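(* Assume that the cylindrical Lévy process $L$ in $U$ has weak second moments, i.e. $E[|L(1)u|^2]<\infty$ for all $u\in U$. If the weak solution $(Y(t):t\in[0,T])$ of $\mathrm dY(t)=AY(t)\,\mathrm dt+B\,\mathrm dL(t)$, $Y(0)=y_0$, satisfies $E[\|Y(t)\|^2]<\infty$ for all $t\in[0,T]$, then $Y$ is continuous in mean square, i.e. $Y\in C([0,T];L^2_P(\Omega;V))$.
   Context: Let $(\Omega,\mathcal F,P)$ be a probability space and $U,V$ separable real Hilbert spaces; $A$ generates a strongly continuous semigroup on $V$, $B\in\mathcal L(U,V)$, $y_0\in V$. A cylindrical Lévy process $L$ in $U$ is a family $(L(t))_{t\ge0}$ of linear continuous maps $U\to L^0_P(\Omega;\mathbb R)$ such that for all $u_1,\dots,u_n\in U$ the process $((L(t)u_1,\dots,L(t)u_n))_{t\ge0}$ is a Lévy process in $\mathbb R^n$. A $V$-valued progressively measurable process $(Y(t))_{t\in[0,T]}$ is a weak solution if $t\mapsto\langle Y(t),g(t)\rangle$ is integrable on $[0,T]$ a.s. for each $g\in C([0,T];V)$, $\int_0^T\langle Y(s),g_n(s)\rangle\,\mathrm ds\to0$ in probability whenever $g_n\in C([0,T];V)$ with $\|g_n\|_\infty\to0$, and for every $v\in\mathcal D(A^* )$ and $t\in[0,T]$, a.s., $\langle Y(t),v\rangle=\langle y_0,v\rangle+\int_0^t\langle Y(s),A^*v\rangle\,\mathrm ds+L(t)(B^*v)$. *)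

(* Defs.v *)
From HB Require Import structures.
From mathcomp Require Import all_boot all_order all_algebra.
From mathcomp Require Import all_classical all_reals all_analysis.
Set Implicit Arguments. Unset Strict Implicit. Unset Printing Implicit Defensive.
Import Order.TTheory GRing.Theory Num.Theory.
Import numFieldNormedType.Exports.
Local Open Scope classical_set_scope.
Local Open Scope ring_scope.

Section Defs.
Context {R : realType}.

Definition separable_hilbert (V : completeNormedModType R) (ip : V -> V -> R) :=
  [/\ (forall x y, ip x y = ip y x),
      (forall (a : R) x y z, ip (a *: x + y) z = a * ip x z + ip y z),
      (forall x, `|x| ^+ 2 = ip x x) &
      exists D : set V, countable D /\ closure D = setT].

Definition bounded_linear (U V : normedModType R) (B : U -> V) :=
  (forall (a : R) u w, B (a *: u + w) = a *: B u + B w) /\ continuous B.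

Definition C0_semigroup (V : normedModType R) (S : R -> V -> V) :=
  [/\ (forall t, 0 <= t -> bounded_linear (S t)),
      (forall v, S 0 v = v),
      (forall t s v, 0 <= t -> 0 <= s -> S (t + s) v = S t (S s v)) &
      (forall v, S^~ v @ 0^'+ --> v)].

Definition generator_of (V : normedModType R) (S : R -> V -> V)
    (A : V -> V) (DA : set V) :=
  (forall v, DA v <-> exists w : V, (fun h => h^-1 *: (S h v - v)) @ 0^'+ --> w) /\
  (forall v, DA v -> (fun h => h^-1 *: (S h v - v)) @ 0^'+ --> A v).

Definition generates_C0 (V : normedModType R) (A : V -> V) (DA : set V) :=
  exists S, C0_semigroup S /\ generator_of S A DA.

Definition adjoint_graph (V : normedModType R) (ip : V -> V -> R)
    (A : V -> V) (DA : set V) (v w : V) :=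
  forall x, DA x -> ip (A x) v = ip x w.

Variables (d : measure_display) (Omega : measurableType d) (P : probability Omega R).

Definition borel (X : topologicalType) : set (set X) :=
  <<s [set O : set X | open O] >>.

(** Lévy process in R^n (Applebaum's definition: starts at 0, independent and
    stationary increments, stochastically continuous) *)
Definition levy_process (n : nat) (X : R -> Omega -> 'rV[R]_n) :=
  [/\ (forall t (i : 'I_n), measurable_fun setT (fun w => X t w 0 i)),
      {ae P, forall w, X 0 w = 0},
      (forall (m : nat) (t : nat -> R) (Bs : nat -> set 'rV[R]_n),
          0 <= t 0%N -> (forall k, t k < t k.+1) -> (forall k, borel (Bs k)) ->
          P (\bigcap_(k in `I_m) [set w | Bs k (X (t k.+1) w - X (t k) w)]) =
          \big[*%E/1%E]_(k < m) P [set w | Bs k (X (t k.+1) w - X (t k) w)]),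
      (forall s t (Bo : set 'rV[R]_n), 0 <= s -> s <= t -> borel Bo ->
          P [set w | Bo (X t w - X s w)] = P [set w | Bo (X (t - s) w)]) &
      (forall t (e : R), 0 <= t -> 0 < e ->
          (fun s => P [set w | e < `|X s w - X t w|])
            @ within [set s | 0 <= s] (nbhs t) --> 0%E)].

Definition cvg_in_prob (Z : nat -> Omega -> R) (Z0 : Omega -> R) :=
  forall e : R, 0 < e ->
    (fun k => P [set w | e < `|Z k w - Z0 w|]) @ \oo --> 0%E.

(** cylindrical Lévy process in U: a family of linear continuous maps
    U -> L^0_P(Omega; R) (linearity holds as an equality in L^0, i.e. a.s.)
    such that every finite-dimensional projection is a Lévy process *)
Definition cylindrical_levy (U : normedModType R) (L : R -> U -> Omega -> R) :=
  [/\ (forall t u, measurable_fun setT (L t u)),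
      (forall t (a : R) u v, 0 <= t ->
          {ae P, forall w, L t (a *: u + v) w = a * L t u w + L t v w}),
      (forall t (u_ : nat -> U) u, 0 <= t -> u_ @ \oo --> u ->
          cvg_in_prob (fun k => L t (u_ k)) (L t u)) &
      (forall (n : nat) (u : 'I_n -> U),
          levy_process (fun t w => \row_(i < n) L t (u i) w))].

Definition filtration (F : R -> set (set Omega)) :=
  [/\ (forall t, sigma_algebra setT (F t)),
      (forall t, F t `<=` measurable) &
      (forall s t, s <= t -> F s `<=` F t)].

Definition prog_measurable (V : normedModType R) (F : R -> set (set Omega))
    (Tend : R) (Y : R -> Omega -> V) :=
  forall t, 0 <= t <= Tend -> forall Bo : set V, borel Bo ->
    <<s [set I `*` E | I in [set I : set R | measurable I /\ I `<=` `[0, t]]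
                     & E in F t] >>
      [set p : R * Omega | 0 <= p.1 <= t /\ Bo (Y p.1 p.2)].

Definition weak_solution (U V : normedModType R) (ipV : V -> V -> R)
    (A : V -> V) (DA : set V) (Bstar : V -> U) (y0 : V)
    (L : R -> U -> Omega -> R) (Tend : R) (F : R -> set (set Omega))
    (Y : R -> Omega -> V) :=
  [/\ prog_measurable F Tend Y,
      (forall g : R -> V, {within `[0, Tend], continuous g} ->
         {ae P, forall w, (@lebesgue_measure R).-integrable `[0, Tend]
                   (fun s => (ipV (Y s w) (g s))%:E)}),
      (forall g : nat -> R -> V,
         (forall k, {within `[0, Tend], continuous g k}) ->
         (forall e : R, 0 < e -> \forall k \near \oo,
             forall s, 0 <= s <= Tend -> `|g k s| <= e) ->
         cvg_in_prob
           (fun k w => Rintegral (@lebesgue_measure R) `[0, Tend]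
                          (fun s => ipV (Y s w) (g k s)))
           (fun _ => 0)) &
      (forall v Av, adjoint_graph ipV A DA v Av ->
       forall t, 0 <= t <= Tend ->
         {ae P, forall w, ipV (Y t w) v =
            ipV y0 v + Rintegral (@lebesgue_measure R) `[0, t]
                         (fun s => ipV (Y s w) Av) + L t (Bstar v) w})].

End Defs.

(* Main.v *)
(** Let [W_{a,b} = Y b - S (b - a) (Y a)] and [X_t = W_{0,t}].  Test the weak
    equation with [p_n s = B_n s v], the Bernstein polynomial built from the powers of
    [K = S^*((b - a) / n)]: it joins [S^*(b - a) v] at [a] to [v] at [b], and [p_n' + A^* p_n]
    tends to [0] uniformly when [v] is smooth for [S^*], so the continuity of the
    time integral kills this term and Fatou's lemma gives
    [E (<W_{a,b}, v> - (L b - L a) (B^* v))^2 = O((b - a)^3)].  Summing over the intervals of a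
    partition, [<W_{a,b}, v>] is an L^2 limit of sums of independent increments of [L].
    Consequently its first two moments depend on [b - a] only, [Var <X_t, v>] is
    nondecreasing in [t], and [E <X_t, v>] is Lipschitz in [t]; smooth vectors are
    weakly dense, so this holds for all [v].  Monotonicity bounds the tail of
    [E |X_h|^2 = \sum_n E <X_h, e_n>^2] by that of the convergent series for [X_T], hence
    [E |W_{a,b}|^2 = E |X_{b - a}|^2] tends to [0] with [b - a].  The remaining terms
    [(S h - 1) Y_t] and [(S h - 1) X_s] for [s < t] are handled by dominated convergence, the
    latter after comparison with [(S h - 1) X_t], by monotonicity again. *)

Require Import Defs.
From HB Require Import structures.
From mathcomp Require Import all_boot all_order all_algebra.
From mathcomp Require Import all_classical all_reals all_analysis.
From mathcomp Require Import measurable_realfun.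
From mathcomp Require Import ring lra.
Set Implicit Arguments. Unset Strict Implicit. Unset Printing Implicit Defensive.
Import Order.TTheory GRing.Theory Num.Theory.
Import numFieldNormedType.Exports.
Local Open Scope classical_set_scope.
Local Open Scope ring_scope.

(** The drift is therefore treated in probability only, and all moment bounds come from increments
    of [L] through Fatou's lemma. The natural test function [Ss (b - s) v] moves with time, whereas
    the weak equation concerns fixed vectors, off a null set depending on the vector and the time. A
    Bernstein polynomial is a finite combination of fixed vectors in the domain of the adjoint
    generator with smooth scalar coefficients, for which integration by parts is a scalar matter.
    The exponent 3 is what makes partitions work: the errors on the M + 1 pieces are not known to be
    orthogonal, the crude bound for their sum costs a factor (M + 1)^2, and (M + 1)^-3 beats it.
    Means, unlike variances, are not monotone in time; they are handled as linear functionals of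
    small norm, whose coefficients are square summable by Bessel's inequality. *)

Lemma sum_ord_sub (W : zmodType) (m n : nat) (G H : nat -> W) : (m <= n)%N ->
  (forall i, (i < m)%N -> H i = 0) -> (forall i, (m <= i)%N -> H i = G i) ->
  \sum_(i < n) G i - \sum_(i < m) G i = \sum_(i < n) H i.
Proof.
move=> mn h1 h2; rewrite -!(big_mkord xpredT) !(big_cat_nat (leq0n _) mn)/=.
rewrite addrAC subrr add0r [X in _ = X + _]big_nat_cond.
rewrite [X in _ = X + _]big1 ?add0r; first by apply: eq_big_nat => i /andP[/h2].
by move=> i /andP[/andP[_ /h1]].
Qed.

(** * Separable Hilbert spaces *)

Section Hilbert.
Context {R : realType} {V : completeNormedModType R} (ip : V -> V -> R).
Hypothesis hV : separable_hilbert ip.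

Lemma ipC x y : ip x y = ip y x. Proof. by case: hV. Qed.

Lemma ipPl a x y z : ip (a *: x + y) z = a * ip x z + ip y z.
Proof. by case: hV. Qed.

Lemma ip_norm x : `|x| ^+ 2 = ip x x. Proof. by case: hV. Qed.

Lemma ip0l z : ip 0 z = 0.
Proof. by have := ipPl 1 0 0 z; rewrite scaler0 addr0 => ?; lra. Qed.

Lemma ipZl a x z : ip (a *: x) z = a * ip x z.
Proof. by rewrite -[a *: x]addr0 ipPl ip0l addr0. Qed.

Lemma ipDl x y z : ip (x + y) z = ip x z + ip y z.
Proof. by rewrite -[x]scale1r ipPl scale1r mul1r. Qed.

Lemma ipNl x z : ip (- x) z = - ip x z.
Proof. by rewrite -scaleN1r ipZl mulN1r. Qed.

Lemma ipBl x y z : ip (x - y) z = ip x z - ip y z.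
Proof. by rewrite ipDl ipNl. Qed.

Lemma ip0r z : ip z 0 = 0. Proof. by rewrite ipC ip0l. Qed.

Lemma ipZr a x z : ip z (a *: x) = a * ip z x.
Proof. by rewrite ipC ipZl ipC. Qed.

Lemma ipDr x y z : ip z (x + y) = ip z x + ip z y.
Proof. by rewrite ipC ipDl !(ipC z). Qed.

Lemma ipNr x z : ip z (- x) = - ip z x.
Proof. by rewrite ipC ipNl ipC. Qed.

Lemma ipBr x y z : ip z (x - y) = ip z x - ip z y.
Proof. by rewrite ipDr ipNr. Qed.

Lemma ip_suml (I : Type) (r : seq I) (F : I -> V) z :
  ip (\sum_(i <- r) F i) z = \sum_(i <- r) ip (F i) z.
Proof.
by elim: r => [|i r ih]; rewrite ?big_nil ?ip0l// !big_cons ipDl ih.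
Qed.

Lemma ip_ge0 x : 0 <= ip x x. Proof. by rewrite -ip_norm sqr_ge0. Qed.

Lemma ip_CS x y : `|ip x y| <= `|x| * `|y|.
Proof.
rewrite -(@ler_pXn2r _ 2)// ?nnegrE ?mulr_ge0// real_normK ?num_real// exprMn !ip_norm.
have [y0|y0] := eqVneq (ip y y) 0.
  have /eqP : `|y| ^+ 2 = 0 by rewrite ip_norm.
  by rewrite sqrf_eq0 normr_eq0 => /eqP ->; rewrite !ip0r expr0n mulr0.
have yp : 0 < ip y y by rewrite lt_neqAle eq_sym y0 ip_ge0.
have := ip_ge0 (ip y y *: x - ip x y *: y).
rewrite !(ipBl, ipBr, ipZl, ipZr) (ipC y x).
set a := ip x x; set b := ip x y; set c := ip y y.
move=> h; have : 0 <= c * (a * c - b ^+ 2) by lra.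
by rewrite pmulr_rge0// subr_ge0.
Qed.

Lemma ip_inj a b : (forall x, ip x a = ip x b) -> a = b.
Proof.
move=> h; apply/eqP; rewrite -subr_eq0 -normr_eq0 -sqrf_eq0 ip_norm.
by rewrite ipBr h subrr.
Qed.

Lemma norm_le_ip (c : R) a : 0 <= c -> (forall x, ip x a <= c * `|x|) -> `|a| <= c.
Proof.
move=> c0 h; have := h a; rewrite -ip_norm expr2.
have [->|a0] := eqVneq a 0; first by rewrite normr0.
by rewrite ler_pM2r// normr_gt0.
Qed.

Lemma sqr_normD x y : `|x + y| ^+ 2 = `|x| ^+ 2 + 2 * ip x y + `|y| ^+ 2.
Proof. by rewrite !ip_norm !(ipDl, ipDr) (ipC y x); ring. Qed.

Lemma ip_continuous y : continuous (ip^~ y).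
Proof.
move=> x; apply/cvgrPdist_lt => e e0.
have c0 : 0 < `|y| + 1 by rewrite ltr_wpDl.
near=> z; rewrite -ipBl; apply: (le_lt_trans (ip_CS _ _)).
apply: (@le_lt_trans _ _ (`|x - z| * (`|y| + 1))).
  by rewrite ler_wpM2l// lerDl.
rewrite -ltr_pdivlMr//; near: z.
by apply: cvgr_dist_lt => //; rewrite divr_gt0.
Unshelve. all: by end_near. Qed.

Lemma cvg_ipl (T : Type) (F : set_system T) {FF : Filter F} (f : T -> V) l y :
  f @ F --> l -> (fun t => ip (f t) y) @ F --> ip l y.
Proof. by move=> fl; exact: (cvg_comp f (ip^~ y) fl (@ip_continuous y l)). Qed.

Lemma dense_sequence : exists d : nat -> V,
  forall x (e : R), 0 < e -> exists k, `|x - d k| < e.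
Proof.
have [_ _ _ [D [/countable_injP[f finj] Dd]]] := hV.
exists (fun n => xget 0 [set x | D x /\ f x = n]) => x e e0.
have : closure D x by rewrite Dd.
move=> /(_ (ball x e))[|z [Dz bz]]; first exact: nbhsx_ballx.
exists (f z); case: xgetP => [y _ [Dy fy]|/(_ z)]; last first.
  by move=> h; exfalso; apply: h; split.
by have -> : y = z; [apply: finj => //; rewrite inE|rewrite -ball_normE in bz].
Qed.

Section GramSchmidt.
Variable d : nat -> V.

Let proj (s : seq V) x := \sum_(e <- s) ip x e *: e.
Let res s x := x - proj s x.
Let unit_res s x := `|res s x|^-1 *: res s x.

Fixpoint gram_schmidt_seq n : seq V :=
  if n is m.+1 then rcons (gram_schmidt_seq m) (unit_res (gram_schmidt_seq m) (d m)) else [::].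

(* Either a unit vector or [0], the latter since [0^-1 = 0]; dependent vectors of [d]
   therefore need not be discarded. *)
Definition gram_schmidt n := unit_res (gram_schmidt_seq n) (d n).
Local Notation e := gram_schmidt.

Lemma gram_schmidt_seqE n (F : V -> V) :
  \sum_(x <- gram_schmidt_seq n) F x = \sum_(i < n) F (e i).
Proof.
elim: n => [|n ih]; first by rewrite big_nil big_ord0.
by rewrite /= -cats1 big_cat big_seq1 ih big_ord_recr.
Qed.

Let resE n : res (gram_schmidt_seq n) (d n) = d n - \sum_(i < n) ip (d n) (e i) *: e i.
Proof. by rewrite /res /proj gram_schmidt_seqE. Qed.

Lemma gram_schmidt_unit n : ip (e n) (e n) = 1 \/ e n = 0.
Proof.
rewrite /gram_schmidt /unit_res.
have [->|r0] := eqVneq (res (gram_schmidt_seq n) (d n)) 0.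
  by right; rewrite scaler0.
by left; rewrite -ip_norm normrZ normfV normr_id mulVf ?expr1n// normr_eq0.
Qed.

Lemma gram_schmidt_orth i j : i != j -> ip (e i) (e j) = 0.
Proof.
have main n : forall i, (i < n)%N -> ip (e n) (e i) = 0.
  elim/ltn_ind: n => n IH k kn.
  rewrite {1}/gram_schmidt /unit_res ipZl resE ipBl ip_suml.
  suff -> : \sum_(i < n) ip (ip (d n) (e i) *: e i) (e k) = ip (d n) (e k).
    by rewrite subrr mulr0.
  rewrite (bigD1 (Ordinal kn))//= ipZl big1 => [|l /eqP lk].
    by case: (gram_schmidt_unit k) => ->; rewrite ?ip0r ?mulr1 ?mulr0 addr0.
  rewrite ipZl; case: (ltngtP l k) => h.
  - by rewrite (ipC (e l)) IH ?mulr0.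
  - by rewrite IH ?mulr0.
  - by case: lk; apply: val_inj.
case: (ltngtP i j) => // h _; [rewrite ipC|]; exact: main.
Qed.

Definition gram_schmidt_proj n x := \sum_(i < n) ip x (e i) *: e i.

(** Only an inequality, because the zero vectors of the family contribute nothing on the left. *)
Lemma gram_schmidt_sum_sqr n (a : nat -> R) :
  `|\sum_(i < n) a i *: e i| ^+ 2 <= \sum_(i < n) a i ^+ 2.
Proof.
elim: n => [|n ih]; first by rewrite !big_ord0 normr0 expr0n.
rewrite !big_ord_recr/= sqr_normD ipZr ip_suml [X in a n * X]big1 ?mulr0 ?addr0; last first.
  by move=> i _; rewrite ipZl gram_schmidt_orth ?mulr0// ltn_eqF.
rewrite lerD// ip_norm ipZl ipZr.
case: (gram_schmidt_unit n) => ->; first by rewrite mulr1 expr2.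
by rewrite ip0l !mulr0 sqr_ge0.
Qed.

Lemma gram_schmidt_projB n x y :
  gram_schmidt_proj n (x - y) = gram_schmidt_proj n x - gram_schmidt_proj n y.
Proof.
rewrite /gram_schmidt_proj -sumrB; apply: eq_bigr => i _.
by rewrite ipBl scalerBl.
Qed.

Lemma gram_schmidt_proj_norm n x :
  `|x - gram_schmidt_proj n x| ^+ 2 = `|x| ^+ 2 - \sum_(i < n) ip x (e i) ^+ 2.
Proof.
elim: n => [|n ih]; first by rewrite /gram_schmidt_proj !big_ord0 !subr0.
rewrite /gram_schmidt_proj !big_ord_recr/= opprD addrA sqr_normD ih.
rewrite normrN normrZ exprMn real_normK ?num_real// ip_norm ipNr ipZr ipBl ip_suml [X in _ * (_ - X)]big1; last first.
  by move=> i _; rewrite ipZl gram_schmidt_orth ?mulr0// ltn_eqF.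
by rewrite ip_norm; case: (gram_schmidt_unit n) => ->; rewrite ?ip0r; ring.
Qed.

Lemma gram_schmidt_span k n : (k < n)%N -> gram_schmidt_proj n (d k) = d k.
Proof.
have base : gram_schmidt_proj k.+1 (d k) = d k.
  rewrite /gram_schmidt_proj big_ord_recr/=.
  have eN : `|res (gram_schmidt_seq k) (d k)| *: e k = res (gram_schmidt_seq k) (d k).
    rewrite /gram_schmidt /unit_res scalerA.
    have [->|r0] := eqVneq (res (gram_schmidt_seq k) (d k)) 0; first by rewrite scaler0.
    by rewrite mulfV ?scale1r// normr_eq0.
  have -> : ip (d k) (e k) = `|res (gram_schmidt_seq k) (d k)|.
    have -> : ip (d k) (e k) = ip (res (gram_schmidt_seq k) (d k)) (e k) +
        ip (\sum_(i < k) ip (d k) (e i) *: e i) (e k) by rewrite -ipDl resE subrK.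
    rewrite ip_suml big1 => [|i _].
      rewrite -eN ipZl.
      case: (gram_schmidt_unit k) => [->|e0]; first by rewrite mulr1 addr0 eN.
      by rewrite e0 ip0r mulr0 scaler0 addr0 normr0.
    by rewrite ipZl gram_schmidt_orth ?mulr0// ltn_eqF.
  by rewrite eN resE addrC subrK.
(* By [gram_schmidt_proj_norm] the squared residual decreases with the number of vectors; it
   vanishes at [k.+1], hence at every later [n]. *)
move=> kn; apply/eqP; rewrite eq_sym -subr_eq0 -normr_eq0 -sqrf_eq0.
rewrite eq_le sqr_ge0 andbT gram_schmidt_proj_norm subr_le0.
have /eqP : `|d k - gram_schmidt_proj k.+1 (d k)| ^+ 2 = 0.
  by rewrite base subrr normr0 expr0n.
rewrite gram_schmidt_proj_norm subr_eq0 => /eqP ->.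
rewrite -!(big_mkord xpredT (fun i => ip (d k) (e i) ^+ 2)).
by rewrite (big_cat_nat (leq0n _) kn)//= lerDl sumr_ge0// => i _; rewrite sqr_ge0.
Qed.

End GramSchmidt.

(** The family may contain zero vectors; these three properties replace orthonormality from here on.
    The projection of [d k] is exact from index [k.+1] on, so the residual of [x] equals that of
    [x - d k], whose norm is at most that of [x - d k]. *)
Lemma exists_parseval_basis : exists e : nat -> V,
  [/\ forall x, (fun n => \sum_(i < n) ip x (e i) ^+ 2) @ \oo --> `|x| ^+ 2,
      forall x, (fun n => \sum_(i < n) ip x (e i) *: e i) @ \oo --> x &
      forall n (a : nat -> R), `|\sum_(i < n) a i *: e i| ^+ 2 <= \sum_(i < n) a i ^+ 2].
Proof.
have [d dd] := dense_sequence; exists (gram_schmidt d).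
have pc x : (fun n => gram_schmidt_proj d n x) @ \oo --> x.
  apply/cvgrPdist_lt => eps eps0; have [k dk] := dd x _ eps0.
  exists k.+1 => // n /= kn.
  apply: le_lt_trans dk; rewrite -(@ler_pXn2r _ 2)// ?nnegrE//.
  have -> : x - gram_schmidt_proj d n x =
     (x - d k) - gram_schmidt_proj d n (x - d k).
    by rewrite gram_schmidt_projB (gram_schmidt_span d kn) opprB addrA subrK.
  by rewrite gram_schmidt_proj_norm gerBl sumr_ge0// => i _; rewrite sqr_ge0.
split=> [x|//|n a]; last exact: gram_schmidt_sum_sqr.
have -> : (fun n => \sum_(i < n) ip x (gram_schmidt d i) ^+ 2) =
          (fun n => `|x| ^+ 2 - `|x - gram_schmidt_proj d n x| ^+ 2).
  by apply/funext => n; rewrite gram_schmidt_proj_norm opprB addrC subrK.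
rewrite -[X in _ --> X]subr0; apply: cvgB; first exact: cvg_cst.
have -> : 0 = `|x - x| ^+ 2 by rewrite subrr normr0 expr0n.
apply: (@cvg_comp _ _ _ (fun n => `|x - gram_schmidt_proj d n x|) (fun r => r ^+ 2)); last exact: exprn_continuous.
by apply: cvg_norm; apply: cvgB; [exact: cvg_cst|exact: pc].
Qed.

Definition linear_functional (f : V -> R) := forall a x y, f (a *: x + y) = a * f x + f y.

Lemma linear_functional0 f : linear_functional f -> f 0 = 0.
Proof. by move=> lf; have := lf 1 0 0; rewrite scaler0 addr0 => ?; lra. Qed.

Lemma linear_functional_sum f (I : Type) (r : seq I) (a : I -> R) (x : I -> V) :
  linear_functional f -> f (\sum_(i <- r) a i *: x i) = \sum_(i <- r) a i * f (x i).
Proof.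
move=> lf; elim: r => [|i r ih]; first by rewrite !big_nil linear_functional0.
by rewrite !big_cons lf ih.
Qed.

Lemma linear_functionalB f x y : linear_functional f -> f (x - y) = f x - f y.
Proof. by move=> lf; rewrite addrC -scaleN1r lf; ring. Qed.

(** Evaluating [f] at the sum of the [f (e i) *: e i] gives [s ^+ 2 <= c ^+ 2 * s] for the sum [s]
    of squares. Besides the Riesz representation, it later controls the coefficients of the mean
    functionals uniformly in [n]. *)
Lemma bessel_functional (e : nat -> V) (f : V -> R) c :
  (forall n (a : nat -> R), `|\sum_(i < n) a i *: e i| ^+ 2 <= \sum_(i < n) a i ^+ 2) ->
  linear_functional f -> 0 <= c -> (forall x, `|f x| <= c * `|x|) ->
  forall n, \sum_(i < n) f (e i) ^+ 2 <= c ^+ 2.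
Proof.
move=> he lf c0 fc n; set s := \sum_(i < n) _.
have s0 : 0 <= s by rewrite sumr_ge0// => i _; rewrite sqr_ge0.
have [->|sn0] := eqVneq s 0; first by rewrite sqr_ge0.
have sp : 0 < s by rewrite lt_neqAle eq_sym sn0.
have := fc (\sum_(i < n) f (e i) *: e i).
rewrite linear_functional_sum// -[X in `|X|]/s => fs.
have {fs} : s ^+ 2 <= c ^+ 2 * s.
  rewrite -(ger0_norm s0) (le_trans (lerXn2r 2 _ _ fs))// ?nnegrE// ?mulr_ge0//.
  by rewrite exprMn ler_wpM2l ?sqr_ge0// (ger0_norm s0) (he n (fun i => f (e i))).
by rewrite expr2 ler_pM2r.
Qed.

(** The representing vector is the limit of the partial sums of [f (e i) *: e i]; they are Cauchy
    because the sums of squares increase and stay bounded by Bessel's inequality. *)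
Lemma riesz (f : V -> R) c : linear_functional f ->
  (forall x, `|f x| <= c * `|x|) -> exists y, forall x, f x = ip x y.
Proof.
move=> lf fc0.
have {c fc0} [c c0 fc] : exists2 c, 0 <= c & forall x, `|f x| <= c * `|x|.
  exists `|c| => // x; apply: (le_trans (fc0 x)).
  by rewrite ler_wpM2r// ler_norm.
have [e [e1 e2 e3]] := exists_parseval_basis.
pose s n := \sum_(i < n) f (e i) ^+ 2.
pose y n := \sum_(i < n) f (e i) *: e i.
have snd : nondecreasing_seq s.
  apply/nondecreasing_seqP => n.
  by rewrite /s big_ord_recr/= lerDl sqr_ge0.
have scv : cvgn s.
  apply: nondecreasing_is_cvgn => //; exists (c ^+ 2) => _ [n _ <-].
  exact: (bessel_functional e3 lf c0 fc).
have ydist m n : (m <= n)%N -> `|y n - y m| ^+ 2 <= s n - s m.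
  (* Zeroing the first [m] coefficients turns the difference into a full sum over [i < n], the form
     to which [e3] applies. *)
  move=> mn; pose a i := if (i < m)%N then 0 else f (e i).
  have -> : y n - y m = \sum_(i < n) a i *: e i.
    apply: (sum_ord_sub (G := fun i => f (e i) *: e i) (H := fun i => a i *: e i) mn) => i im.
      by rewrite /a im scale0r.
    by rewrite /a ltnNge im.
  apply: (le_trans (e3 n a)).
  rewrite -(sum_ord_sub (G := fun i => f (e i) ^+ 2) (H := fun i => a i ^+ 2) mn)// => i im.
    by rewrite /a im expr0n.
  by rewrite /a ltnNge im.
have ycv : cvgn y.
  apply: cauchy_cvg; apply: cauchy_exP => eps eps0.
  have e20 : 0 < eps ^+ 2 by rewrite exprn_gt0.
  have /cvgrPdist_lt /(_ _ e20) [N _ hN] := scv.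
  exists (y N); exists N => // n /= Nn.
  rewrite -ball_normE /= distrC -(@ltr_pXn2r _ 2)// ?nnegrE//; last exact: ltW.
  apply: le_lt_trans (ydist _ _ Nn) _.
  have h1 : s n <= limn s by exact: nondecreasing_cvgn_le.
  have := hN N (leqnn _); apply: le_lt_trans.
  by rewrite (le_trans _ (ler_norm _))// lerD2r.
exists (limn y) => x.
have h1 : (fun n => ip (y n) x) @ \oo --> ip (limn y) x by exact: cvg_ipl.
have h2 : (fun n => ip (y n) x) = (fun n => f (\sum_(i < n) ip x (e i) *: e i)).
  apply/funext => n; rewrite linear_functional_sum// /y ip_suml.
  by apply: eq_bigr => i _; rewrite ipZl mulrC ipC.
rewrite ipC; apply: (@cvg_unique _ (@Rhausdorff R) _ _ _ _ _ h1).
rewrite h2; apply/cvgrPdist_lt => eps eps0.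
near=> n; rewrite -linear_functionalB//; apply: (le_lt_trans (fc _)).
apply: (@le_lt_trans _ _ ((c + 1) * `|x - \sum_(i < n) ip x (e i) *: e i|)).
  by rewrite ler_wpM2r// lerDl.
rewrite -ltr_pdivlMl ?ltr_wpDl// mulrC; near: n.
by apply: cvgr_dist_lt => //; rewrite divr_gt0// ltr_wpDl.
Unshelve. all: by end_near. Qed.

Lemma adjoint_exists (K : V -> V) c : (forall a x y, K (a *: x + y) = a *: K x + K y) ->
  (forall x, `|K x| <= c * `|x|) -> exists Ks : V -> V, forall x y, ip (K x) y = ip x (Ks y).
Proof.
move=> lK Kc; suff : forall y, exists z, forall x, ip (K x) y = ip x z.
  by move=> /choice[Ks h]; exists Ks.
move=> y; apply: (@riesz (fun x => ip (K x) y) (c * `|y|)) => [a x z|x].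
  by rewrite lK ipDl ipZl.
by rewrite (le_trans (ip_CS _ _))// mulrAC ler_wpM2r.
Qed.

End Hilbert.

Lemma bounded_linear_bound (R : realType) (U V : normedModType R) (B : U -> V) :
  bounded_linear B -> exists2 c : R, 0 <= c & forall x, `|B x| <= c * `|x|.
Proof.
move=> [lB cB].
have B0 : B 0 = 0.
  by have := lB (-1) 0 0; rewrite scaler0 addr0 scaleN1r addNr.
have BZ a x : B (a *: x) = a *: B x by rewrite -[a *: x]addr0 lB B0 addr0.
have /cvgrPdist_lt /(_ _ ltr01) := cB 0.
rewrite B0 => /nbhs_ballP [e /= e0 he].
(* Rescaled to norm [e / 2], the vector [x] falls into the ball on which [B] has norm below 1. *)
exists (2 / e) => [|x]; first by rewrite divr_ge0// ltW.
have [->|x0] := eqVneq x 0; first by rewrite B0 !normr0 mulr0.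
have xp : 0 < `|x| by rewrite normr_gt0.
have : `|0 - B ((e / 2 / `|x|) *: x)| < 1.
  apply: he; rewrite -ball_normE /= sub0r normrN normrZ.
  rewrite gtr0_norm ?divr_gt0// divfK ?normr_eq0//.
  by rewrite ltr_pdivrMr// mulr_natr mulr2n ltrDl.
rewrite sub0r normrN BZ normrZ gtr0_norm ?divr_gt0// => h.
rewrite -ler_pdivrMl ?divr_gt0// invf_div; apply/ltW.
by move: h; rewrite mulrAC ltr_pdivrMr// mul1r.
Qed.

(** * Semigroups and their adjoints *)

Section Primitive.
Context {R : realType}.
Implicit Types g G : R -> R.

(* The base point [-1] makes [prim g] differentiable at [0] from both sides. *)
Definition prim g (t : R) : R :=
  Rintegral (@lebesgue_measure R) `[-1, t] g - Rintegral (@lebesgue_measure R) `[-1, 0] g.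

Lemma continuous_itv_integrable g (a b : R) : continuous g ->
  (@lebesgue_measure R).-integrable `[a, b] (EFin \o g).
Proof.
move=> cg; apply: continuous_compact_integrable; first exact: segment_compact.
exact: continuous_subspaceT.
Qed.

Lemma prim_is_derive g : continuous g -> forall x : R, -1 < x -> is_derive x 1 (prim g) (g x).
Proof.
move=> cg x x1.
have xx1 : x < x + 1 by rewrite ltrDl.
have [d1 d2] := continuous_FTC1_closed xx1 (continuous_itv_integrable (-1) (x + 1) cg) x1 (cg x).
have dF : is_derive x 1 (fun y => Rintegral (@lebesgue_measure R) `[-1, y] g) (g x).
  by apply: DeriveDef; [exact: d1|rewrite -derive1E; exact: d2].
rewrite -[g x]subr0; apply: is_deriveB.
Qed.

Lemma prim0 g : prim g 0 = 0. Proof. by rewrite /prim subrr. Qed.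

Lemma prim_mvt g (a b : R) : continuous g -> 0 <= a -> a <= b ->
  exists2 c, a <= c <= b & prim g b - prim g a = g c * (b - a).
Proof.
move=> cg a0 ab.
have h x : x \in `[a, b] -> is_derive x 1 (prim g) (g x).
  by rewrite in_itv/= => /andP[ax _]; apply: prim_is_derive => //; lra.
have h1 x : x \in `]a, b[ -> is_derive x 1 (prim g) (g x).
  by move=> xab; apply: h; exact: subset_itv_oo_cc.
have h2 : {within `[a, b], continuous (prim g)}.
  by apply: derivable_within_continuous => x xab; have [] := h x xab.
have [c cab E] := MVT_segment ab h1 h2.
by exists c => //; move: cab; rewrite in_itv.
Qed.

Lemma prim_unique g G (t : R) : continuous g -> 0 <= t ->
  (forall x, 0 <= x <= t -> is_derive x 1 G (g x)) -> G t - G 0 = prim g t.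
Proof.
move=> cg t0 dG.
have h x : x \in `[0, t] -> is_derive x 1 (fun y => G y - prim g y) 0.
  rewrite in_itv/= => xt; rewrite -(subrr (g x)).
  have := dG x xt; have /andP[x0 _] := xt.
  have : is_derive x 1 (prim g) (g x) by apply: prim_is_derive => //; lra.
  by move=> ? ?; apply: is_deriveB.
have h1 x : x \in `]0, t[ -> is_derive x 1 (fun y => G y - prim g y) ((fun=> 0) x).
  by move=> xab; apply: h; exact: subset_itv_oo_cc.
have h2 : {within `[0, t], continuous (fun y => G y - prim g y)}.
  by apply: derivable_within_continuous => x xab; have [] := h x xab.
have [c cab] := MVT_segment t0 h1 h2.
by rewrite prim0 => ?; lra.
Qed.

Lemma prim_bound g (t c : R) : continuous g -> 0 <= t ->
  (forall s, 0 <= s <= t -> `|g s| <= c) -> `|prim g t| <= c * t.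
Proof.
move=> cg t0 gc; have [s st] := prim_mvt cg (lexx 0) t0.
by rewrite prim0 !subr0 => ->; rewrite normrM (ger0_norm t0) ler_wpM2r// gc.
Qed.

Lemma primD g1 g2 (a t : R) : continuous g1 -> continuous g2 -> 0 <= t ->
  prim (fun s => a * g1 s + g2 s) t = a * prim g1 t + prim g2 t.
Proof.
move=> c1 c2 t0.
have h1 : continuous (fun s => a * g1 s + g2 s).
  move=> x; apply: (@continuousD _ _ _ (fun s => a * g1 s) g2); last exact: c2.
  by apply: (@continuousM _ _ (fun=> a) g1); [exact: cst_continuous|exact: c1].
have h2 x : 0 <= x <= t -> is_derive x 1 (fun t => a * prim g1 t + prim g2 t) (a * g1 x + g2 x).
  move=> /andP[x0 _].
  have x1 : -1 < x by lra.
  have d1 := prim_is_derive c1 x1; have d2 := prim_is_derive c2 x1.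
  apply: (@is_deriveD _ _ _ (fun t => a * prim g1 t) (prim g2)).
by have := prim_unique h1 t0 h2; rewrite !prim0 mulr0 addr0 subr0 => <-.
Qed.

Lemma prim_eq g1 g2 (t : R) : continuous g1 -> continuous g2 -> 0 <= t ->
  (forall s, 0 <= s <= t -> g1 s = g2 s) -> prim g1 t = prim g2 t.
Proof.
move=> c1 c2 t0 g12.
have c12 : continuous (fun s => -1 * g1 s + g2 s).
  move=> x; apply: (@continuousD _ _ _ (fun s => -1 * g1 s) g2); last exact: c2.
  by apply: (@continuousM _ _ (fun=> -1) g1); [exact: cst_continuous|exact: c1].
have := @prim_bound _ t 0 c12 t0.
rewrite primD// mul0r normr_le0 mulN1r addrC subr_eq0 => h.
apply/esym/eqP/h => s st; rewrite g12// mulN1r addNr normr0//.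
Qed.

Lemma prim_cst (k t : R) : 0 <= t -> prim (fun=> k) t = k * t.
Proof.
move=> t0; have h1 : continuous (fun _ : R => k) by exact: cst_continuous.
have h2 x : 0 <= x <= t -> is_derive x 1 (fun t : R => k * t) k.
  move=> _; rewrite -[X in is_derive _ _ _ X]mulr1.
  exact: (is_deriveZ k (is_derive_id x 1)).
by have := prim_unique h1 t0 h2; rewrite mulr0 subr0 => <-.
Qed.

Lemma continuous_comp_addr g (h : R) : continuous g -> continuous (fun s => g (s + h)).
Proof.
move=> cg x; apply: (@continuous_comp _ _ _ (fun s => s + h) g); last exact: cg.
by apply: (@continuousD _ _ _ (fun s => s) (fun=> h)); [exact: id|exact: cst_continuous].
Qed.

Lemma prim_shift g (h t : R) : continuous g -> 0 <= h -> 0 <= t ->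
  prim (fun s => g (s + h)) t = prim g (t + h) - prim g h.
Proof.
move=> cg h0 t0.
have h2 x : 0 <= x <= t -> is_derive x 1 (fun t => prim g (t + h)) (g (x + h)).
  move=> /andP[x0 _].
  have d1 : is_derive (x + h) 1 (prim g) (g (x + h)) by apply: prim_is_derive => //; lra.
  have d2 : is_derive x 1 (shift h) (1 : R) by exact: is_derive_shift.
  have := @is_derive1_comp _ (prim g) (shift h) x _ _ d1 d2.
  by rewrite mulr1.
by have := prim_unique (@continuous_comp_addr g h cg) t0 h2; rewrite add0r => <-.
Qed.

Lemma prim_rderiv g (a : R) : continuous g -> 0 <= a ->
  (fun h => h^-1 * (prim g (a + h) - prim g a)) @ 0^'+ --> g a.
Proof.
move=> cg a0; apply/cvgrPdist_lt => e e0.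
have /cvgrPdist_lt /(_ e e0) /nbhs_ballP [d /= d0 hd] := cg a.
near=> h.
have h0 : 0 < h by near: h; exact: nbhs_right_gt.
have hlt : h < d by near: h; exact: nbhs_right_lt.
have aah : a <= a + h by rewrite lerDl ltW.
have [c /andP[ac cb] ->] := prim_mvt cg a0 aah.
rewrite (addrC a h) addrK mulrC mulfK ?gt_eqF//; apply: hd.
by rewrite -ball_normE /= distrC ger0_norm; lra.
Unshelve. all: by end_near. Qed.

End Primitive.

(** * Local bounds and continuity of trajectories *)

Section SemigroupBound.
Context {R : realType} {V : completeNormedModType R} (S : R -> V -> V).
Hypothesis hS : C0_semigroup S.

Lemma semigroup_linear t a x y : 0 <= t -> S t (a *: x + y) = a *: S t x + S t y.
Proof. by case: hS => h _ _ _ t0; case: (h t t0). Qed.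

Lemma semigroup0 x : S 0 x = x. Proof. by case: hS. Qed.

Lemma semigroupD t s x : 0 <= t -> 0 <= s -> S (t + s) x = S t (S s x).
Proof. by case: hS => _ _ h _; exact: h. Qed.

Lemma semigroupB t x y : 0 <= t -> S t (x - y) = S t x - S t y.
Proof.
by move=> t0; rewrite addrC -scaleN1r semigroup_linear// scaleN1r addrC.
Qed.

Lemma semigroupZ t a x : 0 <= t -> S t (a *: x) = a *: S t x.
Proof.
move=> t0; have S0 : S t 0 = 0 by have := semigroupB 0 0 t0; rewrite !subrr.
by rewrite -[a *: x]addr0 semigroup_linear// S0 addr0.
Qed.

Lemma semigroup_near0 x (e : R) : 0 < e ->
  exists2 d : R, 0 < d & forall h, 0 <= h -> h < d -> `|S h x - x| < e.
Proof.
case: hS => _ S0 _ h e0.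
have /cvgrPdist_lt /(_ e e0) := h x.
rewrite near_withinE => /nbhs_ballP[d /= d0 hd]; exists d => // s s0 sd.
move: s0; rewrite le_eqVlt => /predU1P[<-|s0]; first by rewrite S0 subrr normr0.
rewrite distrC; apply: hd => //.
by rewrite -ball_normE/= sub0r normrN gtr0_norm.
Qed.

(** Otherwise there are times tending to 0 whose operators have unbounded norms. They are pointwise
    bounded by strong continuity at 0, which contradicts the uniform boundedness principle. *)
Lemma semigroup_bound_near0 : exists d C : R, [/\ 0 < d, 1 <= C &
  forall t x, 0 <= t -> t <= d -> `|S t x| <= C * `|x|].
Proof.
apply: contrapT => /forallNP hn.
have {}hn n : exists tx : R * V, [/\ 0 <= tx.1, tx.1 <= n.+1%:R^-1 &
    n.+1%:R * `|tx.2| < `|S tx.1 tx.2|].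
  have /forallNP/(_ n.+1%:R) hn' := hn n.+1%:R^-1.
  apply: contrapT => /forallNP hn''; apply: hn'; split => //.
    by rewrite ler1n.
  move=> t x t0 tn; rewrite leNgt; apply/negP => h.
  by apply: (hn'' (t, x)).
have [tx /all_and3 [t0 tn txn]] := choice hn.
pose F : set (V -> V) := [set S (tx n).1 | n in setT].
have hF f : F f -> bounded_fun_norm f /\ linear f.
  move=> [n _ <-]; split; last by move=> a x y; exact: semigroup_linear.
  case: hS => /(_ _ (t0 n)) /bounded_linear_bound [c c0 hc] _ _ _ r.
  by exists (c * r) => x xr; rewrite (le_trans (hc x))// ler_wpM2l.
have pF : pointwise_bounded F.
  move=> x; have [d d0 hd] := semigroup_near0 x ltr01.
  pose N := (Num.truncn d^-1).+1.
  (* From index [N] on the time is below [d] and the value lies within 1 of [x]; the sum covers the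
     finitely many earlier indices. *)
  exists (`|x| + 1 + \sum_(i < N) `|S (tx i).1 x|) => _ [n _ <-].
  have [nN|Nn] := ltnP n N.
    rewrite (bigD1 (Ordinal nN))//= addrCA lerDl addr_ge0 ?addr_ge0//.
    by rewrite sumr_ge0.
  rewrite -[leLHS]addr0 lerD ?sumr_ge0//.
  rewrite -[S _ x](subrK x) addrC (le_trans (ler_normD _ _))// lerD2l.
  apply/ltW/hd => //; apply: (le_lt_trans (tn n)).
  rewrite -[ltRHS]invrK ltf_pV2 ?posrE ?invr_gt0//.
  apply: (lt_le_trans (truncnS_gt _)); rewrite ler_nat.
  exact: leq_trans Nn _.
have [M hM] := Banach_Steinhauss hF pF 1.
have hM' n x : `|S (tx n).1 x| <= M * `|x|.
  have [->|x0] := eqVneq x 0.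
    by have := semigroupB 0 0 (t0 n); rewrite !subrr => ->; rewrite !normr0 mulr0.
  have xp : 0 < `|x| by rewrite normr_gt0.
  have := hM _ (ex_intro2 _ _ n I erefl) (`|x|^-1 *: x).
  rewrite normrZ normfV normr_id mulVf ?gt_eqF// semigroupZ// normrZ normfV normr_id.
  by rewrite ler_pdivrMl// mulrC; apply.
have [n Mn] : exists n : nat, M <= n.+1%:R.
  by exists (Num.truncn M); exact/ltW/truncnS_gt.
have := txn n; rewrite ltNge => /negP; apply.
by rewrite (le_trans (hM' n _))// ler_wpM2r.
Qed.

Lemma semigroup_bound (T : R) : exists2 C : R, 1 <= C &
  forall t x, 0 <= t -> t <= T -> `|S t x| <= C * `|x|.
Proof.
have [d [C [d0 C1 hC]]] := semigroup_bound_near0.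
have C0 : 0 <= C by apply: le_trans C1.
have main n : forall t x, 0 <= t -> t <= n%:R * d -> `|S t x| <= C ^+ n.+1 * `|x|.
  elim: n => [|n ih] t x t0.
    by rewrite mul0r => td; rewrite expr1 hC// (le_trans td)// ltW.
  have [td _|td tn] := leP t d.
    rewrite (le_trans (hC _ _ t0 td))// ler_wpM2r// exprS ler_peMr//.
    by rewrite exprn_ege1.
  have -> : t = d + (t - d) by lra.
  have td0 : 0 <= t - d by lra.
  rewrite (semigroupD x (ltW d0) td0) (le_trans (hC _ _ (ltW d0) (lexx _)))//.
  rewrite exprS -mulrA ler_wpM2l// ih//.
  by move: tn; rewrite -natr1; lra.
exists (C ^+ (Num.truncn (T / d)).+2) => [|t x t0 tT]; first by rewrite exprn_ege1.
apply: main => //; rewrite (le_trans tT)// -ler_pdivrMr//.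
exact/ltW/truncnS_gt.
Qed.

(* Frozen at [x] for negative times, so as to be continuous on the whole line. *)
Definition traj (x : V) (s : R) : V := S (Num.max s 0) x.

Lemma trajE x s : 0 <= s -> traj x s = S s x.
Proof. by move=> s0; rewrite /traj max_l. Qed.

(** For [a <= b] the difference of values is [S a (S (b - a) x - x)], small by the local bound on
    [S] and continuity at 0. This includes left continuity, which the definition of the semigroup
    does not state. *)
Lemma traj_continuous x : continuous (traj x).
Proof.
move=> t; apply/cvgrPdist_lt => e e0.
have [C C1 hC] := semigroup_bound (`|t| + 1).
have C0 : 0 < C by apply: lt_le_trans C1.
have [d d0 hd] := semigroup_near0 x (divr_gt0 e0 C0).
have key a b : 0 <= a -> a <= b -> a <= `|t| + 1 -> b - a < d -> `|S b x - S a x| < e.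
  move=> a0 ab at1 bad.
  have -> : S b x = S a (S (b - a) x).
    by rewrite -semigroupD ?subr_ge0// addrC subrK.
  rewrite -semigroupB//.
  apply: (le_lt_trans (hC _ _ a0 at1)).
  by rewrite mulrC -ltr_pdivlMr// hd ?subr_ge0.
exists (Num.min d 1); first by rewrite /= lt_min d0 ltr01.
move=> s; rewrite /= lt_min => /andP[sd s1].
have ts : `|Num.max t 0 - Num.max s 0| <= `|t - s|.
  by case: (leP t 0); case: (leP s 0); move=> ? ?; rewrite ler_norml; apply/andP; split;
    have [] := (ler_norm (t - s), ler_norm (s - t)); rewrite (distrC s t); lra.
have b1 : Num.max t 0 <= `|t| + 1.
  by case: (leP t 0) => _; [|apply: (le_trans (ler_norm t))]; rewrite ?addr_ge0 ?lerDl.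
have b2 : Num.max s 0 <= `|t| + 1.
  case: (leP s 0) => _; first by rewrite addr_ge0.
  have := ler_norm (s - t); rewrite distrC; have := ler_norm t; lra.
have m0 (r : R) : 0 <= Num.max r 0 by rewrite le_max lexx orbT.
rewrite /traj; case: (leP (Num.max s 0) (Num.max t 0)) => h.
  by apply: key => //; apply: le_lt_trans sd; apply: le_trans ts; exact: ler_norm.
rewrite distrC; apply: key => //; first exact: ltW.
by apply: le_lt_trans sd; apply: le_trans ts; rewrite distrC; exact: ler_norm.
Qed.

End SemigroupBound.

(** * The adjoint semigroup and its weak integrals *)

Section Adjoint.
Context {R : realType} {V : completeNormedModType R} (ip : V -> V -> R).
Hypothesis hV : separable_hilbert ip.
Variables (S : R -> V -> V) (A : V -> V) (DA : set V).
Hypothesis hS : C0_semigroup S.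
Hypothesis hA : generator_of S A DA.

Lemma semigroup_adjoint_exists : exists Ss : R -> V -> V,
  forall t, 0 <= t -> forall x y, ip (S t x) y = ip x (Ss t y).
Proof.
suff : forall t, exists K : V -> V, 0 <= t -> forall x y, ip (S t x) y = ip x (K y).
  by move=> /choice[Ss h]; exists Ss.
move=> t; have [t0|t0] := leP 0 t; last by exists id.
have [C _ hC] := semigroup_bound hS t.
have [K hK] := @adjoint_exists _ _ _ hV (S t) C
  (fun a x y => semigroup_linear hS a x y t0) (fun x => hC t x t0 (lexx t)).
by exists K.
Qed.

(* [J t y] is the weak integral of [s |-> S^* s y] over [[0, t]]. *)
Lemma weak_integral_exists : exists J : R -> V -> V,
  forall t, 0 <= t -> forall x y, ip x (J t y) = prim (fun s => ip (traj S x s) y) t.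
Proof.
suff : forall ty : R * V, exists z, 0 <= ty.1 -> forall x, ip x z = prim (fun s => ip (traj S x s) ty.2) ty.1.
  by move=> /choice[J h]; exists (fun t y => J (t, y)) => t t0 x y; exact: (h (t, y)).
move=> [t y] /=; have [t0|t0] := leP 0 t; last by exists 0.
have [C C1 hC] := semigroup_bound hS t.
have cc x : continuous (fun s => ip (traj S x s) y).
  by move=> s; apply: (cvg_ipl hV); exact: traj_continuous.
have [|x|z hz] := @riesz _ _ _ hV (fun x => prim (fun s => ip (traj S x s) y) t) (C * `|y| * t).
- move=> a x z; rewrite -primD//; congr (prim _ t); apply/funext => s.
  by rewrite /traj semigroup_linear ?ipPl// le_max lexx orbT.
- rewrite (@le_trans _ _ (C * `|x| * `|y| * t))//; last first.
    by rewrite le_eqVlt; apply/orP; left; apply/eqP; ring.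
  apply: prim_bound => // s /andP[s0 st].
  rewrite trajE// (le_trans (ip_CS hV _ _))// ler_wpM2r// hC//.
by exists z => _ x; rewrite -hz.
Qed.

(** [S t] is bounded and commutes with the difference quotients of the semigroup at 0. *)
Lemma generator_semigroup t x : 0 <= t -> DA x -> DA (S t x) /\ A (S t x) = S t (A x).
Proof.
case: hA => h1 h2 t0 Dx.
have hc : (fun h => h^-1 *: (S h (S t x) - S t x)) @ 0^'+ --> S t (A x).
  have [C C1 hC] := semigroup_bound hS t.
  have C0 : 0 < C by apply: lt_le_trans C1.
  have /cvgrPdist_lt hx := h2 x Dx.
  apply/cvgrPdist_lt => e e0; near=> h.
  have h0 : 0 < h by near: h; exact: nbhs_right_gt.
  have hh0 := ltW h0.
  rewrite -(semigroupD hS)// (addrC h t) (semigroupD hS)// -(semigroupB hS)// -(semigroupZ hS)//.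
  rewrite -(semigroupB hS)//; apply: (le_lt_trans (hC _ _ t0 (lexx t))).
  rewrite mulrC -ltr_pdivlMr//; near: h; apply: hx; exact: divr_gt0.
have D : DA (S t x) by apply/h1; exists (S t (A x)).
by split => //; exact: (cvg_unique _ (h2 _ D) hc).
Unshelve. all: by end_near. Qed.

End Adjoint.

(** * Bernstein polynomials in the powers of an operator *)

Section Bernstein.
Context {R : realType} {V : normedModType R} (K : V -> V).
Hypothesis lK : forall a x y, K (a *: x + y) = a *: K x + K y.

(* [bern m x z = \sum_k 'C(m, k) x^k (1 - x)^(m - k) K^k z], with [x]-derivative [dbern m x z]. *)
Fixpoint bern m (x : R) (z : V) : V :=
  if m is m'.+1 then (1 - x) *: bern m' x z + x *: bern m' x (K z) else z.

Fixpoint dbern m (x : R) (z : V) : V :=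
  if m is m'.+1 then (bern m' x (K z) - bern m' x z) +
    ((1 - x) *: dbern m' x z + x *: dbern m' x (K z)) else 0.

Lemma bern_linear m x a y z : bern m x (a *: y + z) = a *: bern m x y + bern m x z.
Proof.
elim: m y z => [//|m ih] y z /=; rewrite lK !ih !scalerDr !scalerA.
by rewrite (mulrC a x) (mulrC a (1 - x)) addrACA.
Qed.

Lemma bernB m x y z : bern m x (y - z) = bern m x y - bern m x z.
Proof. by rewrite addrC -scaleN1r bern_linear scaleN1r addrC. Qed.

(** Lowers the degree to that of the derivative in [dbernE], so that the two can be added inside one
    polynomial. *)
Lemma bernS m x z : bern m.+1 x z = bern m x ((1 - x) *: z + x *: K z).
Proof.
rewrite bern_linear; congr (_ + _).
by rewrite -[x *: K z]addr0 bern_linear -[0 in RHS](subrr z) bernB subrr addr0.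
Qed.

Lemma bern_at1 m z : bern m 1 z = iter m K z.
Proof. by elim: m z => [//|m ih] z; rewrite /= subrr scale0r add0r scale1r ih -iterSr. Qed.

Lemma bern_at0 m z : bern m 0 z = z.
Proof. by elim: m => [//|m ih]; rewrite /= subr0 scale1r scale0r addr0. Qed.

(** The recursion makes the value a convex combination of the iterates [iter k K z] with [k <= m],
    so it stays in every ball containing them. *)
Lemma bern_convex m x z c (r : R) : 0 <= x <= 1 ->
  (forall k, (k <= m)%N -> `|iter k K z - c| <= r) -> `|bern m x z - c| <= r.
Proof.
move=> /andP[x0 x1]; elim: m z => [|m ih] z hk; first exact: (hk 0%N).
have -> : bern m.+1 x z - c = (1 - x) *: (bern m x z - c) + x *: (bern m x (K z) - c).
  rewrite /= !scalerBr addrACA -opprD -scalerDl; congr (_ - _).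
  by rewrite addrAC -addrA subrr addr0 scale1r.
rewrite (le_trans (ler_normD _ _))// !normrZ !ger0_norm ?subr_ge0//.
have -> : r = (1 - x) * r + x * r by ring.
rewrite lerD// ler_wpM2l ?subr_ge0//; apply: ih => k km.
  by apply: hk; exact: leqW.
by rewrite -iterSr hk.
Qed.

Lemma bern_norm m x z (r : R) : 0 <= x <= 1 ->
  (forall k, (k <= m)%N -> `|iter k K z| <= r) -> `|bern m x z| <= r.
Proof.
move=> x01 h; rewrite -[bern m x z]subr0; apply: bern_convex => // k km.
by rewrite subr0 h.
Qed.

(** The derivative of a Bernstein polynomial is the degree times the polynomial of the forward
    differences. At [m = 0] the predecessor is harmless, as the factor [m%:R] is zero. *)
Lemma dbernE m x z : dbern m x z = m%:R *: bern m.-1 x (K z - z).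
Proof.
elim: m z => [|m ih] z; first by rewrite scale0r.
rewrite [LHS]/= !ih -bernB; case: m {ih} => [|m].
  by rewrite !scale0r !scaler0 !addr0 scale1r.
rewrite [m.+1.-1]/= [m.+2.-1]/= -[m.+2%:R]natr1 addrC [RHS]scalerDl scale1r; congr (_ + _).
rewrite /= scalerDr !scalerA (mulrC m.+1%:R x) (mulrC m.+1%:R (1 - x)).
rewrite -!scalerA; congr (_ + _ *: (_ *: bern m x _)).
by have := lK (-1) z (K z); rewrite !scaleN1r !(addrC (- _)) => ->.
Qed.

End Bernstein.

(** * Smooth vectors of the adjoint semigroup *)

Section Smooth.
Context {R : realType} {V : completeNormedModType R} (ip : V -> V -> R).
Hypothesis hV : separable_hilbert ip.
Variables (S : R -> V -> V) (A : V -> V) (DA : set V).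
Hypothesis hS : C0_semigroup S.
Hypothesis hA : generator_of S A DA.
Variables Ss : R -> V -> V.
Hypothesis hSs : forall t : R, 0 <= t -> forall x y, ip (S t x) y = ip x (Ss t y).
Variable J : R -> V -> V.
Hypothesis hJ : forall t : R, 0 <= t -> forall x y,
  ip x (J t y) = prim (fun s => ip (traj S x s) y) t.
Variables T C : R.
Hypothesis C1 : 1 <= C.
Hypothesis hC : forall t x, 0 <= t -> t <= T -> `|S t x| <= C * `|x|.

Implicit Types (t s h a r : R) (x y v w : V).

Let C0 : 0 <= C. Proof. exact: le_trans C1. Qed.

Lemma adjoint_linear t a x y : 0 <= t -> Ss t (a *: x + y) = a *: Ss t x + Ss t y.
Proof.
move=> t0; apply: (ip_inj hV) => z.
by rewrite -hSs// !(ipDr hV) !(ipZr hV) -!hSs.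
Qed.

Lemma adjointB t x y : 0 <= t -> Ss t (x - y) = Ss t x - Ss t y.
Proof.
by move=> t0; rewrite addrC -scaleN1r adjoint_linear// scaleN1r addrC.
Qed.

Lemma adjointZ t a x : 0 <= t -> Ss t (a *: x) = a *: Ss t x.
Proof.
by move=> t0; apply: (ip_inj hV) => z; rewrite -hSs// !(ipZr hV) -hSs.
Qed.

Lemma adjoint0 v : Ss 0 v = v.
Proof. by apply: (ip_inj hV) => z; rewrite -hSs// (semigroup0 hS). Qed.

Lemma adjointD s t v : 0 <= s -> 0 <= t -> Ss (s + t) v = Ss s (Ss t v).
Proof.
move=> s0 t0; apply: (ip_inj hV) => z.
by rewrite -!hSs ?addr_ge0// addrC (semigroupD hS).
Qed.

Lemma adjoint_iter h k v : 0 <= h -> iter k (Ss h) v = Ss (k%:R * h) v.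
Proof.
move=> h0; elim: k => [|k ih]; first by rewrite mul0r adjoint0.
by rewrite iterS ih -adjointD ?mulr_ge0// -[k.+1%:R]natr1 mulrDl mul1r addrC.
Qed.

Lemma adjoint_bound t v : 0 <= t -> t <= T -> `|Ss t v| <= C * `|v|.
Proof.
move=> t0 tT; apply: (norm_le_ip hV); first by rewrite mulr_ge0.
move=> x; rewrite -hSs// (le_trans (ler_norm _))// (le_trans (ip_CS hV _ _))//.
by rewrite mulrAC ler_wpM2r// hC.
Qed.

Lemma traj_ip_continuous x y : continuous (fun s => ip (traj S x s) y).
Proof. by move=> s; apply: (cvg_ipl hV); exact: traj_continuous. Qed.

Lemma J_bound t v : 0 <= t -> t <= T -> `|J t v| <= C * t * `|v|.
Proof.
move=> t0 tT; apply: (norm_le_ip hV); first by rewrite !mulr_ge0.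
move=> x; rewrite hJ// (le_trans (ler_norm _))//.
have -> : C * t * `|v| * `|x| = C * `|x| * `|v| * t by ring.
apply: prim_bound => //; first exact: traj_ip_continuous.
move=> s /andP[s0 st]; rewrite trajE// (le_trans (ip_CS hV _ _))// ler_wpM2r//.
by rewrite hC// (le_trans st).
Qed.

Lemma prim_traj_shift h t x y : 0 <= h -> 0 <= t ->
  prim (fun s => ip (traj S (S h x) s) y) t =
  prim (fun s => ip (traj S x s) y) (t + h) - prim (fun s => ip (traj S x s) y) h.
Proof.
move=> h0 t0; rewrite -prim_shift//; last exact: traj_ip_continuous.
apply: prim_eq => //; first exact: traj_ip_continuous.
  by apply: (@continuous_comp_addr _ (fun s => ip (traj S x s) y)); exact: traj_ip_continuous.
by move=> s /andP[s0 st]; rewrite !trajE ?addr_ge0// (semigroupD hS).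
Qed.

(** Both sides are the weak integral over [0, t + a] minus those over [0, a] and [0, t], grouped in
    two ways. *)
Lemma J_diff t a v : 0 <= t -> 0 <= a -> Ss t (J a v) - J a v = J t (Ss a v - v).
Proof.
move=> t0 a0; apply: (ip_inj hV) => x.
rewrite (ipBr hV) -hSs// !hJ// prim_traj_shift//.
have -> : (fun s => ip (traj S x s) (Ss a v - v)) =
          (fun s => -1 * ip (traj S x s) v + ip (traj S (S a x) s) v).
  apply/funext => s; rewrite (ipBr hV) mulN1r [RHS]addrC; congr (_ - _).
  have m0 : 0 <= Num.max s 0 by rewrite le_max lexx orbT.
  by rewrite /traj -hSs// -!(semigroupD hS)// addrC.
rewrite primD//; [|exact: traj_ip_continuous|exact: traj_ip_continuous].
by rewrite prim_traj_shift// (addrC a t); ring.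
Qed.

(** Averaged orbits lie in the domain of the adjoint generator: moving [S h] through the weak
    integral leaves integrals over [a, a + h] and [0, h], whose quotients by [h] tend to the values
    at [a] and 0. *)
Lemma J_graph a v : 0 <= a -> adjoint_graph ip A DA (J a v) (Ss a v - v).
Proof.
move=> a0 x Dx; case: hA => _ /(_ x Dx) hx.
have h1 : (fun h => ip (h^-1 *: (S h x - x)) (J a v)) @ 0^'+ --> ip (A x) (J a v).
  by apply: (cvg_ipl hV); exact: hx.
set g := fun s => ip (traj S x s) v.
have cg : continuous g by exact: traj_ip_continuous.
have h2 : (fun h => h^-1 * (prim g (a + h) - prim g a) - h^-1 * (prim g (0 + h) - prim g 0))
   @ 0^'+ --> g a - g 0.
  by apply: cvgB; apply: prim_rderiv.
have -> : ip x (Ss a v - v) = g a - g 0.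
  by rewrite (ipBr hV) -hSs// /g !trajE// (semigroup0 hS).
apply: (@cvg_unique _ (@Rhausdorff R) _ _ _ _ h1).
apply: cvg_trans h2; apply: near_eq_cvg; near=> h.
have h0 : 0 < h by near: h; exact: nbhs_right_gt.
rewrite (ipZl hV) (ipBl hV) !hJ// prim_traj_shift// ?ltW// prim0 add0r -/g.
by rewrite subr0; ring.
Unshelve. all: by end_near. Qed.

(* [w] stands for [A^* v]. *)
Definition smooth (c : R) (v w : V) := [/\ 0 <= c, adjoint_graph ip A DA v w &
  forall t, 0 <= t -> t <= T -> [/\ `|Ss t v - v| <= c * t, `|Ss t w - w| <= c * t &
    `|Ss t v - v - t *: w| <= c * t ^+ 2]].

Lemma smoothZ c v w k : smooth c v w -> smooth (`|k| * c) (k *: v) (k *: w).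
Proof.
move=> [c0 gvw hc]; split; first by rewrite mulr_ge0.
  by move=> x Dx; rewrite !(ipZr hV) gvw.
move=> t t0 tT; have [h1 h2 h3] := hc t t0 tT.
rewrite !adjointZ// scalerA (mulrC t k) -scalerA -!scalerBr !normrZ -!mulrA.
by split; rewrite ler_wpM2l.
Qed.

Lemma smooth_adjoint c v w r : smooth c v w -> 0 <= r -> r <= T ->
  smooth (C * c) (Ss r v) (Ss r w).
Proof.
move=> [c0 gvw hc] r0 rT; split; first by rewrite mulr_ge0.
  move=> x Dx; have [D E] := generator_semigroup hS hA r0 Dx.
  by rewrite -!hSs// -E gvw.
move=> t t0 tT; have [h1 h2 h3] := hc t t0 tT.
have comm y : Ss t (Ss r y) = Ss r (Ss t y) by rewrite -!adjointD// addrC.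
have hle y (k : R) : `|y| <= c * k -> `|Ss r y| <= C * c * k.
  by move=> yk; rewrite (le_trans (adjoint_bound _ r0 rT))// -mulrA ler_wpM2l.
rewrite !comm -adjointZ// -!adjointB//; split; exact: hle.
Qed.

(** One [J] reaches the domain of the adjoint generator. With a second one the image [w] is itself
    [J a z2], by [J_diff], and hence Lipschitz along the adjoint semigroup; integrating this over
    [0, t] gives the quadratic estimate. *)
Lemma smooth_JJ a v0 : 0 <= a -> exists c w, smooth c (J a (J a v0)) w.
Proof.
move=> a0; set z := J a v0; set z2 := Ss a v0 - v0.
pose w2 := Ss a z2 - z2; pose w := Ss a z - z.
have wE : w = J a z2 by rewrite /w /z J_diff.
exists (C * (`|w| + `|w2|)), w; split; first by rewrite mulr_ge0// addr_ge0.
  exact: J_graph.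
move=> t t0 tT.
have b (k : R) : 0 <= C * t * k -> k \in [:: `|w|; `|w2|] -> C * t * k <= C * (`|w| + `|w2|) * t.
  rewrite !inE => _ hw; rewrite (mulrAC C t k) ler_wpM2r// ler_wpM2l//.
  by case/orP: hw => /eqP ->; rewrite ?lerDl ?lerDr.
have hb2 s : 0 <= s -> s <= T -> `|Ss s w - w| <= C * s * `|w2|.
  by move=> s0 sT; rewrite wE J_diff// J_bound.
have hv s : 0 <= s -> Ss s (J a z) - J a z = J s w by move=> s0; rewrite J_diff.
split.
- by rewrite hv// (le_trans (J_bound _ t0 tT))// b ?mulr_ge0// !inE eqxx.
- by rewrite (le_trans (hb2 _ t0 tT))// b ?mulr_ge0// !inE eqxx orbT.
rewrite hv//; apply: (@le_trans _ _ (C * t * `|w2| * t)); last first.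
  by rewrite expr2 mulrA ler_wpM2r// b ?mulr_ge0// !inE eqxx orbT.
apply: (norm_le_ip hV); first by rewrite !mulr_ge0.
move=> x; rewrite (ipBr hV) (ipZr hV) hJ//.
have cg := @traj_ip_continuous x w.
have ck : continuous (fun _ : R => ip x w) by exact: cst_continuous.
have -> : prim (fun s => ip (traj S x s) w) t - t * ip x w =
    prim (fun s => -1 * ip x w + ip (traj S x s) w) t.
  by rewrite (primD (-1) ck cg)// prim_cst// mulN1r addrC (mulrC t).
rewrite (le_trans (ler_norm _))//.
have -> : C * t * `|w2| * t * `|x| = C * t * `|w2| * `|x| * t by ring.
apply: prim_bound => //.
  move=> s; apply: (@continuousD _ _ _ (fun=> -1 * ip x w)); last exact: cg.
  exact: cst_continuous.
move=> s /andP[s0 st]; have sT := le_trans st tT.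
rewrite trajE// hSs// mulN1r addrC -(ipBr hV) (le_trans (ip_CS hV _ _))// mulrC.
rewrite ler_wpM2r// (le_trans (hb2 _ s0 sT))// ler_wpM2r// ler_wpM2l//.
Qed.

(** [vs n] averages the adjoint orbit of [v0] twice over [0, T / (n + 1)]. Tested against [x], the
    averaging moves to the trajectory of [x], so strong continuity of [S] suffices; it yields weak
    convergence, which is all that the moments need. *)
Lemma smooth_weakly_dense v0 : 0 < T -> exists vs ws : nat -> V,
  [/\ forall n, exists c, smooth c (vs n) (ws n),
      forall n, `|vs n| <= C ^+ 2 * `|v0| &
      forall x, (fun n => ip x (vs n)) @ \oo --> ip x v0].
Proof.
move=> T0; pose a (n : nat) : R := T / n.+1%:R.
have a0 n : 0 < a n by rewrite divr_gt0.
have aT n : a n <= T by rewrite ler_pdivrMr// ler_peMr ?ler1n// ltW.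
pose M n v := (a n)^-1 *: J (a n) v.
have Mb n v : `|M n v| <= C * `|v|.
  rewrite normrZ gtr0_norm ?invr_gt0// ler_pdivrMl// mulrA (mulrC (a n)).
  by rewrite J_bound// ltW.
have JZ t k y : 0 <= t -> J t (k *: y) = k *: J t y.
  move=> t0; apply: (ip_inj hV) => x; rewrite (ipZr hV) !hJ//.
  have cg := @traj_ip_continuous x y.
  have c0 : continuous (fun _ : R => 0 : R) by exact: cst_continuous.
  have := primD k cg c0 t0; rewrite prim_cst// mul0r addr0 => <-.
  by congr (prim _ t); apply/funext => s; rewrite (ipZr hV) addr0.
have hsm n : exists w, exists c, smooth c (M n (M n v0)) w.
  have [c [w hw]] := smooth_JJ v0 (ltW (a0 n)).
  exists ((a n)^-1 *: ((a n)^-1 *: w)), (`|(a n)^-1| * (`|(a n)^-1| * c)).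
  by rewrite /M JZ ?ltW//; apply: smoothZ; apply: smoothZ.
have [ws hws] := choice hsm.
exists (fun n => M n (M n v0)), ws; split => //.
  by move=> n; rewrite (le_trans (Mb _ _))// expr2 -mulrA ler_wpM2l.
move=> x; apply/cvgrPdist_le => e e0.
(* The two averagings contribute the norms of [v0] and of [M n v0], the latter at most [C] times the
   former, each multiplied by [e / k]; the added 1 keeps [k] positive when [v0] is zero. *)
set k := (C + 1) * `|v0| + 1.
have k0 : 0 < k by rewrite ltr_wpDl// mulr_ge0// addr_ge0.
have [d d0 hd] := semigroup_near0 hS x (divr_gt0 e0 k0).
have Mz n z : a n < d -> `|ip x z - ip x (M n z)| <= `|z| * (e / k).
  move=> ad; have cg := @traj_ip_continuous x z.
  have ck : continuous (fun _ : R => ip x z) by exact: cst_continuous.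
  have -> : ip x z - ip x (M n z) =
      - ((a n)^-1 * prim (fun s => -1 * ip x z + ip (traj S x s) z) (a n)).
    rewrite (primD (-1) ck cg) ?ltW// prim_cst ?ltW// (ipZr hV) hJ ?ltW//.
    by field; rewrite gt_eqF.
  rewrite normrN normrM gtr0_norm ?invr_gt0// ler_pdivrMl// [leRHS]mulrC.
  apply: prim_bound; [|exact: ltW|].
    move=> s; apply: (@continuousD _ _ _ (fun=> -1 * ip x z)); last exact: cg.
    exact: cst_continuous.
  move=> s /andP[s0 sa]; rewrite trajE// mulN1r addrC -(ipBl hV).
  rewrite (le_trans (ip_CS hV _ _))// mulrC ler_wpM2l// ltW// hd//.
  exact: le_lt_trans ad.
near=> n.
have ad : a n < d.
  rewrite ltr_pdivrMr// mulrC -ltr_pdivrMr//; near: n.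
  exists (Num.truncn (T / d)) => // n /= hn; apply: (lt_le_trans (truncnS_gt _)).
  by rewrite ler_nat ltnS.
rewrite -[_ - _](subrKA (ip x (M n v0))) (le_trans (ler_normD _ _))//.
rewrite (@le_trans _ _ (`|v0| * (e / k) + C * `|v0| * (e / k)))//.
  rewrite lerD ?Mz// (le_trans (Mz n _ ad))// ler_wpM2r ?Mb//.
  by rewrite divr_ge0 ?ltW.
rewrite -mulrDl mulrCA -ler_pdivlMl// mulVf ?gt_eqF// ler_pdivrMr// mul1r /k.
by rewrite mulrDl mul1r addrC lerDl.
Unshelve. all: by end_near. Qed.

End Smooth.

(** * Square integrable and convergent random variables *)

Section SquareIntegrable.
Context {R : realType} {d : measure_display} {Omega : measurableType d}.
Variable P : probability Omega R.
Implicit Types X Y Z : Omega -> R.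

Definition Int X := P.-integrable setT (EFin \o X).
(** Real valued through [fine], so an infinite integral reads 0. A bound on [m2] is informative only
    together with [L2], which is why the two are carried side by side. *)
Definition EX X : R := Rintegral P setT X.
Definition L2 X := measurable_fun setT X /\ (\int[P]_w ((X w) ^+ 2)%:E < +oo)%E.
Definition m2 X := EX (fun w => X w ^+ 2).

Lemma Int_dom X Y : measurable_fun setT X -> Int Y -> (forall w, `|X w| <= Y w) -> Int X.
Proof.
move=> mX iY h; apply: le_integrable iY => //; first exact/measurable_EFinP.
by move=> w _ /=; rewrite lee_fin (le_trans (h w))// ler_norm.
Qed.

Lemma Int_cst k : Int (fun=> k).
Proof.
exact: finite_measure_integrable_cst.
Qed.

Lemma IntD X Y : Int X -> Int Y -> Int (fun w => X w + Y w).
Proof. by move=> iX iY; exact: (integrableD _ iX iY). Qed.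

Lemma IntZ k X : Int X -> Int (fun w => k * X w).
Proof. by move=> iX; exact: (integrableZl _ k iX). Qed.

Lemma IntB X Y : Int X -> Int Y -> Int (fun w => X w - Y w).
Proof. by move=> iX iY; exact: (integrableB _ iX iY). Qed.

Lemma Int_sum (I : Type) (r : seq I) (F : I -> Omega -> R) :
  (forall i, Int (F i)) -> Int (fun w => \sum_(i <- r) F i w).
Proof.
move=> h; elim: r => [|i r ih].
  by under eq_fun do rewrite big_nil; exact: Int_cst.
by under eq_fun do rewrite big_cons; exact: IntD.
Qed.

Lemma EXD X Y : Int X -> Int Y -> EX (fun w => X w + Y w) = EX X + EX Y.
Proof. by move=> iX iY; exact: RintegralD. Qed.

Lemma EXB X Y : Int X -> Int Y -> EX (fun w => X w - Y w) = EX X - EX Y.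
Proof. by move=> iX iY; exact: RintegralB. Qed.

Lemma EXZ k X : Int X -> EX (fun w => k * X w) = k * EX X.
Proof. by move=> iX; exact: RintegralZl. Qed.

Lemma EX_cst k : EX (fun=> k) = k.
Proof.
rewrite /EX Rintegral_cst//= [X in fine X](_ : _ = 1%E) ?mulr1//.
exact: probability_setT.
Qed.

Lemma EX_sum (I : Type) (r : seq I) (F : I -> Omega -> R) : (forall i, Int (F i)) ->
  EX (fun w => \sum_(i <- r) F i w) = \sum_(i <- r) EX (F i).
Proof.
move=> h; elim: r => [|i r ih].
  by under eq_fun do rewrite big_nil; rewrite EX_cst big_nil.
under eq_fun do rewrite big_cons.
by rewrite EXD// ?ih ?big_cons//; exact: Int_sum.
Qed.

Lemma EX_le X Y : Int X -> Int Y -> (forall w, X w <= Y w) -> EX X <= EX Y.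
Proof. by move=> iX iY h; exact: le_Rintegral. Qed.

Lemma EX_ge0 X : (forall w, 0 <= X w) -> 0 <= EX X.
Proof. by move=> h; exact: Rintegral_ge0. Qed.

Lemma EX_EFin X : Int X -> (EX X)%:E = (\int[P]_w (X w)%:E)%E.
Proof. by move=> iX; rewrite /EX /Rintegral fineK//; exact: integrable_fin_num. Qed.

Lemma EX_ae X Y : measurable_fun setT X -> measurable_fun setT Y ->
  {ae P, forall w, X w = Y w} -> EX X = EX Y.
Proof.
move=> mX mY h; congr fine; apply: ae_eq_integral => //; try exact/measurable_EFinP.
by apply: filterS h => w h _; rewrite h.
Qed.

Lemma L2_measurable X : L2 X -> measurable_fun setT X. Proof. by case. Qed.

Lemma sqr_measurable X : measurable_fun setT X -> measurable_fun setT (fun w => X w ^+ 2).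
Proof. by move=> mX; exact: measurable_funX. Qed.

Lemma L2_sqr X : L2 X -> Int (fun w => X w ^+ 2).
Proof.
move=> [mX iX]; apply/integrableP; split.
  by apply/measurable_EFinP; exact: sqr_measurable.
by under eq_integral do rewrite /= ger0_norm ?sqr_ge0//.
Qed.

Lemma L2P X : measurable_fun setT X -> Int (fun w => X w ^+ 2) -> L2 X.
Proof.
move=> mX iX; split=> //; move/integrableP : iX => [_].
by under eq_integral do rewrite /= ger0_norm ?sqr_ge0//.
Qed.

Lemma L2_dom X Y : measurable_fun setT X -> Int Y -> (forall w, X w ^+ 2 <= Y w) -> L2 X.
Proof.
move=> mX iY h; apply: L2P => //; apply: Int_dom iY _; first exact: sqr_measurable.
by move=> w; rewrite ger0_norm ?sqr_ge0.
Qed.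

Lemma L2_Int X : L2 X -> Int X.
Proof.
move=> lX; apply: (@Int_dom _ (fun w => 1 + X w ^+ 2)) => [||w].
- exact: L2_measurable.
- by apply: IntD; [exact: Int_cst|exact: L2_sqr].
- by rewrite ler_norml; apply/andP; split; nra.
Qed.

Lemma L2_mul X Y : L2 X -> L2 Y -> Int (fun w => X w * Y w).
Proof.
move=> lX lY; apply: (@Int_dom _ (fun w => X w ^+ 2 + Y w ^+ 2)) => [||w].
- by apply: measurable_funM; exact: L2_measurable.
- by apply: IntD; exact: L2_sqr.
- by rewrite ler_norml; apply/andP; split; nra.
Qed.

Lemma L2_cst k : L2 (fun=> k).
Proof. by apply: L2P => //; exact: (Int_cst (k ^+ 2)). Qed.

Lemma L2D X Y : L2 X -> L2 Y -> L2 (fun w => X w + Y w).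
Proof.
move=> lX lY; apply: (@L2_dom _ (fun w => 2 * X w ^+ 2 + 2 * Y w ^+ 2)) => [||w].
- by apply: measurable_funD; exact: L2_measurable.
- by apply: IntD; apply: IntZ; exact: L2_sqr.
- by have := sqr_ge0 (X w - Y w); lra.
Qed.

Lemma L2Z k X : L2 X -> L2 (fun w => k * X w).
Proof.
move=> lX; apply: (@L2_dom _ (fun w => k ^+ 2 * X w ^+ 2)) => [||w].
- by apply: measurable_funM => //; exact: L2_measurable.
- by apply: IntZ; exact: L2_sqr.
- by rewrite exprMn.
Qed.

Lemma L2B X Y : L2 X -> L2 Y -> L2 (fun w => X w - Y w).
Proof.
move=> lX lY; have := L2D lX (L2Z (-1) lY).
by under eq_fun do rewrite mulN1r.
Qed.

Lemma L2_sum (I : Type) (r : seq I) (F : I -> Omega -> R) :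
  (forall i, L2 (F i)) -> L2 (fun w => \sum_(i <- r) F i w).
Proof.
move=> h; elim: r => [|i r ih].
  by under eq_fun do rewrite big_nil; exact: L2_cst.
by under eq_fun do rewrite big_cons; exact: L2D.
Qed.

Lemma L2_ae X Y : measurable_fun setT Y -> {ae P, forall w, X w = Y w} -> L2 X -> L2 Y.
Proof.
move=> mY h [mX iX]; split => //.
have -> : (\int[P]_w (Y w ^+ 2)%:E = \int[P]_w (X w ^+ 2)%:E)%E; last by [].
apply: ae_eq_integral => //.
- by apply/measurable_EFinP; exact: sqr_measurable.
- by apply/measurable_EFinP; exact: sqr_measurable.
- by apply: filterS h => w h _; rewrite h.
Qed.

Lemma m2_ae X Y : measurable_fun setT X -> measurable_fun setT Y ->
  {ae P, forall w, X w = Y w} -> m2 X = m2 Y.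
Proof.
move=> mX mY h; apply: EX_ae; [exact: sqr_measurable|exact: sqr_measurable|].
by apply: filterS h => w ->.
Qed.

Lemma m2_ge0 X : 0 <= m2 X. Proof. by apply: EX_ge0 => w; rewrite sqr_ge0. Qed.

Lemma m2Z k X : L2 X -> m2 (fun w => k * X w) = k ^+ 2 * m2 X.
Proof.
move=> lX; rewrite /m2 -EXZ; last exact: L2_sqr.
by congr EX; apply/funext => w; rewrite exprMn.
Qed.

Lemma m2D_le X Y : L2 X -> L2 Y -> m2 (fun w => X w + Y w) <= 2 * m2 X + 2 * m2 Y.
Proof.
move=> lX lY; rewrite /m2 -!EXZ; [|exact: L2_sqr|exact: L2_sqr].
have iX := IntZ 2 (L2_sqr lX); have iY := IntZ 2 (L2_sqr lY).
rewrite -EXD//; apply: EX_le => [||w]; [exact: L2_sqr (L2D lX lY)|exact: IntD|].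
by have := sqr_ge0 (X w - Y w); lra.
Qed.

Lemma m2D X Y : L2 X -> L2 Y ->
  m2 (fun w => X w + Y w) = m2 X + 2 * EX (fun w => X w * Y w) + m2 Y.
Proof.
move=> lX lY; have iXY := L2_mul lX lY.
rewrite /m2 -EXZ// -!EXD; try by [exact: L2_sqr|exact: IntZ|apply: IntD; [exact: L2_sqr|exact: IntZ]].
by congr EX; apply/funext => w; ring.
Qed.

(** Cauchy-Schwarz over the [n] terms, with no orthogonality; the factor [n] is later absorbed by
    the cubic error estimate. *)
Lemma m2_sum_le n (F : 'I_n -> Omega -> R) : (forall i, L2 (F i)) ->
  m2 (fun w => \sum_(i < n) F i w) <= n%:R * \sum_(i < n) m2 (F i).
Proof.
move=> h.
have CS (m : nat) (a : nat -> R) : (\sum_(i < m) a i) ^+ 2 <= m%:R * \sum_(i < m) a i ^+ 2.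
  elim: m => [|m ih]; first by rewrite !big_ord0 expr0n mul0r.
  rewrite !big_ord_recr/=; set s := \sum_(i < m) a i in ih *.
  set q := \sum_(i < m) _ in ih *; rewrite -[m.+1%:R]natr1.
  have hq : 2 * s * a m <= q + m%:R * a m ^+ 2.
    rewrite /s /q; clear; elim: m (a m) => [|k ihk] b.
      by rewrite !big_ord0 mulr0 !mul0r addr0.
    by rewrite !big_ord_recr/= -[k.+1%:R]natr1; have := ihk b; have := sqr_ge0 (a k - b); lra.
  lra.
rewrite /m2 -EX_sum; last by move=> i; exact: L2_sqr.
rewrite -EXZ; last by apply: Int_sum => i; exact: L2_sqr.
apply: EX_le => [||w]; first exact: L2_sqr (L2_sum _ h).
  by apply: IntZ; apply: Int_sum => i; exact: L2_sqr.
(* [inord] needs a nonempty index type, so the empty sum is treated first. *)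
case: n F h => [|n] F h; first by rewrite !big_ord0 expr0n mul0r.
have := CS n.+1 (fun i => F (inord i) w).
have -> : \sum_(i < n.+1) F (inord i) w = \sum_(i < n.+1) F i w.
  by apply: eq_bigr => i _; rewrite inord_val.
have -> // : \sum_(i < n.+1) F (inord i) w ^+ 2 = \sum_(i < n.+1) F i w ^+ 2.
by apply: eq_bigr => i _; rewrite inord_val.
Qed.

Definition vari X := m2 (fun x => X x - EX X).

Lemma EX_centered X : L2 X -> EX (fun x => X x - EX X) = 0.
Proof. by move=> lX; rewrite EXB ?EX_cst ?subrr//; [exact: L2_Int|exact: Int_cst]. Qed.

Lemma m2_vari X : L2 X -> m2 X = vari X + EX X ^+ 2.
Proof.
move=> lX; have lc := L2_cst (EX X); have lD := L2B lX lc.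
rewrite -[in LHS](_ : (fun x => (X x - EX X) + EX X) = X); last first.
  by apply/funext => x; rewrite subrK.
rewrite (m2D lD lc) -addrA; congr (_ + _).
rewrite [X in 2 * X](_ : _ = 0) ?mulr0 ?add0r; first by rewrite /m2 EX_cst.
under eq_fun do rewrite mulrC.
by rewrite EXZ ?EX_centered ?mulr0//; exact: L2_Int.
Qed.

Lemma vari_ge0 X : 0 <= vari X. Proof. exact: m2_ge0. Qed.

Lemma jensen X : L2 X -> EX X ^+ 2 <= m2 X.
Proof. by move=> /m2_vari ->; rewrite lerDr vari_ge0. Qed.

Lemma cauchy_schwarz X Y : L2 X -> L2 Y ->
  EX (fun w => X w * Y w) ^+ 2 <= m2 X * m2 Y.
Proof.
move=> lX lY; set c := EX _; have [Y0|Y0] := eqVneq (m2 Y) 0.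
  have h k : 0 <= m2 X + 2 * k * c.
    have := m2_ge0 (fun w => X w + k * Y w); rewrite m2D//; last exact: L2Z.
    rewrite m2Z// Y0 mulr0 addr0.
    have -> : (fun w => X w * (k * Y w)) = (fun w => k * (X w * Y w)).
      by apply/funext => w; ring.
    by rewrite EXZ ?mulrA//; exact: L2_mul.
  rewrite Y0 mulr0; have [->|c0] := eqVneq c 0; first by rewrite expr0n.
  (* This multiplier makes the nonnegative quantity in [h] equal to -1. *)
  have := h (- (m2 X + 1) / (2 * c)).
  have -> : 2 * (- (m2 X + 1) / (2 * c)) * c = - (m2 X + 1) by field.
  lra.
have Yp : 0 < m2 Y by rewrite lt_neqAle eq_sym Y0 m2_ge0.
have := m2_ge0 (fun w => m2 Y * X w + - c * Y w); rewrite m2D; [|exact: L2Z|exact: L2Z].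
rewrite !m2Z//.
have -> : (fun w => m2 Y * X w * (- c * Y w)) = (fun w => (- c * m2 Y) * (X w * Y w)).
  by apply/funext => w; ring.
rewrite EXZ; last exact: L2_mul.
rewrite -/c => h; have : 0 <= m2 Y * (m2 X * m2 Y - c ^+ 2) by lra.
by rewrite pmulr_rge0// subr_ge0.
Qed.

End SquareIntegrable.

(** * Convergence in probability and limits of second moments *)

Section InProbability.
Context {R : realType} {d : measure_display} {Omega : measurableType d}.
Variable P : probability Omega R.
Local Notation rv := (Omega -> R).
Local Notation rvs := (nat -> Omega -> R).
Implicit Types X : rv.

Lemma measurable_EFin_fun X : measurable_fun setT X -> measurable_fun setT (fun w => (X w)%:E).
Proof. by move=> mX; apply/measurable_EFinP. Qed.

Lemma measurable_gt X (e : R) : measurable_fun setT X -> measurable [set w | e < X w].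
Proof.
move=> mX; rewrite -[X in measurable X]setTI.
have -> : [set w | e < X w] = X @^-1` `]e, +oo[.
  by apply/seteqP; split => w; rewrite /= in_itv /= andbT.
exact: mX.
Qed.

(* Convergence in probability through measurable covers of the exceptional
    sets, so that no measurability of the variables has to be tracked. *)
Definition cip (Z : rvs) (Z0 : rv) :=
  forall e eta : R, 0 < e -> 0 < eta -> \forall n \near \oo,
    exists B, [/\ measurable B, (P B <= eta%:E)%E & forall w, ~ B w -> `|Z n w - Z0 w| <= e].

Lemma cip_of_cvg (Z : rvs) (Z0 : rv) :
  (forall n, measurable_fun setT (Z n)) -> measurable_fun setT Z0 ->
  cvg_in_prob P Z Z0 -> cip Z Z0.
Proof.
move=> mZ mZ0 h e eta e0 eta0.
have mB n : measurable [set w | e < `|Z n w - Z0 w|].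
  by apply: measurable_gt; apply: measurableT_comp => //; exact: measurable_funB.
have /fine_cvgP[_ /cvgrPdist_lt /(_ _ eta0)] := h e e0.
apply: filterS => n; rewrite /= sub0r normrN => hn.
exists [set w | e < `|Z n w - Z0 w|]; split => // [|w /negP]; last by rewrite -leNgt.
rewrite -[X in (X <= _)%E]fineK ?fin_num_measure// lee_fin (le_trans (ler_norm _))//.
exact: ltW.
Qed.

Lemma cip_ae (Z Y : rvs) (Z0 Y0 : rv) :
  (forall n, {ae P, forall w, Z n w = Y n w}) ->
  {ae P, forall w, Z0 w = Y0 w} -> cip Z Z0 -> cip Y Y0.
Proof.
move=> h [N0 [mN0 N00 hN0]] c e eta e0 eta0.
apply: filterS (c e eta e0 eta0) => n [B [mB PB hB]].
have [N [mN N1 hN]] := h n.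
exists (B `|` (N `|` N0)); split; first by do 2 apply: measurableU => //.
  rewrite (le_trans (measureU2 _ _ _))//; first exact: measurableU.
  rewrite -[leRHS]adde0 leeD// (le_trans (measureU2 _ _ _))//.
  by rewrite [X in (X + _)%E]N1 [X in (_ + X)%E]N00 adde0.
move=> w nB; have -> : Y n w = Z n w.
  by apply: contrapT => H; apply: nB; right; left; apply: hN => /= E; apply: H.
have -> : Y0 w = Z0 w.
  by apply: contrapT => H; apply: nB; right; right; apply: hN0 => /= E; apply: H.
by apply: hB => Bw; apply: nB; left.
Qed.

Lemma cip_dom (Z Y : rvs) (Z0 Y0 : rv) :
  (forall n, {ae P, forall w, `|Y n w - Y0 w| <= `|Z n w - Z0 w|}) ->
  cip Z Z0 -> cip Y Y0.
Proof.
move=> h c e eta e0 eta0.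
apply: filterS (c e eta e0 eta0) => n [B [mB PB hB]].
have [N [mN N1 hN]] := h n.
exists (B `|` N); split; first exact: measurableU.
  by rewrite (le_trans (measureU2 _ _ _))// [X in (_ + X)%E]N1 adde0.
move=> w nB; rewrite (le_trans (_ : _ <= `|Z n w - Z0 w|))//.
  by apply: contrapT => H; apply: nB; right; apply: hN => /= E; apply: H.
by apply: hB => Bw; apply: nB; left.
Qed.

Lemma cipD (Z Y : rvs) (Z0 Y0 : rv) : cip Z Z0 -> cip Y Y0 ->
  cip (fun n w => Z n w + Y n w) (fun w => Z0 w + Y0 w).
Proof.
move=> c1 c2 e eta e0 eta0.
have e2 : 0 < e / 2 by rewrite divr_gt0.
have eta2 : 0 < eta / 2 by rewrite divr_gt0.
apply: filterS2 (c1 _ _ e2 eta2) (c2 _ _ e2 eta2) => n [B [mB PB hB]] [D [mD PD hD]].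
exists (B `|` D); split; first exact: measurableU.
  by rewrite (le_trans (measureU2 _ _ _))// [eta in leRHS]splitr EFinD leeD.
move=> w nBD; rewrite opprD addrACA (le_trans (ler_normD _ _))// [e]splitr lerD//.
  by apply: hB => h; apply: nBD; left.
by apply: hD => h; apply: nBD; right.
Qed.

Lemma cipZ k (Z : rvs) (Z0 : rv) : cip Z Z0 -> cip (fun n w => k * Z n w) (fun w => k * Z0 w).
Proof.
move=> c e eta e0 eta0.
have k0 : 0 < `|k| + 1 by rewrite ltr_wpDl.
apply: filterS (c _ _ (divr_gt0 e0 k0) eta0) => n [B [mB PB hB]].
exists B; split => // w /hB; rewrite ler_pdivlMr// -mulrBr normrM => h.
by rewrite (le_trans _ h)// mulrC ler_wpM2l// lerDl.
Qed.

Lemma cip_cst (Z0 : rv) : cip (fun=> Z0) Z0.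
Proof.
move=> e eta e0 eta0; apply: nearW => n; exists set0; split => //.
  by rewrite measure0 lee_fin ltW.
by move=> w _; rewrite subrr normr0 ltW.
Qed.

Lemma cip_squeeze (Z Y : rvs) :
  (forall n, {ae P, forall w, `|Z n w| <= Y n w}) ->
  cip Y (fun=> 0) -> cip Z (fun=> 0).
Proof.
move=> h; apply: cip_dom => n; apply: filterS (h n) => w hw.
by rewrite !subr0 (le_trans hw)// ler_norm.
Qed.

Lemma markov_cover (D : rv) (c e : R) : measurable_fun setT D -> (forall w, 0 <= D w) ->
  0 < e -> (\int[P]_w (D w)%:E <= c%:E)%E -> (P [set w | (e < D w)%R] <= (c / e)%:E)%E.
Proof.
move=> mD D0 e0 Dc.
have mB : measurable [set w | e < D w].
  exact: measurable_gt.
have : (e%:E * P [set w | (e < D w)%R] <= c%:E)%E.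
  apply: le_trans Dc; rewrite -integral_cst//.
  rewrite integral_mkcond; apply: ge0_le_integral => //.
  - by move=> w _; apply: erestrict_ge0 => ? _; rewrite lee_fin ltW.
  - by apply/(measurable_restrictT _ mB).1; exact: measurable_cst.
  - exact: measurable_EFin_fun.
  - move=> w _; rewrite patchE; case: ifPn => [|_]; last by rewrite lee_fin.
    by rewrite inE /= lee_fin => /ltW.
rewrite -[P _]fineK ?fin_num_measure// -EFinM !lee_fin ler_pdivlMr//.
by rewrite mulrC.
Qed.

Lemma cip_L1 (D : rvs) (c : nat -> R) :
  (forall n, measurable_fun setT (D n)) ->
  (forall n w, 0 <= D n w) -> (forall n, (\int[P]_w (D n w)%:E <= (c n)%:E)%E) ->
  c @ \oo --> 0 -> cip D (fun=> 0).
Proof.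
move=> mD D0 Dc c0 e eta e0 eta0.
have /cvgrPdist_lt /(_ _ (mulr_gt0 eta0 e0)) := c0.
apply: filterS => n; rewrite /= sub0r normrN => hn.
exists [set w | e < D n w]; split.
- exact: measurable_gt.
- rewrite (le_trans (markov_cover _ _ _ (Dc n)))// lee_fin ler_pdivrMr//.
  by rewrite (le_trans (ler_norm _))// ltW.
- by move=> w /negP; rewrite -leNgt subr0 ger0_norm.
Qed.

Lemma tight (G : rv) (eta : R) : measurable_fun setT G -> 0 < eta ->
  exists K, [/\ 0 < K & (P [set w | (K < G w)%R] <= eta%:E)%E].
Proof.
move=> mG eta0; pose G' : {mfun Omega >-> R} := HB.pack G (isMeasurableFun.Build _ _ _ _ G mG).
have /fine_cvgP[_ /cvgrPdist_lt /(_ _ eta0)] := cvg_ccdfy0 (G' : {RV P >-> R}).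
move=> H; near (+oo%R : set_system R) => K; exists K; split; first by near: K; exact: nbhs_pinfty_gt.
have : `|0 - fine (ccdf (G' : {RV P >-> R}) K)| < eta by near: K; exact: H.
rewrite sub0r normrN => h.
have mB : measurable [set w | K < G w].
  exact: measurable_gt.
rewrite -[X in (X <= _)%E]fineK ?fin_num_measure// lee_fin.
apply: le_trans (ltW h); apply: le_trans (ler_norm _).
have -> : [set w | K < G w] = G @^-1` `]K, +oo[.
  by apply/seteqP; split => w; rewrite /= in_itv /= andbT.
exact: lexx.
Unshelve. all: by end_near. Qed.

(** A single real random variable is tight, so null constants times [G] tend to 0 in probability
    without any moment of [G]. This serves the drift terms. *)
Lemma cip_bounded (Z : rvs) (G : rv) (c : nat -> R) :
  measurable_fun setT G -> (forall n, 0 <= c n) -> c @ \oo --> 0 ->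
  (forall n, {ae P, forall w, `|Z n w| <= c n * G w}) -> cip Z (fun=> 0).
Proof.
move=> mG c0 cc hZ; apply: (cip_squeeze hZ) => e eta e0 eta0.
have [K' [K'0 hK']] : exists K', [/\ 0 < K' & (P [set w | (K' < `|G w|)%R] <= eta%:E)%E].
  by apply: tight => //; exact: measurableT_comp.
have /cvgrPdist_lt /(_ _ (divr_gt0 e0 K'0)) := cc.
apply: filterS => n; rewrite /= sub0r normrN ltr_pdivlMr// => hn.
exists [set w | K' < `|G w|]; split => //.
  by apply: measurable_gt; exact: measurableT_comp.
move=> w /negP; rewrite -leNgt subr0 normrM => h.
by rewrite (le_trans _ (ltW hn))// ler_wpM2l.
Qed.

(** No almost surely convergent subsequence is extracted: [Z0 ^+ 2] is truncated at [M], compared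
    with [Z n ^+ 2] for one large [n], and the truncation is removed by monotone convergence. *)
Lemma fatou_cip (Z : rvs) (Z0 : rv) (C : R) : cip Z Z0 -> measurable_fun setT Z0 ->
  (forall n, L2 P (Z n)) -> (\forall n \near \oo, m2 P (Z n) <= C) ->
  L2 P Z0 /\ m2 P Z0 <= C.
Proof.
move=> cZ mZ0 lZ ZC.
have C0 : 0 <= C.
  by near \oo => n; apply: (le_trans (m2_ge0 P (Z n))); near: n.
pose h (M : nat) w := Num.min (Z0 w ^+ 2) M%:R.
have mh M : measurable_fun setT (h M).
  by apply: measurable_minr => //; exact: sqr_measurable.
have h0 M w : 0 <= h M w by rewrite le_min sqr_ge0 ler0n.
have ih M : Int P (h M).
  apply: Int_dom (Int_cst P M%:R) _ => // w.
  by rewrite ger0_norm// ge_min lexx orbT.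
have hC M : EX P (h M) <= C.
  apply/ler_addgt0Pr => e e0.
  (* Off [B], [Z0 w ^+ 2] is at most [(1 + eta) * Z n w ^+ 2 + (eta + eta ^+ 2)]; on [B] the
     truncation is at most [M%:R]. As [eta <= 1], the excess over [C] is at most
     [eta * (C + 2 + M%:R)]. *)
  pose k := C + 2 + M%:R + 1.
  have k0 : 0 < k by rewrite /k; have : (0 : R) <= M%:R by []; lra.
  pose eta := Num.min 1 (e / k).
  have eta0 : 0 < eta by rewrite lt_min ltr01 divr_gt0.
  have eta1 : eta <= 1 by rewrite ge_min lexx.
  have etae : eta * k <= e by rewrite -ler_pdivlMr// ge_min lexx orbT.
  near \oo => n.
  have [B [mB PB hB]] : exists B, [/\ measurable B, (P B <= eta%:E)%E &
     forall w, ~ B w -> `|Z n w - Z0 w| <= eta] by near: n; exact: cZ.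
  have Zn : m2 P (Z n) <= C by near: n.
  have iB : Int P (\1_B : Omega -> R) by exact: integrable_indic.
  have EB : EX P (\1_B : Omega -> R) <= eta.
    rewrite -lee_fin EX_EFin// integral_indic// setIT//.
  have i1 := IntZ (1 + eta) (L2_sqr (lZ n)).
  have i2 := Int_cst P (eta + eta ^+ 2).
  have i3 := IntZ M%:R iB.
  apply: (@le_trans _ _ (EX P (fun w => ((1 + eta) * Z n w ^+ 2 + (eta + eta ^+ 2)) + M%:R * (\1_B w : R)))).
    apply: EX_le => [//||w]; first exact: IntD (IntD i1 i2) i3.
    rewrite indicE; case: (boolP (w \in B)) => [_|].
      rewrite /= mulr1 ler_wpDl//; last by rewrite ge_min lexx orbT.
      have s1 : 0 <= (1 + eta) * Z n w ^+ 2.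
        by rewrite mulr_ge0 ?sqr_ge0// addr_ge0// ltW.
      by have := sqr_ge0 eta; lra.
    rewrite notin_setE => /hB hw; rewrite /= mulr0 addr0 ge_min; apply/orP; left.
    have := sqr_ge0 (`|Z n w| - 1); rewrite -[Z n w ^+ 2]real_normK ?num_real//.
    have : Z0 w ^+ 2 <= (`|Z n w| + eta) ^+ 2.
      rewrite -[X in X <= _]real_normK ?num_real// ler_pXn2r// ?nnegrE// ?addr_ge0//; last exact: ltW.
      by rewrite -[Z0 w](subKr (Z n w)) (le_trans (ler_normB _ _))// lerD2l.
    set z := `|Z n w|; set y := Z0 w ^+ 2 => yz zz.
    have : 0 <= eta * (z - 1) ^+ 2 by rewrite mulr_ge0// ltW.
    by lra.
  rewrite (EXD (IntD i1 i2) i3) (EXD i1 i2) EX_cst (EXZ _ iB) (EXZ _ (L2_sqr (lZ n))).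
  rewrite -/(m2 P (Z n)).
  have h1 : (1 + eta) * m2 P (Z n) <= (1 + eta) * C by rewrite ler_wpM2l// addr_ge0// ltW.
  have h2 : M%:R * EX P (\1_B : Omega -> R) <= M%:R * eta by rewrite ler_wpM2l.
  have h3 : eta ^+ 2 <= eta by rewrite expr2 ler_piMr// ltW.
  by move: etae; rewrite /k; lra.
have key : (\int[P]_w (Z0 w ^+ 2)%:E <= C%:E)%E.
  have cv : (fun M => \int[P]_w (h M w)%:E)%E @ \oo --> (\int[P]_w (Z0 w ^+ 2)%:E)%E.
    have hl w : (fun M => (h M w)%:E) @ \oo --> (Z0 w ^+ 2)%:E.
      apply: cvg_EFin; first exact: nearW.
      apply: cvg_near_cst; near=> M; rewrite /= /h min_l//.
      apply/ltW; apply: (lt_le_trans (truncnS_gt _)); rewrite ler_nat.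
      by near: M; exact: nbhs_infty_ge.
    have -> : (fun w => (Z0 w ^+ 2)%:E) = (fun w => limn (fun M => (h M w)%:E)).
      by apply/funext => w; apply/esym/cvg_lim => //; exact: hl.
    apply: cvg_monotone_convergence => //.
    - by move=> M; exact: measurable_EFin_fun.
    - by move=> M w _; rewrite lee_fin.
    - move=> w _ M N MN; rewrite lee_fin /h le_min; apply/andP; split.
        by rewrite ge_min lexx.
      by rewrite ge_min ler_nat MN orbT.
  rewrite -(cvg_lim _ cv)//; apply: lime_le; first by apply/cvg_ex; eexists; exact: cv.
  by apply: nearW => M; rewrite -EX_EFin// lee_fin.
have lZ0 : L2 P Z0 by split => //; apply: (le_lt_trans key); rewrite ltry.
by split => //; rewrite -lee_fin EX_EFin//; exact: L2_sqr.
Unshelve. all: by end_near. Qed.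

(** Expand around [Y] and split the cross term by Young's inequality: the small weight falls on the
    fixed limit [Y], the large one on the difference. *)
Lemma m2_near (X Y : rv) (eps : R) : L2 P X -> L2 P Y -> 0 < eps -> eps <= 1 ->
  `|m2 P X - m2 P Y| <= eps * (2 * m2 P Y) + (2 / eps) * m2 P (fun w => X w - Y w).
Proof.
move=> lX lY e0 e1; have lD := L2B lX lY.
have E : m2 P X = m2 P (fun w => (X w - Y w) + Y w).
  by congr (m2 P _); apply/funext => w; rewrite subrK.
rewrite E m2D// addrK.
have hcs := cauchy_schwarz lD lY.
set c := EX _ _ in hcs *; set a := m2 P (fun w => X w - Y w) in hcs *; set b := m2 P Y in hcs *.
have a0 : 0 <= a by exact: m2_ge0.
have b0 : 0 <= b by exact: m2_ge0.
have ie : 1 <= eps^-1 by rewrite invf_ge1.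
have hc : `|2 * c| <= eps * b + eps^-1 * a.
  rewrite -(@ler_pXn2r _ 2)// ?nnegrE ?addr_ge0 ?mulr_ge0 ?invr_ge0//; try exact: ltW.
  rewrite real_normK ?num_real//.
  have : 4 * (a * b) <= (eps * b + eps^-1 * a) ^+ 2.
    have := sqr_ge0 (eps * b - eps^-1 * a).
    have -> : (eps * b + eps^-1 * a) ^+ 2 = (eps * b - eps^-1 * a) ^+ 2 + 4 * (a * b) * (eps * eps^-1) by ring.
    by rewrite mulfV ?gt_eqF// mulr1; lra.
  by rewrite exprMn; lra.
rewrite (le_trans (ler_normD _ _))// (ger0_norm a0).
have h1 : a <= eps^-1 * a by rewrite ler_peMl.
have h2 : 0 <= eps * b by rewrite mulr_ge0// ltW.
have -> : 2 / eps * a = 2 * (eps^-1 * a) by ring.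
by lra.
Qed.

Lemma cvg_m2 (Z : rvs) (Z0 : rv) : (forall n, L2 P (Z n)) -> L2 P Z0 ->
  (fun n => m2 P (fun w => Z n w - Z0 w)) @ \oo --> 0 ->
  (fun n => m2 P (Z n)) @ \oo --> m2 P Z0.
Proof.
move=> lZ lZ0 h; apply/cvgrPdist_le => e e0.
pose k := 2 * m2 P Z0 + 1.
have k0 : 0 < k by rewrite /k; have := m2_ge0 P Z0; lra.
pose eps := Num.min 1 (e / 2 / k).
have eps0 : 0 < eps by rewrite lt_min ltr01 !divr_gt0.
have eps1 : eps <= 1 by rewrite ge_min lexx.
have epse : eps * k <= e / 2 by rewrite -ler_pdivlMr// ge_min lexx orbT.
have e' : 0 < e / 2 * (eps / 2) by rewrite mulr_gt0// divr_gt0.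
have /cvgrPdist_lt /(_ _ e') := h; apply: filterS => n.
rewrite sub0r normrN ger0_norm ?m2_ge0// => hn.
rewrite distrC (le_trans (m2_near (lZ n) lZ0 eps0 eps1))//.
set a := m2 P (fun w => _) in hn *.
have : 2 / eps * a <= e / 2.
  by rewrite -ler_pdivlMl ?divr_gt0// invf_div mulrC ltW.
by move: epse; rewrite /k; nra.
Qed.

Lemma cvg_EX (Z : rvs) (Z0 : rv) : (forall n, L2 P (Z n)) -> L2 P Z0 ->
  (fun n => m2 P (fun w => Z n w - Z0 w)) @ \oo --> 0 ->
  (fun n => EX P (Z n)) @ \oo --> EX P Z0.
Proof.
move=> lZ lZ0 h; apply/cvgrPdist_lt => e e0.
have e20 : 0 < e ^+ 2 by rewrite exprn_gt0.
have /cvgrPdist_lt /(_ _ e20) := h; apply: filterS => n.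
rewrite sub0r normrN ger0_norm ?m2_ge0// => hn.
rewrite distrC -EXB; [|exact: L2_Int|exact: L2_Int].
rewrite -(@ltr_pXn2r _ 2)// ?nnegrE//; last exact: ltW.
by rewrite real_normK ?num_real// (le_lt_trans _ hn)// jensen//; exact: L2B.
Qed.

Lemma cvg_vari (Z : rvs) (Z0 : rv) : (forall n, L2 P (Z n)) -> L2 P Z0 ->
  (fun n => m2 P (fun x => Z n x - Z0 x)) @ \oo --> 0 ->
  (fun n => vari P (Z n)) @ \oo --> vari P Z0.
Proof.
move=> lZ l0 h.
have vE X : L2 P X -> vari P X = m2 P X - EX P X ^+ 2 by move=> /m2_vari ->; rewrite addrK.
rewrite (vE _ l0); under eq_fun do rewrite vE//.
apply: cvgB; first exact: cvg_m2.
by rewrite expr2; under eq_fun do rewrite expr2; apply: cvgM; exact: cvg_EX.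
Qed.

End InProbability.

(** * Independence and Lévy processes *)

(** Links [borel], generated by the open sets, with the measurable sets of [R]: the latter are
    generated by open rays, whose preimages are open. *)
Lemma borel_preimage (R : realType) (X : topologicalType) (f : X -> R) (A : set R) :
  continuous f -> measurable A -> borel (f @^-1` A).
Proof.
move=> cf.
have -> : measurable A = (<<s [set O : set R | exists x, O = `]x, +oo[%classic] >> A).
  by rewrite -[RHS]/(_.-sigma.-measurable A) -RGenOInfty.measurableE.
have h : sigma_algebra setT (image_set_system setT f (@borel X)).
  exact/sigma_algebra_image/smallest_sigma_algebra.
move=> /(smallest_sub h) hA; suff : image_set_system setT f (@borel X) A.
  by rewrite /image_set_system /= setTI.
apply: hA => _ [x ->]; rewrite /image_set_system /= setTI; apply: sub_sigma_algebra => /=.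
by apply: open_comp; [move=> y _; exact: cf|exact: interval_open].
Qed.

Section Independence.
Context {R : realType} {d : measure_display} {Omega : measurableType d}.
Variable P : probability Omega R.
Implicit Types X Y : Omega -> R.

Definition same_law X Y := forall B : set R, measurable B ->
  P [set w | B (X w)] = P [set w | B (Y w)].

Definition indep X Y := forall A B : set R, measurable A -> measurable B ->
  P [set w | A (X w) /\ B (Y w)] = (P [set w | A (X w)] * P [set w | B (Y w)])%E.

Lemma same_law_ge0_integral X Y (f : R -> \bar R) : measurable_fun setT X ->
  measurable_fun setT Y -> same_law X Y -> measurable_fun setT f -> (forall x, 0 <= f x)%E ->
  (\int[P]_w f (X w) = \int[P]_w f (Y w))%E.
Proof.
move=> mX mY XY mf f0.
pose X' : {mfun Omega >-> R} := HB.pack X (isMeasurableFun.Build _ _ _ _ X mX).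
pose Y' : {mfun Omega >-> R} := HB.pack Y (isMeasurableFun.Build _ _ _ _ Y mY).
have <- := ge0_integral_distribution (P := P) (X' : {RV P >-> R}) mf f0.
have <- := ge0_integral_distribution (P := P) (Y' : {RV P >-> R}) mf f0.
by apply: eq_measure_integral => A mA _; exact: XY.
Qed.

Lemma same_law_L2 X Y : measurable_fun setT X -> same_law X Y -> L2 P Y -> L2 P X.
Proof.
move=> mX XY [mY lY]; split => //.
rewrite (same_law_ge0_integral (f := fun x => (x ^+ 2)%:E) mX mY XY)//.
  by apply/measurable_EFinP; exact: (measurable_funX 2 (@measurable_id _ R setT)).
by move=> x; rewrite lee_fin sqr_ge0.
Qed.

Lemma same_law_m2 X Y k : measurable_fun setT X -> measurable_fun setT Y -> same_law X Y ->
  m2 P (fun w => X w - k) = m2 P (fun w => Y w - k).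
Proof.
move=> mX mY XY; congr fine.
rewrite (same_law_ge0_integral (f := fun x => ((x - k) ^+ 2)%:E) mX mY XY)//.
  apply/measurable_EFinP; apply: measurable_funX.
  by apply: measurable_funB => //; exact: measurable_id.
by move=> x; rewrite lee_fin sqr_ge0.
Qed.

(* The mean is recovered from the two second moments E X^2 and E (X - 1)^2. *)
Lemma same_law_EX X Y : same_law X Y -> L2 P X -> L2 P Y -> EX P X = EX P Y.
Proof.
move=> XY lX lY.
have key Z : L2 P Z -> m2 P (fun w => Z w - 1) = m2 P (fun w => Z w - 0) - 2 * EX P Z + 1.
  move=> lZ; rewrite /m2; have iZ := IntZ 2 (L2_Int lZ).
  have iZ2 : Int P (fun w => (Z w - 0) ^+ 2) by under eq_fun do rewrite subr0; exact: L2_sqr.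
  have i1 := Int_cst P 1.
  have -> : (fun w => (Z w - 1) ^+ 2) = (fun w => ((Z w - 0) ^+ 2 - 2 * Z w) + 1).
    by apply/funext => w; ring.
  by rewrite (EXD (IntB iZ2 iZ) i1) (EXB iZ2 iZ) EX_cst (EXZ 2 (L2_Int lZ)).
have := key _ lX; rewrite (same_law_m2 _ _ _ XY); [|by case: lX|by case: lY].
rewrite (same_law_m2 _ _ _ XY); [|by case: lX|by case: lY].
by rewrite key// => ?; lra.
Qed.

Section JointLaw.
Variables X Y : Omega -> R.
Hypotheses (mX : measurable_fun setT X) (mY : measurable_fun setT Y) (iXY : indep X Y).

Let X' : {mfun Omega >-> R} := HB.pack X (isMeasurableFun.Build _ _ _ _ X mX).
Let Y' : {mfun Omega >-> R} := HB.pack Y (isMeasurableFun.Build _ _ _ _ Y mY).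
Let mXY : measurable_fun setT (fun w => (X w, Y w)).
Proof. exact: measurable_fun_pair. Qed.
Let XY' : {mfun Omega >-> (R * R)%type} :=
  HB.pack (fun w => (X w, Y w)) (isMeasurableFun.Build _ _ _ _ _ mXY).
Let PX : probability R R := distribution P X'.
Let PY : probability R R := distribution P Y'.
Let PXY : probability (R * R)%type R := distribution P XY'.

Let joint A : measurable A -> (PX \x PY)%E A = PXY A.
Proof. by apply: product_measure_unique => B C mB mC; exact: iXY. Qed.

Lemma indep_ge0_integral (f : R * R -> \bar R) : measurable_fun setT f ->
  (forall z, 0 <= f z)%E ->
  (\int[P]_w f (X w, Y w) = \int[PX]_x \int[PY]_y f (x, y))%E.
Proof.
move=> mf f0.
have <- := ge0_integral_distribution (P := P) (XY' : {RV P >-> (R * R)%type}) mf f0.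
rewrite -(@fubini_tonelli1 _ _ _ _ _ PX PY _ mf f0).
by apply: eq_measure_integral => A mA _; exact/esym/joint.
Qed.

(** By Tonelli the second moment of the sum is an average over [y] of those of [X + y]. One of them
    is finite, and subtracting the constant [y] gives [X]. *)
Lemma indep_L2 : L2 P (fun w => X w + Y w) -> L2 P X.
Proof.
move=> [mS lS]; split => //.
have mf : measurable_fun setT (fun z : R * R => ((z.1 + z.2) ^+ 2)%:E).
  by apply/measurable_EFinP; apply: measurable_funX; apply: measurable_funD.
have f0 (z : R * R) : (0 <= ((z.1 + z.2) ^+ 2)%:E)%E by rewrite lee_fin sqr_ge0.
have := indep_ge0_integral mf f0.
rewrite -(@fubini_tonelli1 _ _ _ _ _ PX PY _ mf f0) (@fubini_tonelli2 _ _ _ _ _ PX PY _ mf f0) /fubini_G /= => E.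
have [y hy] : exists y, (\int[PX]_x ((x + y) ^+ 2)%:E < +oo)%E.
  apply: contrapT => /forallNP hn; move: lS; rewrite E.
  rewrite (eq_integral (fun=> +oo%E)) ?integral_cst//; last first.
    move=> y _; apply/eqP; rewrite -leye_eq leNgt; apply/negP; exact: hn.
  by rewrite [X in (_ * X)%E](_ : _ = 1%E) ?mule1 ?ltxx//; exact: (probability_setT PY).
have <- : (\int[PX]_x (x ^+ 2)%:E = \int[P]_w (X w ^+ 2)%:E)%E.
  apply: (ge0_integral_distribution (P := P) (X' : {RV P >-> R})).
    by apply/measurable_EFinP; exact: (measurable_funX 2 (@measurable_id _ R setT)).
  by move=> x; rewrite lee_fin sqr_ge0.
have l1 : L2 PX (fun x => x + y).
  by split => //; apply: measurable_funD => //; exact: measurable_id.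
have [_] := L2B l1 (L2_cst PX y).
by under [X in (X < _)%E -> _]eq_integral do rewrite addrK.
Qed.

Lemma indep_EXM : L2 P X -> L2 P Y -> EX P (fun w => X w * Y w) = EX P X * EX P Y.
Proof.
move=> lX lY.
have mf : measurable_fun setT (fun z : R * R => (z.1 * z.2)%:E).
  by apply/measurable_EFinP; apply: measurable_funM.
have iM : P.-integrable setT ((fun z : R * R => (z.1 * z.2)%:E) \o XY') by exact: (L2_mul lX lY).
have E1 := integral_distribution (P := P) (X := XY' : {RV P >-> (R * R)%type}) mf iM.
have E2 : (\int[PXY]_z (z.1 * z.2)%:E = \int[PX \x PY]_z (z.1 * z.2)%:E)%E.
  by apply: eq_measure_integral => A mA _; exact/esym/joint.
have iprod : (PX \x PY)%E.-integrable setT (fun z : R * R => (z.1 * z.2)%:E).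
  apply/integrableP; split => //.
  have -> : (\int[PX \x PY]_z `|(z.1 * z.2)%:E| = \int[PXY]_z `|(z.1 * z.2)%:E|)%E.
    by apply: eq_measure_integral => A mA _; exact: joint.
  rewrite (ge0_integral_distribution (P := P) (XY' : {RV P >-> (R * R)%type}))//.
    by case/integrableP : iM.
  exact: measurableT_comp.
have mid : measurable_fun setT (fun x : R => x%:E) by apply/measurable_EFinP; exact: measurable_id.
have iX : (\int[PX]_x x%:E = \int[P]_w (X w)%:E)%E.
  by apply: (integral_distribution (P := P) (X := X' : {RV P >-> R})) => //; exact: L2_Int lX.
have iY : (\int[PY]_x x%:E = \int[P]_w (Y w)%:E)%E.
  by apply: (integral_distribution (P := P) (X := Y' : {RV P >-> R})) => //; exact: L2_Int lY.
have iPX : PX.-integrable setT (fun x : R => x%:E).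
  apply/integrableP; split => //.
  rewrite (ge0_integral_distribution (P := P) (X' : {RV P >-> R}))//; last exact: measurableT_comp.
  by case/integrableP : (L2_Int lX).
have iPY : PY.-integrable setT (fun x : R => x%:E).
  apply/integrableP; split => //.
  rewrite (ge0_integral_distribution (P := P) (Y' : {RV P >-> R}))//; last exact: measurableT_comp.
  by case/integrableP : (L2_Int lY).
rewrite /EX /Rintegral.
have -> : (\int[P]_w (X w * Y w)%:E = (EX P X * EX P Y)%:E)%E; last by [].
rewrite -[LHS]E1 E2 -(integral12_prod_meas1 iprod) /fubini_F /=.
under eq_integral => x _.
  under eq_integral do rewrite EFinM.
  rewrite integralZl// iY -EX_EFin; last exact: L2_Int.
  over.
rewrite integralZr// iX -EX_EFin//; exact: L2_Int.
Qed.

End JointLaw.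

End Independence.

(** Subtracting the linear part leaves an additive [g] with [g 1 = 0]. It has period 1 and is
    bounded on [0, 1], hence bounded by some [K] everywhere; additivity then bounds [n] times the
    modulus of [g t] by [K] for all [n]. *)
Lemma additive_bounded_linear (R : realType) (f : R -> R) (eta C : R) : 0 < eta ->
  (forall s t, 0 <= s -> 0 <= t -> f (s + t) = f s + f t) ->
  (forall t, 0 <= t -> t <= eta -> `|f t| <= C) ->
  forall t, 0 <= t -> f t = t * f 1.
Proof.
move=> eta0 fD fb.
pose g t := f t - t * f 1.
have gD s t : 0 <= s -> 0 <= t -> g (s + t) = g s + g t.
  by move=> s0 t0; rewrite /g fD//; ring.
have gM n t : 0 <= t -> g (n%:R * t) = n%:R * g t.
  move=> t0; elim: n => [|n ih].
    rewrite !mul0r; have := gD 0 0 (lexx _) (lexx _); rewrite addr0 => ?; lra.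
  by rewrite -natr1 mulrDl mul1r gD ?mulr_ge0// ih; ring.
have g1 : g 1 = 0 by rewrite /g mul1r subrr.
have [N N0 hN] : exists2 N : nat, (0 < N)%N & 1 <= N%:R * eta.
  exists (Num.truncn eta^-1).+1 => //.
  by rewrite -ler_pdivrMr// mul1r ltW// truncnS_gt.
have gb r : 0 <= r -> r <= 1 -> `|g r| <= N%:R * (C + eta * `|f 1|).
  move=> r0 r1; have N0' : (0 : R) < N%:R by rewrite ltr0n.
  have -> : r = N%:R * (r / N%:R) by rewrite mulrCA mulfV ?mulr1// gt_eqF.
  have rN0 : 0 <= r / N%:R by rewrite divr_ge0// ltW.
  have rN : r / N%:R <= eta.
    by rewrite ler_pdivrMr// mulrC (le_trans r1).
  rewrite gM// normrM gtr0_norm//; apply: ler_wpM2l; first exact: ltW.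
  rewrite /g (le_trans (ler_normB _ _))//.
  by rewrite lerD ?fb// normrM ger0_norm// ler_wpM2r.
move=> t t0; apply/eqP; rewrite -subr_eq0 -/(g t) -normr_le0; apply/ler_addgt0Pr => e e0.
rewrite add0r; set K := N%:R * (C + eta * `|f 1|) in gb.
have K0 : 0 <= K by apply: le_trans (gb 0 (lexx _) ler01).
pose n := (Num.truncn (K / e)).+1.
have nK : K <= n%:R * e by rewrite -ler_pdivrMr// ltW// truncnS_gt.
have n0 : (0 : R) < n%:R by rewrite ltr0n.
rewrite -(ler_pM2l n0) -{1}(gtr0_norm n0) -normrM -gM//.
apply: le_trans nK; set s := n%:R * t.
have s0 : 0 <= s by rewrite mulr_ge0.
have -> : s = (s - (Num.truncn s)%:R) + (Num.truncn s)%:R * 1 by rewrite mulr1 subrK.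
have hs := truncn_itv s0; case/andP : hs => h1 h2.
rewrite gD ?subr_ge0 ?mulr1// -[X in g X + _]/(_) -[(Num.truncn s)%:R]mulr1 gM// g1 mulr0 addr0 mulr1.
by apply: gb; rewrite ?subr_ge0// lerBlDl; move: h2; rewrite -natr1 => /ltW.
Qed.

(** * First and second moments of a cylindrical Lévy process *)

Section Levy.
Context {R : realType} {d : measure_display} {Omega : measurableType d}.
Variable P : probability Omega R.
Context {U : completeNormedModType R} (L : R -> U -> Omega -> R).
Hypothesis hL : cylindrical_levy P L.
Hypothesis hL2 : forall u : U, (\int[P]_w ((L 1 u w) ^+ 2)%:E < +oo)%E.
Implicit Types (s t r : R) (u v : U).

Lemma borel_coord n (i : 'I_n) (A : set R) : measurable A ->
  borel [set x : 'rV[R]_n | A (x 0 i)].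
Proof.
apply: (@borel_preimage R 'rV[R]_n (fun x => x 0 i)) => x.
exact: coord_continuous.
Qed.

Lemma levy_measurable t u : measurable_fun setT (L t u).
Proof. by case: hL. Qed.

Lemma levy_start u : {ae P, forall w, L 0 u w = 0}.
Proof.
case: hL => _ _ _ /(_ 1%N (fun=> u)) [_ h0 _ _ _].
by apply: filterS h0 => w /(congr1 (fun x : 'rV[R]_1 => x 0 0)); rewrite !mxE.
Qed.

Lemma levy_increment_law s t u : 0 <= s -> s <= t ->
  same_law P (fun w => L t u w - L s u w) (L (t - s) u).
Proof.
move=> s0 st A mA; case: hL => _ _ _ /(_ 1%N (fun=> u)) [_ _ _ h _].
have := h s t _ s0 st (@borel_coord 1 0 A mA).
by rewrite /=; under eq_set do rewrite !mxE; under [X in _ = P X -> _]eq_set do rewrite !mxE.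
Qed.

(** The definition is applied to the process in R^2 given by [u] and [v], so the two increments may
    be tested with different vectors. It speaks only of consecutive intervals along a strictly
    increasing sequence of times. *)
Lemma levy_increment_indep s1 t1 s2 t2 u v : 0 <= s1 -> s1 < t1 -> t1 <= s2 -> s2 < t2 ->
  indep P (fun w => L t1 u w - L s1 u w) (fun w => L t2 v w - L s2 v w).
Proof.
move=> s10 st1 ts st2 A B mA mB.
pose uv (i : 'I_2) := if i == 0 then u else v.
case: hL => _ _ _ /(_ 2%N uv) [_ _ h _ _].
have bA := @borel_coord 2 0 A mA; have bB := @borel_coord 2 1 B mB.
have bT : borel [set: 'rV[R]_2] by apply: sub_sigma_algebra; exact: openT.
have PT : P [set w : Omega | True] = 1%E by exact: probability_setT.
have EA : [set w | A (L t1 u w - L s1 u w)] =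
  [set w | [set x : 'rV[R]_2 | A (x 0 0)] ((\row_i L t1 (uv i) w) - (\row_i L s1 (uv i) w))].
  by apply/seteqP; split => w /=; rewrite !mxE.
have EB : [set w | B (L t2 v w - L s2 v w)] =
  [set w | [set x : 'rV[R]_2 | B (x 0 1)] ((\row_i L t2 (uv i) w) - (\row_i L s2 (uv i) w))].
  by apply/seteqP; split => w /=; rewrite !mxE.
have EAB : [set w | A (L t1 u w - L s1 u w) /\ B (L t2 v w - L s2 v w)] =
    [set w | A (L t1 u w - L s1 u w)] `&` [set w | B (L t2 v w - L s2 v w)].
  by apply/seteqP; split.
rewrite EAB EA EB; move: ts; rewrite le_eqVlt => /predU1P[ts|ts].
  (* Adjacent intervals: the times [s1], [t1], [t2], continued by unit steps because an infinite
     sequence is required. *)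
  pose t k := if k is k'.+1 then if k' is k''.+1 then t2 + k''%:R else t1 else s1.
  pose Bs k := if k is _.+1 then [set x : 'rV[R]_2 | B (x 0 1)] else [set x : 'rV[R]_2 | A (x 0 0)].
  have t0 : 0 <= t 0%N by [].
  have tS k : t k < t k.+1.
    case: k => [//|[|k]] /=; first by rewrite addr0 ts.
    by rewrite ltrD2l ltr_nat.
  have bBs k : borel (Bs k) by case: k.
  have := h 2%N t Bs t0 tS bBs.
  rewrite bigcap_mkord !big_ord_recr !big_ord0 /= setTI mul1e addr0.
  by rewrite -ts.
(* With a gap, the interval from [t1] to [s2] is inserted and carries [setT], an event of
   probability one. *)
pose t k := if k is k'.+1 then if k' is k''.+1 then if k'' is k3.+1 then t2 + k3%:R else s2 else t1 else s1.
pose Bs k := if k is k'.+1 then if k' is _.+1 then [set x : 'rV[R]_2 | B (x 0 1)] else setT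
  else [set x : 'rV[R]_2 | A (x 0 0)].
have t0 : 0 <= t 0%N by [].
have tS k : t k < t k.+1.
  case: k => [//|[//|[|k]]] /=; first by rewrite addr0.
  by rewrite ltrD2l ltr_nat.
have bBs k : borel (Bs k) by case: k => [//|[]].
have := h 3%N t Bs t0 tS bBs.
rewrite bigcap_mkord !big_ord_recr !big_ord0 /= setTI mul1e addr0.
by rewrite [X in P (_ `&` X `&` _)](_ : _ = setT)// setIT PT mule1.
Qed.

(** Finite second moments are given at time 1 only. Before it, [L 1 u] splits into independent
    increments and [indep_L2] passes to the first; beyond it, increments of length 1, with the law
    of [L 1 u], are added. *)
Lemma levy_L2 t u : 0 <= t -> L2 P (L t u).
Proof.
have L0 v : L2 P (L 0 v).
  apply: L2_ae (L2_cst P 0); first exact: levy_measurable.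
  by apply: filterS (levy_start v) => w ->.
have l1 : L2 P (L 1 u) by split; [exact: levy_measurable|exact: hL2].
have small r : 0 <= r -> r <= 1 -> L2 P (L r u).
  rewrite le_eqVlt => /predU1P[<- _//|r0]; rewrite le_eqVlt => /predU1P[->//|r1].
  have : L2 P (fun w => L r u w - L 0 u w).
    apply: (@indep_L2 _ _ _ _ _ (fun w => L 1 u w - L r u w)).
    - by apply: measurable_funB; exact: levy_measurable.
    - by apply: measurable_funB; exact: levy_measurable.
    - exact: levy_increment_indep.
    - by under eq_fun do rewrite addrC subrKA; exact: L2B.
  by move=> /L2D /(_ (L0 u)); under eq_fun do rewrite subrK.
have main n : forall r, 0 <= r -> r <= n%:R -> L2 P (L r u).
  elim: n => [|n ih] r r0 rn; first by apply: small => //; rewrite (le_trans rn).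
  have [r1|r1] := leP r 1; first exact: small.
  have r10 : 0 <= r - 1 by lra.
  have lr : L2 P (L (r - 1) u) by apply: ih => //; move: rn; rewrite -natr1; lra.
  have : L2 P (fun w => L r u w - L (r - 1) u w).
    apply: (same_law_L2 _ (levy_increment_law _ r10 _)); last 2 first.
    - lra.
    - by have -> : r - (r - 1) = 1 by lra.
    by apply: measurable_funB; exact: levy_measurable.
  by move=> /L2D /(_ lr); under eq_fun do rewrite subrK.
by move=> t0; apply: (main (Num.truncn t).+1) => //; exact/ltW/truncnS_gt.
Qed.

Definition levy_mean u := EX P (L 1 u).
Definition levy_var u := m2 P (fun w => L 1 u w - levy_mean u).

Lemma levy_increment_L2 s t u : 0 <= s -> 0 <= t -> L2 P (fun w => L t u w - L s u w).
Proof. by move=> s0 t0; apply: L2B; exact: levy_L2. Qed.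

Let cent t u w := L t u w - EX P (L t u).

Let cent_L2 t u : 0 <= t -> L2 P (cent t u).
Proof. by move=> t0; apply: L2B; [exact: levy_L2|exact: L2_cst]. Qed.

Let EX_incr s t u : 0 <= s -> s <= t ->
  EX P (fun w => L t u w - L s u w) = EX P (L (t - s) u).
Proof.
move=> s0 st; have t0 := le_trans s0 st.
apply: same_law_EX; [exact: levy_increment_law|exact: levy_increment_L2|].
by apply: levy_L2; rewrite subr_ge0.
Qed.

Let meanD s t u : 0 <= s -> 0 <= t -> EX P (L (s + t) u) = EX P (L s u) + EX P (L t u).
Proof.
move=> s0 t0; have := EX_incr u s0 (_ : s <= s + t).
rewrite lerDl addrAC subrr add0r => /(_ t0) <-.
rewrite EXB; [ring|apply: L2_Int; apply: levy_L2|apply: L2_Int; exact: levy_L2].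
exact: addr_ge0.
Qed.

Let EX_start u : EX P (L 0 u) = 0.
Proof.
rewrite -[RHS](EX_cst P); apply: EX_ae => //; [exact: levy_measurable|].
exact: levy_start.
Qed.

(** [levy_increment_indep] requires nondegenerate intervals; on a degenerate one the centred
    increment vanishes identically. *)
Let uncorr s1 t1 s2 t2 u v : 0 <= s1 -> s1 <= t1 -> t1 <= s2 -> s2 <= t2 ->
  EX P (fun w => (L t1 u w - L s1 u w - EX P (L (t1 - s1) u)) *
                 (L t2 v w - L s2 v w - EX P (L (t2 - s2) v))) = 0.
Proof.
move=> s10; rewrite le_eqVlt => /predU1P[<-|st1] ts.
  move=> _; under eq_fun do rewrite !subrr EX_start subr0 mul0r.
  exact: EX_cst.
rewrite le_eqVlt => /predU1P[<-|st2].
  under eq_fun do rewrite !subrr EX_start subr0 mulr0.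
  exact: EX_cst.
have t10 : 0 <= t1 by apply: le_trans (ltW st1).
have s20 : 0 <= s2 by apply: le_trans ts.
have t20 : 0 <= t2 by apply: le_trans (ltW st2).
rewrite -(EX_incr u s10 (ltW st1)) -(EX_incr v s20 (ltW st2)).
set X := fun w => L t1 u w - L s1 u w; set Y := fun w => L t2 v w - L s2 v w.
have lX : L2 P X by exact: levy_increment_L2.
have lY : L2 P Y by exact: levy_increment_L2.
have iXY : EX P (fun w => X w * Y w) = EX P X * EX P Y.
  apply: indep_EXM => //; [by case: lX|by case: lY|exact: levy_increment_indep].
have i1 := L2_mul lX lY; have i2 := IntZ (EX P Y) (L2_Int lX).
have i3 := IntZ (EX P X) (L2_Int lY); have i4 := Int_cst P (EX P X * EX P Y).
have -> : (fun w => (X w - EX P X) * (Y w - EX P Y)) =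
   (fun w => (X w * Y w - EX P Y * X w) - (EX P X * Y w - EX P X * EX P Y)).
  by apply/funext => w; ring.
rewrite (EXB (IntB i1 i2) (IntB i3 i4)) (EXB i1 i2) (EXB i3 i4) EX_cst iXY.
by rewrite !EXZ//; [ring|exact: L2_Int|exact: L2_Int].
Qed.

Let incr_var s t u : 0 <= s -> s <= t ->
  m2 P (fun w => L t u w - L s u w - EX P (L (t - s) u)) = m2 P (cent (t - s) u).
Proof.
move=> s0 st; have t0 := le_trans s0 st; apply: same_law_m2.
- by case: (levy_increment_L2 u s0 t0).
- exact: levy_measurable.
- exact: levy_increment_law.
Qed.

Let varD s t u : 0 <= s -> 0 <= t -> m2 P (cent (s + t) u) = m2 P (cent s u) + m2 P (cent t u).
Proof.
move=> s0 t0.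
have st0 : 0 <= s + t by exact: addr_ge0.
have sst : s <= s + t by rewrite lerDl.
have E1 := incr_var u (lexx 0) s0; have E2 := incr_var u s0 sst.
have E := uncorr u u (lexx 0) s0 (lexx s) sst.
rewrite subr0 in E1 E; rewrite addrAC subrr add0r in E2 E.
set X := fun w => L s u w - L 0 u w - EX P (L s u) in E1 E.
set Y := fun w => L (s + t) u w - L s u w - EX P (L t u) in E2 E.
have lX : L2 P X by apply: L2B; [exact: levy_increment_L2|exact: L2_cst].
have lY : L2 P Y by apply: L2B; [exact: levy_increment_L2|exact: L2_cst].
rewrite -E1 -E2 (_ : m2 P (cent (s + t) u) = m2 P (fun w => X w + Y w)).
  by rewrite (m2D lX lY) E mulr0 addr0.
apply: m2_ae; [by case: (cent_L2 u st0)|by case: (L2D lX lY)|].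
apply: filterS (levy_start u) => w h.
by rewrite /cent /X /Y h meanD//; ring.
Qed.

(** Additivity and nonnegativity make the variance monotone in time, hence bounded on [0, 1]. *)
Let var_linear t u : 0 <= t -> m2 P (cent t u) = t * m2 P (cent 1 u).
Proof.
apply: (@additive_bounded_linear R (fun t => m2 P (cent t u)) 1 (m2 P (cent 1 u))) => //.
  by move=> s r s0 r0; exact: varD.
move=> r r0 r1; rewrite (ger0_norm (m2_ge0 _ _)).
rewrite -[X in _ <= m2 P (cent X u)](subrKC r) varD ?subr_ge0//.
by rewrite lerDl m2_ge0.
Qed.

Let norm_row1 (x : 'rV[R]_1) : `|x| = `|x 0 0|.
Proof.
have mxE : `|x| = \big[Num.max/0]_ij `|x ij.1 ij.2| by rewrite -mx_normrE.
rewrite mxE; apply/eqP; rewrite eq_le; apply/andP; split.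
  by apply: bigmax_le => [//|[i j] _]; rewrite /= (ord1 i) (ord1 j).
exact: (@le_bigmax _ _ _ 0 (fun ij : 'I_1 * 'I_1 => `|x ij.1 ij.2|) (0, 0)).
Qed.

(* [E L(s) u] is additive in [s]; it is bounded near [0] because, by stochastic
   continuity and Chebyshev, some outcome has both [L(s) u] and [L(s) u - E L(s) u]
   bounded. *)
Let mean_linear t u : 0 <= t -> EX P (L t u) = t * EX P (L 1 u).
Proof.
set q := m2 P (cent 1 u); have q0 : 0 <= q by exact: m2_ge0.
have [eta eta0 heta] : exists2 eta : R, 0 < eta &
    forall s, 0 <= s -> s < eta -> (P [set w | (1 < `|L s u w - L 0 u w|)%R] < (4^-1)%:E)%E.
  case: hL => _ _ _ /(_ 1%N (fun=> u)) [_ _ _ _ /(_ 0 1 (lexx 0) ltr01)].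
  have q4 : (0 : R) < 4^-1 by [].
  move=> /fine_cvgP[h1 /cvgrPdist_lt /(_ _ q4) h2].
  move: h1 h2; rewrite !near_withinE => h1 h2.
  case/nbhs_ballP : h1 => e1 /= e10 he1; case/nbhs_ballP : h2 => e2 /= e20 he2.
  exists (Num.min e1 e2); first by rewrite lt_min e10.
  move=> s s0; rewrite lt_min => /andP[se1 se2].
  have fin := he1 s _ s0; have hlt := he2 s _ s0.
  rewrite -!ball_normE /= !sub0r !normrN (ger0_norm s0) in fin hlt.
  have {}fin := fin se1; have {}hlt := hlt se2.
  have -> : [set w | 1 < `|L s u w - L 0 u w|] =
      [set w | 1 < `|(\row_(i < 1) L s u w) - (\row_(i < 1) L 0 u w)|].
    by apply/seteqP; split => w /=; rewrite norm_row1 !mxE.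
  by rewrite -(fineK fin) lte_fin (le_lt_trans (ler_norm _)).
(* At the outcome found below, [L s u w] is bounded by 1 and the centred value by [q + 4], so the
   mean is bounded by [q + 5]. *)
apply: (@additive_bounded_linear R (fun t => EX P (L t u)) (Num.min 1 (eta / 2)) (q + 6)).
- by rewrite lt_min ltr01 divr_gt0.
- by move=> s r s0 r0; exact: meanD.
move=> s s0; rewrite le_min => /andP[s1 se].
have {}se : s < eta by lra.
have lc := cent_L2 u s0.
have mB1 : measurable [set w | 1 < `|L s u w - L 0 u w|].
  apply: measurable_gt; apply: measurableT_comp => //.
  by apply: measurable_funB; exact: levy_measurable.
have PB1 := heta s s0 se.
(* At this level Chebyshev's bound [q / (4 * (q + 1))] is at most one quarter, and the square root
   of the level is at most [q + 4]. *)
have mB2 : measurable [set w | 4 * (q + 1) < cent s u w ^+ 2].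
  by apply: measurable_gt; apply: sqr_measurable; case: lc.
have PB2 : (P [set w | (4 * (q + 1) < cent s u w ^+ 2)%R] <= (4^-1)%:E)%E.
  apply: le_trans (markov_cover (c := q) _ _ _ _) _.
  - by apply: sqr_measurable; case: lc.
  - by move=> w; rewrite sqr_ge0.
  - lra.
  - rewrite -EX_EFin; last exact: L2_sqr.
    by rewrite lee_fin -/(m2 P (cent s u)) var_linear// -/q ler_piMl.
  rewrite lee_fin invfM mulrCA ler_piMr ?invr_ge0//.
  by rewrite ler_pdivrMr ?mul1r; lra.
have [N [mN PN hN]] := levy_start u.
pose B := [set w | 1 < `|L s u w - L 0 u w|] `|` ([set w | 4 * (q + 1) < cent s u w ^+ 2] `|` N).
have mB : measurable B by do 2 apply: measurableU => //.
have PB : (P B < 1)%E.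
  apply: (@le_lt_trans _ _ ((4^-1)%:E + ((4^-1)%:E + 0))%E); last first.
    by rewrite adde0 -EFinD lte_fin; lra.
  rewrite (le_trans (measureU2 _ _ _))//; first exact: measurableU.
  rewrite leeD//; first exact: ltW.
  rewrite (le_trans (measureU2 _ _ _))//.
  by rewrite leeD// [X in (X <= _)%E]PN.
have [w nB] : exists w, ~ B w.
  apply: contrapT => /forallNP h; move: PB.
  have -> : B = setT by apply/seteqP; split => // w _; apply: contrapT; exact: h.
  by rewrite probability_setT ltxx.
have h1 : `|L s u w - L 0 u w| <= 1.
  by rewrite leNgt; apply/negP => h; apply: nB; left.
have h2 : cent s u w ^+ 2 <= 4 * (q + 1).
  by rewrite leNgt; apply/negP => h; apply: nB; right; left.
have h3 : L 0 u w = 0.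
  by apply: contrapT => h; apply: nB; right; right; exact: hN.
rewrite h3 subr0 in h1.
have h4 : `|cent s u w| <= q + 4.
  rewrite -(@ler_pXn2r _ 2)// ?nnegrE ?addr_ge0// real_normK ?num_real//.
  by have := sqr_ge0 q; lra.
have -> : EX P (L s u) = L s u w - cent s u w by rewrite /cent opprB addrC subrK.
by rewrite (le_trans (ler_normB _ _))//; lra.
Qed.

Lemma levy_increment_mean s t u : 0 <= s -> s <= t ->
  EX P (fun w => L t u w - L s u w) = (t - s) * levy_mean u.
Proof. by move=> s0 st; rewrite EX_incr// mean_linear// subr_ge0. Qed.

Lemma levy_increment_var s t u : 0 <= s -> s <= t ->
  m2 P (fun w => L t u w - L s u w - (t - s) * levy_mean u) = (t - s) * levy_var u.
Proof.
by move=> s0 st; rewrite -mean_linear ?subr_ge0// incr_var// var_linear// subr_ge0.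
Qed.

Lemma levy_uncorrelated s1 t1 s2 t2 u v : 0 <= s1 -> s1 <= t1 -> t1 <= s2 -> s2 <= t2 ->
  EX P (fun w => (L t1 u w - L s1 u w - (t1 - s1) * levy_mean u) *
                 (L t2 v w - L s2 v w - (t2 - s2) * levy_mean v)) = 0.
Proof.
move=> s10 st1 ts st2; rewrite -!mean_linear ?subr_ge0//; exact: uncorr.
Qed.

(* Baire: by Fatou the sets [m2 (L 1 u) <= k] are closed, and they cover U. *)
Lemma levy_m2_bound : exists2 C : R, 0 <= C & forall u, m2 P (L 1 u) <= C * `|u| ^+ 2.
Proof.
pose N u := m2 P (L 1 u).
have lL u : L2 P (L 1 u) by exact: levy_L2.
have Lin a u v : {ae P, forall w, L 1 (a *: u + v) w = a * L 1 u w + L 1 v w}.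
  by case: hL => _ /(_ 1 a u v ler01).
have Nlin a u v : N (a *: u + v) <= 2 * a ^+ 2 * N u + 2 * N v.
  rewrite /N (m2_ae _ _ (Lin a u v)); [|exact: levy_measurable|]; last first.
    by case: (L2D (L2Z a (lL u)) (lL v)).
  by rewrite (le_trans (m2D_le (L2Z a (lL u)) (lL v)))// m2Z// mulrA.
have Fc k : closed [set u | N u <= k].
  move=> u cu.
  have hn (n : nat) : exists v, N v <= k /\ `|u - v| < n.+1%:R^-1.
    have e0 : (0 : R) < n.+1%:R^-1 by [].
    have [v [Nv bv]] := cu _ (nbhsx_ballx u _ e0).
    by exists v; split => //; rewrite -ball_normE in bv.
  have [v /all_and2[Nv uv]] := choice hn.
  have cv : v @ \oo --> u.
    apply/cvgrPdist_lt => e e0; near=> n.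
    apply: (lt_trans (uv n)); near: n.
    exact: near_infty_natSinv_lt (PosNum e0).
  have cp : cip P (fun n => L 1 (v n)) (L 1 u).
    apply: cip_of_cvg; [by move=> n; exact: levy_measurable|exact: levy_measurable|].
    by case: hL => _ _ /(_ 1 v u ler01 cv).
  have [] := fatou_cip (C := k) cp (levy_measurable 1 u) (fun n => lL (v n)) => //.
  exact: nearW.
pose O (n : nat) := ~` [set u | N u <= n%:R].
have [n nd] : exists n, ~ dense (O n).
  apply: contrapT => /forallNP h.
  have : dense (\bigcap_i O i).
    apply: Baire => i; split; first by apply: closed_openC; exact: Fc.
    by apply: contrapT; exact: h.
  move=> /(_ setT) []; [by exists point|exact: openT|].
  move=> u [_ /(_ (Num.truncn (N u)).+1 I)]; apply.
  exact/ltW/truncnS_gt.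
have [D [[x /open_nbhs_nbhs /nbhs_ballP [r /= r0 bxr]] DO]] := denseNE nd.
have hball v : ball x r v -> N v <= n%:R.
  move=> /bxr Dv; apply: contrapT => h.
  by have : (D `&` O n) v by []; rewrite DO.
have Nx : N x <= n%:R by apply: hball; exact: ballxx.
have K0 : (0 : R) <= n%:R by [].
(* On the ball of radius [r] around [x] the second moment is at most [n%:R]; removing [x] gives
   [4 * n%:R] on vectors of norm [r / 2], and homogeneity the rest. The last factor 2 is slack. *)
exists (4 * n%:R * (2 / r) ^+ 2 * 2); first by rewrite mulr_ge0// mulr_ge0 ?sqr_ge0// mulr_ge0.
move=> u; rewrite -/(N u).
have lin0 a v : N (a *: v) = a ^+ 2 * N v.
  rewrite -m2Z; last exact: lL.
  apply: m2_ae; [exact: levy_measurable|by case: (L2Z a (lL v))|].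
  apply: filterS2 (Lin a v 0) (Lin 1 0 0) => w.
  by rewrite !addr0 scale1r mul1r => -> ?; lra.
have [->|u0] := eqVneq u 0.
  by rewrite -(scale0r (0 : U)) lin0 expr0n mul0r scale0r normr0 expr0n mulr0.
have up : 0 < `|u| by rewrite normr_gt0.
set c := r / 2 / `|u|; have c0 : 0 < c by rewrite !divr_gt0.
have hy : N (c *: u) <= 4 * n%:R.
  have -> : c *: u = (-1) *: x + (c *: u + x) by rewrite scaleN1r addrCA addNr addr0.
  rewrite (le_trans (Nlin _ _ _))// sqrrN expr1n mulr1.
  have : N (c *: u + x) <= n%:R.
    apply: hball; rewrite -ball_normE /= opprD addrCA subrr addr0 normrN normrZ.
    rewrite gtr0_norm// /c divfK ?gt_eqF//; lra.
  by lra.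
rewrite lin0 mulrC -ler_pdivlMr ?exprn_gt0// in hy.
rewrite (le_trans hy)// /c -exprVn !invfM !invrK.
have -> : 4 * n%:R * (2 / r) ^+ 2 * 2 * `|u| ^+ 2 = (4 * n%:R * (2 / r * `|u|) ^+ 2) * 2 by ring.
have -> : r^-1 * 2 * `|u| = 2 / r * `|u| by ring.
by rewrite ler_peMr ?ler1n// mulr_ge0 ?sqr_ge0// mulr_ge0.
Unshelve. all: by end_near. Qed.

Lemma levy_mean_sqr_bound C u : (forall u, m2 P (L 1 u) <= C * `|u| ^+ 2) ->
  levy_mean u ^+ 2 <= C * `|u| ^+ 2.
Proof. by move=> hC; rewrite (le_trans (jensen (levy_L2 u ler01))). Qed.

Lemma levy_var_bound C u : (forall u, m2 P (L 1 u) <= C * `|u| ^+ 2) ->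
  levy_var u <= C * `|u| ^+ 2.
Proof.
move=> hC; apply: le_trans (hC u).
by rewrite (m2_vari (levy_L2 u ler01)) lerDl sqr_ge0.
Qed.

Lemma levy_var_ge0 u : 0 <= levy_var u. Proof. exact: m2_ge0. Qed.

End Levy.

(** * Time integrals and Hilbert space valued random vectors *)

Section IntervalIntegral.
Context {R : realType}.
Local Notation mu := (@lebesgue_measure R).
Implicit Types (s t : R) (f g y phi : R -> R).

Definition itv_int s t f := mu.-integrable `[s, t] (EFin \o f).

Lemma itv_intD s t f g : itv_int s t f -> itv_int s t g -> itv_int s t (fun r => f r + g r).
Proof. by move=> i1 i2; exact: (integrableD _ i1 i2). Qed.

Lemma itv_intB s t f g : itv_int s t f -> itv_int s t g -> itv_int s t (fun r => f r - g r).
Proof. by move=> i1 i2; exact: (integrableB _ i1 i2). Qed.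

Lemma itv_intZ s t k f : itv_int s t f -> itv_int s t (fun r => k * f r).
Proof. by move=> i1; exact: (integrableZl _ k i1). Qed.

Lemma itv_int_cst s t k : itv_int s t (fun=> k).
Proof. by apply: continuous_itv_integrable => x; exact: cst_continuous. Qed.

Lemma itv_int_dom s t f g : measurable_fun `[s, t] f ->
  (forall r, s <= r <= t -> `|f r| <= g r) -> itv_int s t g -> itv_int s t f.
Proof.
move=> mf fg ig; apply: le_integrable ig => //; first exact/measurable_EFinP.
by move=> r; rewrite /= in_itv /= => rst; rewrite lee_fin (le_trans (fg r rst))// ler_norm.
Qed.

Lemma itv_int_measurable s t f : itv_int s t f -> measurable_fun `[s, t] f.
Proof. by move=> /measurable_int /measurable_EFinP. Qed.

Lemma itv_int_abs s t f : itv_int s t f -> itv_int s t (fun r => `|f r|).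
Proof. by move=> i1; exact: integrable_norm. Qed.

Lemma continuous_itv_bounded phi s t : continuous phi ->
  exists K : R, 0 <= K /\ forall r, s <= r <= t -> `|phi r| <= K.
Proof.
move=> cphi; have [st|ts] := leP s t; last first.
  by exists 0; split => // r /andP[sr rt]; have := le_trans sr rt; rewrite leNgt ts.
have cn : {within `[s, t], continuous (fun r => `|phi r|)}.
  by apply: continuous_subspaceT => x; apply: cvg_norm; exact: cphi.
have [c _ hc] := EVT_max st cn.
by exists `|phi c|; split => // r rst; apply: hc; rewrite in_itv.
Qed.

Lemma itv_intM s t phi f : continuous phi -> itv_int s t f -> itv_int s t (fun r => phi r * f r).
Proof.
move=> cphi i1.
have [K [K0 hK]] := continuous_itv_bounded s t cphi.
apply: (@itv_int_dom _ _ _ (fun r => K * `|f r|)); last by apply: itv_intZ; exact: itv_int_abs.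
  apply: measurable_funM; last exact: itv_int_measurable i1.
  by apply: measurable_funTS; exact: continuous_measurable_fun.
by move=> r rst; rewrite normrM ler_wpM2r// hK.
Qed.

Lemma itv_int_sub s t s' t' f : s <= s' -> t' <= t -> itv_int s t f -> itv_int s' t' f.
Proof.
by move=> ss tt; apply: integrableS => // r /=; rewrite !in_itv /= => /andP[a b];
  rewrite (le_trans ss a) (le_trans b tt).
Qed.

Lemma Rintegral_split s r t f : s <= r -> r <= t -> itv_int s t f ->
  Rintegral mu `[s, t] f = Rintegral mu `[s, r] f + Rintegral mu `[r, t] f.
Proof.
move=> sr rt i1; have := @Rintegral_itvB R f (BLeft s) (BRight t) r i1.
rewrite !bnd_simp => /(_ sr rt) h.
rewrite -(Rintegral_itv_obnd_cbnd (r := r)) -?h ?subrKC//.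
apply: integrableS i1 => // x /=; rewrite !in_itv /= => /andP[a ->].
by rewrite (le_trans sr (ltW a)).
Qed.

Lemma Rintegral_itv_cst s t k : s <= t -> Rintegral mu `[s, t] (fun=> k) = k * (t - s).
Proof.
move=> st; rewrite Rintegral_cst//= lebesgue_measure_itv /= lte_fin.
case: ltP => //= ts.
have -> : t = s by apply/eqP; rewrite eq_le st ts.
by rewrite subrr.
Qed.

Lemma is_derive_continuous phi phi' : (forall x : R, is_derive x 1 phi (phi' x)) ->
  continuous phi.
Proof. by move=> h x; apply/differentiable_continuous/derivable1_diffP; have [] := h x. Qed.

Lemma Rintegral_FTC phi phi' s t : s <= t -> (forall x : R, is_derive x 1 phi (phi' x)) ->
  continuous phi' -> Rintegral mu `[s, t] phi' = phi t - phi s.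
Proof.
move=> + dphi cphi; rewrite le_eqVlt => /predU1P[->|st].
  by rewrite set_itv1 Rintegral_set1 subrr.
have dc : {in `[s, t], forall x, derivable phi x 1} by move=> x _; have [] := dphi x.
have cc := is_derive_continuous dphi.
rewrite /Rintegral (@continuous_FTC2 _ phi' phi)//.
- exact: continuous_subspaceT.
- split; first by move=> x _; have [] := dphi x.
  + by apply: cvg_at_right_filter; exact: cc.
  + by apply: cvg_at_left_filter; exact: cc.
- by move=> x _; rewrite derive1E; have [_ ->] := dphi x.
Qed.

(** [y] need not be a primitive of [f]: the discrepancy [y t - y s] minus the integral of [f] will
    be an increment of [L]. The left side is the integral of [phi' r * (y t - y r) + (phi s - phi r)
    * f r], so only the oscillation of [y] and the mass of [f] enter. *)
Lemma parts_error s t K phi phi' y f : s <= t -> (forall x : R, is_derive x 1 phi (phi' x)) ->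
  continuous phi' -> (forall r, s <= r <= t -> `|phi' r| <= K) ->
  itv_int s t y -> itv_int s t f ->
  `|phi t * y t - phi s * y s - Rintegral mu `[s, t] (fun r => phi' r * y r + phi r * f r)
     - phi s * (y t - y s - Rintegral mu `[s, t] f)| <=
  K * Rintegral mu `[s, t] (fun r => `|y t - y r|) +
  K * (t - s) * Rintegral mu `[s, t] (fun r => `|f r|).
Proof.
move=> st dphi cphi' hK iy iff.
have cphi := is_derive_continuous dphi.
have i1 := itv_intM cphi' iy; have i2 := itv_intM cphi iff.
have ip' : itv_int s t phi' by exact: continuous_itv_integrable.
have i3 : itv_int s t (fun r => phi' r * (y t - y r)).
  by apply: itv_intM => //; apply: itv_intB => //; exact: itv_int_cst.
have i4 : itv_int s t (fun r => (phi s - phi r) * f r).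
  apply: (@itv_intM _ _ (fun r => phi s - phi r)) => // x.
  by apply: continuousB; [exact: cst_continuous|exact: cphi].
have -> : phi t * y t - phi s * y s - Rintegral mu `[s, t] (fun r => phi' r * y r + phi r * f r)
     - phi s * (y t - y s - Rintegral mu `[s, t] f) =
   Rintegral mu `[s, t] (fun r => phi' r * (y t - y r) + (phi s - phi r) * f r).
  rewrite (RintegralD _ i1 i2)// (RintegralD _ i3 i4)//.
  have -> : Rintegral mu `[s, t] (fun r => phi' r * (y t - y r)) =
      y t * (phi t - phi s) - Rintegral mu `[s, t] (fun r => phi' r * y r).
    rewrite -(Rintegral_FTC st dphi cphi') -(RintegralZl _ _ ip')// -(RintegralB _ (itv_intZ (y t) ip') i1)//.
    by apply: eq_Rintegral => r _; ring.
  have -> : Rintegral mu `[s, t] (fun r => (phi s - phi r) * f r) =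
      phi s * Rintegral mu `[s, t] f - Rintegral mu `[s, t] (fun r => phi r * f r).
    rewrite -(RintegralZl _ _ iff)// -(RintegralB _ (itv_intZ (phi s) iff) i2)//.
    by apply: eq_Rintegral => r _; ring.
  by ring.
have i34 := itv_intD i3 i4.
apply: (le_trans (le_normr_Rintegral _ i34)) => //.
have i5 : itv_int s t (fun r => `|y t - y r|).
  by apply: itv_int_abs; apply: itv_intB => //; exact: itv_int_cst.
have i6 := itv_int_abs iff.
rewrite -(RintegralZl _ _ i5)// -(RintegralZl _ _ i6)//.
have i7 := itv_intZ K i5; have i8 := itv_intZ (K * (t - s)) i6.
rewrite -(RintegralD _ i7 i8)//; apply: le_Rintegral => //.
- exact: itv_int_abs.
- exact: itv_intD.
move=> r; rewrite /= in_itv /= => /andP[sr rt].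
have K0 : 0 <= K by apply: le_trans (hK s _); rewrite ?lexx.
rewrite (le_trans (ler_normD _ _))// !normrM lerD//.
  by rewrite ler_wpM2r// hK// sr.
rewrite ler_wpM2r//.
have hd x : x \in `]s, r[ -> is_derive x 1 phi (phi' x) by move=> _; exact: dphi.
have [c cab E] := MVT_segment sr hd (continuous_subspaceT cphi).
rewrite distrC E normrM (ger0_norm (_ : 0 <= r - s)) ?subr_ge0//.
move: cab; rewrite in_itv /= => /andP[sc cr].
by rewrite ler_pM// ?subr_ge0// ?lerD2r// hK// sc (le_trans cr).
Qed.

(** Splits the oscillation into a part [G], to be taken as the drift, and an excess whose mean can
    be controlled. *)
Lemma truncated_error s t y (G : R) : s <= t -> itv_int s t y ->
  Rintegral mu `[s, t] (fun r => `|y t - y r|) <=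
  Rintegral mu `[s, t] (fun r => Num.max (`|y t - y r| - G) 0) + (t - s) * G /\
  itv_int s t (fun r => Num.max (`|y t - y r| - G) 0).
Proof.
move=> st iy.
have i5 : itv_int s t (fun r => `|y t - y r|).
  by apply: itv_int_abs; apply: itv_intB => //; exact: itv_int_cst.
have i6 : itv_int s t (fun r => `|y t - y r| - G) by apply: itv_intB => //; exact: itv_int_cst.
have i7 : itv_int s t (fun r => Num.max (`|y t - y r| - G) 0).
  apply: (@itv_int_dom _ _ _ (fun r => `| `|y t - y r| - G |)); last exact: itv_int_abs.
    by apply: measurable_maxr => //; exact: itv_int_measurable i6.
  by move=> r _; have [h|h] := leP (`|y t - y r| - G) 0; rewrite ?normr0 ?normr_ge0 ?lexx.
split => //.
rewrite mulrC -(Rintegral_itv_cst G st) -(RintegralD _ i7 (itv_int_cst s t G))//.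
apply: le_Rintegral => //; first by apply: itv_intD => //; exact: itv_int_cst.
by move=> r _; rewrite -lerBlDr le_max lexx.
Qed.

End IntervalIntegral.

(** * Square integrable random vectors *)

Section RandomVectors.
Context {R : realType} {d : measure_display} {Omega : measurableType d}.
Variable P : probability Omega R.

Lemma EX_dominated (X : nat -> Omega -> R) (X0 G : Omega -> R) :
  (forall n, measurable_fun setT (X n)) -> Int P G ->
  (forall w, (fun n => X n w) @ \oo --> X0 w) -> (forall n w, `|X n w| <= G w) ->
  (fun n => EX P (X n)) @ \oo --> EX P X0.
Proof.
move=> mX iG cX hG.
have mX0 : measurable_fun setT X0.
  by apply: (@measurable_fun_cvg _ _ _ setT X) => // w _; exact: cX.
have [] := @dominated_convergence _ _ _ P setT measurableT (fun n w => (X n w)%:E)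
    (fun w => (X0 w)%:E) (fun w => (G w)%:E).
- by move=> n; exact: measurable_EFin_fun.
- exact: measurable_EFin_fun.
- by apply: aeW => w _; apply: cvg_EFin; [exact: nearW|exact: cX].
- exact: iG.
- by apply: aeW => w n _; rewrite lee_fin.
move=> i0 _; rewrite -[X in _ --> X -> _](fineK (integrable_fin_num _ i0))//.
by move=> /fine_cvg.
Qed.

Context {V : completeNormedModType R} (ip : V -> V -> R).
Hypothesis hV : separable_hilbert ip.
Implicit Types (Z : Omega -> V) (v : V).

(** Measurability is weak, through scalar products; [sqr_norm_measurable] recovers that of the norm
    as a limit of Parseval sums. *)
Definition rv2 Z := (forall v, measurable_fun setT (fun x => ip (Z x) v)) /\
  (\int[P]_x (`|Z x| ^+ 2)%:E < +oo)%E.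

Definition E2 Z := EX P (fun x => `|Z x| ^+ 2).

Lemma sqr_norm_measurable Z : (forall v, measurable_fun setT (fun x => ip (Z x) v)) ->
  measurable_fun setT (fun x => `|Z x| ^+ 2).
Proof.
move=> mZ; have [e [e1 _ _]] := exists_parseval_basis hV.
apply: (@measurable_fun_cvg _ _ _ setT (fun n x => \sum_(i < n) ip (Z x) (e i) ^+ 2)) => //.
by move=> n; apply: measurable_sum => i; exact: sqr_measurable.
Qed.

Lemma rv2_Int Z : rv2 Z -> Int P (fun x => `|Z x| ^+ 2).
Proof.
move=> [mZ iZ]; apply/integrableP; split.
  by apply/measurable_EFinP; exact: sqr_norm_measurable.
by under eq_integral do rewrite /= ger0_norm ?sqr_ge0//.
Qed.

Lemma rv2P Z : (forall v, measurable_fun setT (fun x => ip (Z x) v)) ->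
  Int P (fun x => `|Z x| ^+ 2) -> rv2 Z.
Proof.
move=> mZ /integrableP[_ iZ]; split => //.
by move: iZ; under eq_integral do rewrite /= ger0_norm ?sqr_ge0//.
Qed.

Lemma ip_sqr_le x v : ip x v ^+ 2 <= `|v| ^+ 2 * `|x| ^+ 2.
Proof.
by rewrite -exprMn mulrC -[X in X <= _]real_normK ?num_real// lerXn2r ?nnegrE ?mulr_ge0// ip_CS.
Qed.

Lemma rv2_ip Z v : rv2 Z -> L2 P (fun x => ip (Z x) v).
Proof.
move=> rZ; apply: (@L2_dom _ _ _ _ _ (fun x => `|v| ^+ 2 * `|Z x| ^+ 2)).
- by case: rZ.
- by apply: IntZ; exact: rv2_Int.
- by move=> x; exact: ip_sqr_le.
Qed.

Lemma sqr_normD_le (x y : V) : `|x + y| ^+ 2 <= 2 * `|x| ^+ 2 + 2 * `|y| ^+ 2.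
Proof.
rewrite (@le_trans _ _ ((`|x| + `|y|) ^+ 2))//.
  by rewrite lerXn2r ?nnegrE ?addr_ge0// ler_normD.
by have := sqr_ge0 (`|x| - `|y|); nra.
Qed.

Lemma rv2D Z1 Z2 : rv2 Z1 -> rv2 Z2 -> rv2 (fun x => Z1 x + Z2 x).
Proof.
move=> r1 r2; have m v : measurable_fun setT (fun x => ip (Z1 x + Z2 x) v).
  under eq_fun do rewrite (ipDl hV).
  by apply: measurable_funD; [case: r1|case: r2].
apply: rv2P => //; apply: (@Int_dom _ _ _ _ _ (fun x => 2 * `|Z1 x| ^+ 2 + 2 * `|Z2 x| ^+ 2)).
- exact: sqr_norm_measurable.
- by apply: IntD; apply: IntZ; exact: rv2_Int.
- by move=> x; rewrite ger0_norm ?sqr_ge0// sqr_normD_le.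
Qed.

Lemma E2_ge0 Z : 0 <= E2 Z. Proof. by apply: EX_ge0 => x; rewrite sqr_ge0. Qed.

Lemma E2D_le Z1 Z2 : rv2 Z1 -> rv2 Z2 -> E2 (fun x => Z1 x + Z2 x) <= 2 * E2 Z1 + 2 * E2 Z2.
Proof.
move=> r1 r2; have i1 := rv2_Int r1; have i2 := rv2_Int r2.
rewrite -(EXZ _ i1) -(EXZ _ i2) -EXD; [|exact: IntZ|exact: IntZ].
apply: EX_le; [exact: rv2_Int (rv2D r1 r2)|by apply: IntD; exact: IntZ|].
by move=> x; exact: sqr_normD_le.
Qed.

Lemma rv2_map (K Ks : V -> V) (c : R) Z : (forall x y, ip (K x) y = ip x (Ks y)) ->
  (forall x, `|K x| <= c * `|x|) -> rv2 Z -> rv2 (fun x => K (Z x)).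
Proof.
move=> hK hc r; have m v : measurable_fun setT (fun x => ip (K (Z x)) v).
  by under eq_fun do rewrite hK; case: r => + _; apply.
apply: rv2P => //; apply: (@Int_dom _ _ _ _ _ (fun x => c ^+ 2 * `|Z x| ^+ 2)).
- exact: sqr_norm_measurable.
- by apply: IntZ; exact: rv2_Int.
- move=> x; rewrite ger0_norm ?sqr_ge0// -exprMn lerXn2r ?nnegrE//.
  exact: le_trans (hc _).
Qed.

Lemma E2_le_map c Z1 Z2 : rv2 Z1 -> rv2 Z2 -> (forall x, `|Z1 x| <= c * `|Z2 x|) ->
  E2 Z1 <= c ^+ 2 * E2 Z2.
Proof.
move=> r1 r2 h; rewrite -EXZ; last exact: rv2_Int.
apply: EX_le; [exact: rv2_Int|by apply: IntZ; exact: rv2_Int|].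
by move=> x; rewrite -exprMn lerXn2r ?nnegrE//; exact: le_trans (h _).
Qed.

Lemma parseval_partial_le (e : nat -> V) x n :
  (forall x, (fun n => \sum_(i < n) ip x (e i) ^+ 2) @ \oo --> `|x| ^+ 2) ->
  \sum_(i < n) ip x (e i) ^+ 2 <= `|x| ^+ 2.
Proof.
move=> he; have nd : nondecreasing_seq (fun n => \sum_(i < n) ip x (e i) ^+ 2).
  by apply/nondecreasing_seqP => k; rewrite big_ord_recr/= lerDl sqr_ge0.
by rewrite -(cvg_lim (@Rhausdorff R) (he x)); apply: (nondecreasing_cvgn_le nd (cvgP _ (he x))).
Qed.

Lemma m2_sum_le_E2 (e : nat -> V) Z n :
  (forall x, (fun n => \sum_(i < n) ip x (e i) ^+ 2) @ \oo --> `|x| ^+ 2) -> rv2 Z ->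
  \sum_(i < n) m2 P (fun x => ip (Z x) (e i)) <= E2 Z.
Proof.
move=> he r; rewrite -EX_sum; last by move=> i; apply: L2_sqr; exact: rv2_ip.
apply: EX_le; [by apply: Int_sum => i; apply: L2_sqr; exact: rv2_ip|exact: rv2_Int|].
by move=> x; exact: parseval_partial_le.
Qed.

Lemma E2_parseval (e : nat -> V) Z :
  (forall x, (fun n => \sum_(i < n) ip x (e i) ^+ 2) @ \oo --> `|x| ^+ 2) -> rv2 Z ->
  (fun n => \sum_(i < n) m2 P (fun x => ip (Z x) (e i))) @ \oo --> E2 Z.
Proof.
move=> he r.
have -> : (fun n => \sum_(i < n) m2 P (fun x => ip (Z x) (e i))) =
  (fun n => EX P (fun x => \sum_(i < n) ip (Z x) (e i) ^+ 2)).
  by apply/funext => n; rewrite EX_sum// => i; apply: L2_sqr; exact: rv2_ip.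
apply: (@EX_dominated _ _ (fun x => `|Z x| ^+ 2)).
- by move=> n; apply: measurable_sum => i; apply: sqr_measurable; case: r => + _; apply.
- exact: rv2_Int.
- by move=> x; exact: he.
- move=> n x; rewrite ger0_norm; last by apply: sumr_ge0 => i _; exact: sqr_ge0.
  exact: parseval_partial_le.
Qed.

Lemma E2_le_of_sums (e : nat -> V) Z (M : R) :
  (forall x, (fun n => \sum_(i < n) ip x (e i) ^+ 2) @ \oo --> `|x| ^+ 2) -> rv2 Z ->
  (forall n, \sum_(i < n) m2 P (fun x => ip (Z x) (e i)) <= M) -> E2 Z <= M.
Proof.
move=> he r h; have cv := E2_parseval he r.
rewrite -(cvg_lim (@Rhausdorff R) cv).
by apply: limr_le; [exact: cvgP cv|exact: nearW].
Qed.

(** Weak convergence of a bounded sequence is enough, since the squared scalar products are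
    dominated by [c ^+ 2] times the squared norm of [Z]. *)
Lemma weak_cvg_moments (vs : nat -> V) v0 (c : R) Z : rv2 Z ->
  (forall x, (fun n => ip x (vs n)) @ \oo --> ip x v0) -> (forall n, `|vs n| <= c) ->
  (fun n => m2 P (fun x => ip (Z x) (vs n))) @ \oo --> m2 P (fun x => ip (Z x) v0) /\
  (fun n => EX P (fun x => ip (Z x) (vs n))) @ \oo --> EX P (fun x => ip (Z x) v0).
Proof.
move=> r cv hc; have c0 : 0 <= c by exact: le_trans (normr_ge0 _) (hc 0%N).
have h n x : ip (Z x) (vs n) ^+ 2 <= c ^+ 2 * `|Z x| ^+ 2.
  by rewrite (le_trans (ip_sqr_le _ _))// ler_wpM2r ?sqr_ge0// lerXn2r ?nnegrE.
have iG : Int P (fun x => c ^+ 2 * `|Z x| ^+ 2) by apply: IntZ; exact: rv2_Int.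
split.
  apply: (@EX_dominated _ _ (fun x => c ^+ 2 * `|Z x| ^+ 2)) => //.
  - by move=> n; apply: sqr_measurable; case: r => + _; apply.
  - by move=> x; rewrite expr2; under eq_fun do rewrite expr2; apply: cvgM; exact: cv.
  - by move=> n x; rewrite ger0_norm ?sqr_ge0.
apply: (@EX_dominated _ _ (fun x => 1 + c ^+ 2 * `|Z x| ^+ 2)) => //.
- by move=> n; case: r => + _; apply.
- by apply: IntD => //; exact: Int_cst.
- move=> n x; have := h n x; rewrite -(real_normK (num_real (ip (Z x) (vs n)))).
  by have := normr_ge0 (ip (Z x) (vs n)); nra.
Qed.

End RandomVectors.

(** * Moments of weighted sums of Lévy increments *)

Section LevySums.
Context {R : realType} {d : measure_display} {Omega : measurableType d}.
Variable P : probability Omega R.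
Context {U : completeNormedModType R}.
Variable L : R -> U -> Omega -> R.
Hypothesis hL : cylindrical_levy P L.
Hypothesis hL2 : forall u : U, (\int[P]_w ((L 1 u w) ^+ 2)%:E < +oo)%E.
Implicit Types (n : nat -> R) (u : nat -> U).
Local Notation mean := (levy_mean P L).
Local Notation var := (levy_var P L).

Definition grid n := (forall j, 0 <= n j) /\ (forall j, n j <= n j.+1).

(** The integral against [L] of the deterministic step function with value [u j] on the [j]-th
    interval. *)
Definition lsum N n u x := \sum_(j < N) (L (n j.+1) (u j) x - L (n j) (u j) x).

Let inc_L2 n u j : grid n -> L2 P (fun x => L (n j.+1) (u j) x - L (n j) (u j) x).
Proof. by move=> [n0 _]; apply: (levy_increment_L2 hL hL2). Qed.

Lemma lsum_L2 N n u : grid n -> L2 P (lsum N n u).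
Proof. by move=> gn; apply: L2_sum => j; exact: inc_L2. Qed.

Lemma lsum_EX N n u : grid n ->
  EX P (lsum N n u) = \sum_(j < N) (n j.+1 - n j) * mean (u j).
Proof.
move=> gn; rewrite EX_sum; last by move=> j; apply: L2_Int; exact: inc_L2.
by case: gn => n0 n1; apply: eq_bigr => j _; rewrite (levy_increment_mean hL hL2).
Qed.

Let cinc n u j x := L (n j.+1) (u j) x - L (n j) (u j) x - (n j.+1 - n j) * mean (u j).

Let cinc_L2 n u j : grid n -> L2 P (cinc n u j).
Proof. by move=> gn; apply: L2B; [exact: inc_L2|exact: L2_cst]. Qed.

Let lsum_centered N n u : grid n ->
  (fun x => lsum N n u x - EX P (lsum N n u)) = fun x => \sum_(j < N) cinc n u j x.
Proof. by move=> gn; apply/funext => x; rewrite lsum_EX// -sumrB. Qed.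

Let cinc_uncorrelated n u n' u' i j : grid n -> grid n' -> n i.+1 <= n' j ->
  EX P (fun x => cinc n u i x * cinc n' u' j x) = 0.
Proof. by move=> [n0 n1] [n0' n1'] h; exact: (levy_uncorrelated hL hL2). Qed.

Lemma grid_le n i j : grid n -> (i <= j)%N -> n i <= n j.
Proof. by move=> [_ n1]; move=> ij; have /nondecreasing_seqP h := n1; exact: h. Qed.

(** Centred increments over successive intervals are orthogonal even when tested with different
    vectors, so the variances add up. *)
Lemma lsum_vari N n u : grid n ->
  vari P (lsum N n u) = \sum_(j < N) (n j.+1 - n j) * var (u j).
Proof.
move=> gn; rewrite /vari lsum_centered//; elim: N => [|N ih].
  rewrite big_ord0 (_ : (fun x => _) = fun=> 0); last by apply/funext => x; rewrite big_ord0.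
  by rewrite /m2 expr0n EX_cst.
under eq_fun do rewrite big_ord_recr/=.
rewrite m2D; [|by apply: L2_sum => j; exact: cinc_L2|exact: cinc_L2].
rewrite ih big_ord_recr/=.
rewrite [X in 2 * X](_ : _ = 0); last first.
  under eq_fun do rewrite mulr_suml.
  rewrite EX_sum; last by move=> j; apply: L2_mul; exact: cinc_L2.
  by rewrite big1// => j _; rewrite cinc_uncorrelated//; exact: grid_le.
rewrite mulr0 addr0; congr (_ + _).
by case: gn => n0 n1; rewrite (levy_increment_var hL hL2).
Qed.

Lemma lsumD_vari N n u N' n' u' : grid n -> grid n' -> n N <= n' 0%N ->
  vari P (fun x => lsum N n u x + lsum N' n' u' x) =
  vari P (lsum N n u) + vari P (lsum N' n' u').
Proof.
move=> gn gn' h; have l1 := lsum_L2 N u gn; have l2 := lsum_L2 N' u' gn'.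
rewrite {1}/vari EXD; [|exact: L2_Int|exact: L2_Int].
rewrite (_ : (fun x => _) = fun x => (lsum N n u x - EX P (lsum N n u)) +
   (lsum N' n' u' x - EX P (lsum N' n' u'))); last first.
  by apply/funext => x; rewrite opprD addrACA.
rewrite m2D; [|by apply: L2B => //; exact: L2_cst|by apply: L2B => //; exact: L2_cst].
rewrite [X in 2 * X](_ : _ = 0) ?mulr0 ?addr0//.
transitivity (EX P (fun x => \sum_(i < N) \sum_(j < N') cinc n u i x * cinc n' u' j x)).
  congr EX; apply/funext => x; rewrite (congr1 (@^~ x) (lsum_centered N u gn)).
  rewrite (congr1 (@^~ x) (lsum_centered N' u' gn')) mulr_suml.
  by apply: eq_bigr => i _; rewrite mulr_sumr.
rewrite EX_sum; last first.
  by move=> i; apply: Int_sum => j; apply: L2_mul; exact: cinc_L2.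
rewrite big1// => i _; rewrite EX_sum; last by move=> j; apply: L2_mul; exact: cinc_L2.
rewrite big1// => j _; apply: cinc_uncorrelated => //.
by rewrite (le_trans (grid_le gn (ltn_ord i)))// (le_trans h)// grid_le.
Qed.

Variable C : R.
Hypotheses (C0 : 0 <= C) (hC : forall v : U, m2 P (L 1 v) <= C * `|v| ^+ 2).

Let grid_sum N n : \sum_(j < N) (n j.+1 - n j) = n N - n 0%N.
Proof.
by rewrite -(big_mkord xpredT (fun j => n j.+1 - n j)) telescope_sumr.
Qed.

Lemma lsum_EX_le N n u r : grid n -> (forall j, (j < N)%N -> `|u j| <= r) -> 0 <= r ->
  `|EX P (lsum N n u)| <= (n N - n 0%N) * (Num.sqrt C * r).
Proof.
move=> gn ur r0; rewrite lsum_EX// (le_trans (ler_norm_sum _ _ _))//.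
rewrite -grid_sum mulr_suml; apply: ler_sum => j _; have [_ n1] := gn.
rewrite normrM ger0_norm ?subr_ge0// ler_wpM2l ?subr_ge0//.
rewrite -(@ler_pXn2r _ 2)// ?nnegrE ?mulr_ge0 ?sqrtr_ge0//.
rewrite real_normK ?num_real// exprMn sqr_sqrtr// (le_trans (levy_mean_sqr_bound hL hL2 _ hC))//.
by rewrite ler_wpM2l// lerXn2r ?nnegrE// ur.
Qed.

Lemma lsum_vari_le N n u r : grid n -> (forall j, (j < N)%N -> `|u j| <= r) -> 0 <= r ->
  vari P (lsum N n u) <= (n N - n 0%N) * (C * r ^+ 2).
Proof.
move=> gn ur r0; rewrite lsum_vari// -grid_sum mulr_suml; apply: ler_sum => j _.
have [_ n1] := gn; rewrite ler_wpM2l ?subr_ge0// (le_trans (levy_var_bound hL hL2 _ hC))//.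
by rewrite ler_wpM2l// lerXn2r ?nnegrE// ur.
Qed.

Lemma lsum_m2_le N n u r : grid n -> (forall j, (j < N)%N -> `|u j| <= r) -> 0 <= r ->
  m2 P (lsum N n u) <= (n N - n 0%N) * ((1 + (n N - n 0%N)) * C * r ^+ 2).
Proof.
move=> gn ur r0; have h0 : 0 <= n N - n 0%N by rewrite subr_ge0 grid_le.
rewrite m2_vari; last exact: lsum_L2.
have h1 := lsum_vari_le gn ur r0; have h2 := lsum_EX_le gn ur r0.
have h3 : EX P (lsum N n u) ^+ 2 <= (n N - n 0%N) ^+ 2 * (C * r ^+ 2).
  rewrite -[X in _ * (X * _)](sqr_sqrtr C0) -!exprMn.
  rewrite -[leLHS]real_normK ?num_real// lerXn2r ?nnegrE//.
  by rewrite mulr_ge0// mulr_ge0// sqrtr_ge0.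
by apply: le_trans (lerD h1 h3) _; rewrite le_eqVlt; apply/orP; left; apply/eqP; ring.
Qed.

End LevySums.

Lemma cip_of_ae_cvg (R : realType) (d : measure_display) (Omega : measurableType d)
  (P : probability Omega R) (Z : nat -> Omega -> R) :
  (forall n, measurable_fun setT (Z n)) ->
  {ae P, forall w, (fun n => Z n w) @ \oo --> 0} -> cip P Z (fun=> 0).
Proof.
move=> mZ hZ.
pose D n w := Num.min `|Z n w| 1.
have mD n : measurable_fun setT (D n).
  by apply: measurable_minr => //; exact: measurableT_comp.
have D0 n w : 0 <= D n w by rewrite le_min normr_ge0 ler01.
have D1 n w : D n w <= 1 by rewrite ge_min lexx orbT.
have [] := @dominated_convergence _ _ _ P setT measurableT (fun n w => (D n w)%:E)
    (fun=> 0%E) (fun=> 1%E).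
- by move=> n; exact: measurable_EFin_fun.
- exact: measurable_cst.
- apply: filterS hZ => w hw _; apply: cvg_EFin; first exact: nearW.
  have : (fun n => `|Z n w|) @ \oo --> 0 by rewrite -(normr0 R); exact: cvg_norm.
  move/cvgrPdist_lt => h; apply/cvgrPdist_lt => e e0; apply: filterS (h e e0) => n.
  rewrite /= !sub0r !normrN normr_id => hn; rewrite ger0_norm//.
  by rewrite (le_lt_trans _ hn)// ge_min lexx.
- exact: (Int_cst P 1).
- by apply: aeW => w n _; rewrite lee_fin ger0_norm.
move=> _ _; rewrite integral0 => cv.
have {cv} cv : (fun n => EX P (D n)) @ \oo --> 0.
  by move/fine_cvgP : cv => [_].
have cD : cip P D (fun=> 0).
  apply: (cip_L1 mD D0 _ cv) => n; rewrite -EX_EFin//.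
  by apply: Int_dom (Int_cst P 1) _ => // w; rewrite ger0_norm.
move=> e eta e0 eta0.
(* Below one half the minimum defining [D] is not attained at its cap 1, so smallness of [D] is
   smallness of [Z]. *)
pose e' := Num.min e 2^-1.
have e'0 : 0 < e' by rewrite lt_min e0 invr_gt0 ltr0n.
have e'1 : e' <= 2^-1 by rewrite ge_min lexx orbT.
apply: filterS (cD e' eta e'0 eta0) => n [B [mB PB hB]]; exists B; split => // w /hB.
rewrite !subr0 ger0_norm// /D ge_min => /orP[h|h].
  by rewrite (le_trans h)// ge_min lexx.
by exfalso; move: (le_trans h e'1); lra.
Qed.

Lemma cip_of_diff (R : realType) (d : measure_display) (Omega : measurableType d)
  (P : probability Omega R) (Z : nat -> Omega -> R) (Z0 : Omega -> R) :
  cip P (fun n w => Z n w - Z0 w) (fun=> 0) -> cip P Z Z0.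
Proof. by apply: cip_dom => n; apply: aeW => w; rewrite subr0. Qed.

Lemma ae_forall_nat (R : realType) (d : measure_display) (Omega : measurableType d)
  (P : probability Omega R) (Q : nat -> Omega -> Prop) :
  (forall j, {ae P, forall w, Q j w}) -> {ae P, forall w, forall j, Q j w}.
Proof.
move=> h; apply: negligibleS (negligible_bigcup h) => w /= /existsNP[j hj].
by exists j.
Qed.

(** * Weak solutions *)

Section Solution.
Context {R : realType} {d : measure_display} {Omega : measurableType d}.
Variable P : probability Omega R.
Context {V : completeNormedModType R} (ip : V -> V -> R).
Hypothesis hV : separable_hilbert ip.
Variables (T : R) (F : R -> set (set Omega)) (Y : R -> Omega -> V).
Hypothesis T0 : 0 < T.
Hypothesis hF : filtration F.
Hypothesis hprog : prog_measurable F T Y.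
Local Notation mu := (@lebesgue_measure R).
Hypothesis hint : forall g, {within `[0, T], continuous g} ->
  {ae P, forall w, mu.-integrable `[0, T] (fun s => (ip (Y s w) (g s))%:E)}.
Hypothesis hsmall : forall g : nat -> R -> V,
  (forall k, {within `[0, T], continuous g k}) ->
  (forall e : R, 0 < e -> \forall k \near \oo, forall s, 0 <= s <= T -> `|g k s| <= e) ->
  cvg_in_prob P (fun k w => Rintegral mu `[0, T] (fun s => ip (Y s w) (g k s))) (fun _ => 0).

(** * Measurability and smallness of time integrals of the solution *)

Section TimeIntegrals.
Implicit Types (s t a b : R) (g h : R -> V).

(** Set to zero outside [0, T], where [hprog] gives no information; joint measurability then makes
    sense on the whole product space. *)
Definition Yp g s w := if (0 <= s <= T) then ip (Y s w) (g s) else 0.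

Lemma YpE g s w : 0 <= s <= T -> Yp g s w = ip (Y s w) (g s).
Proof. by rewrite /Yp => ->. Qed.

(** Progressive measurability at the final time [T] gives joint measurability, as all sets of [F T]
    are measurable. *)
Lemma Yp_cst_measurable v : measurable_fun [set: R * Omega] (fun p => Yp (fun=> v) p.1 p.2).
Proof.
pose D : set (R * Omega) := [set p | 0 <= p.1 <= T].
have mD : measurable D.
  have -> : D = `[0, T]%classic `*` [set: Omega].
    by apply/seteqP; split => -[s w] /=; rewrite in_itv //= => -[].
  exact: measurableX.
have hB (Bo : set V) : borel Bo -> measurable (D `&` [set p | Bo (Y p.1 p.2)]).
  move=> bBo; have [_ hFm _] := hF.
  have := hprog (_ : 0 <= T <= T) bBo; rewrite lexx ltW// => /(_ isT).
  apply: smallest_sub => //; first exact: sigma_algebra_measurable.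
  move=> _ [I [mI _] [E FE <-]]; apply: measurableX => //; exact: hFm FE.
move=> _ A mA; rewrite setTI.
have bA := @borel_preimage R V (ip^~ v) A (@ip_continuous _ _ _ hV v) mA.
have -> : (fun p : R * Omega => Yp (fun=> v) p.1 p.2) @^-1` A =
    (D `&` [set p | (ip^~ v @^-1` A) (Y p.1 p.2)]) `|` (~` D `&` [set p | A 0]).
  apply/seteqP; split => -[s w] /=; rewrite /Yp /D /=.
    by case: ifPn => sT h; [left|right; split => //; apply/negP].
  by move=> [[-> //]|[/negP/negbTE -> //]].
apply: measurableU; first exact: hB.
apply: measurableI; first exact: measurableC.
by have [A0|A0] := pselect (A 0); [rewrite (_ : [set p | A 0] = setT)//|
  rewrite (_ : [set p | A 0] = set0)//]; apply/seteqP; split.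
Qed.

(** Expansion along a Parseval family reduces a time dependent [g] to constant vectors with
    continuous scalar coefficients. *)
Lemma Yp_measurable g : continuous g -> measurable_fun [set: R * Omega] (fun p => Yp g p.1 p.2).
Proof.
move=> cg; have [e [_ e2 _]] := exists_parseval_basis hV.
pose G n (p : R * Omega) := \sum_(i < n) Yp (fun=> e i) p.1 p.2 * ip (g p.1) (e i).
apply: (@measurable_fun_cvg _ _ _ setT G) => //.
  move=> n; apply: measurable_sum => i; apply: measurable_funM; first exact: Yp_cst_measurable.
  apply: (@measurableT_comp _ _ _ _ _ _ (fun s => ip (g s) (e i)) _ fst) => //.
  apply: continuous_measurable_fun => s; apply: (cvg_ipl hV); exact: cg.
move=> [s w] _; rewrite /G /Yp /=; case: ifPn => sT.
  have : (fun n => ip (\sum_(i < n) ip (Y s w) (e i) *: e i) (g s)) @ \oo --> ip (Y s w) (g s).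
    by apply: (cvg_ipl hV); exact: e2.
  have -> : (fun n => ip (\sum_(i < n) ip (Y s w) (e i) *: e i) (g s)) =
     (fun n => \sum_(i < n) ip (Y s w) (e i) * ip (g s) (e i)); last exact.
  apply/funext => n; rewrite (ip_suml hV); apply: eq_bigr => i _.
  by rewrite (ipZl hV) (ipC hV (g s)).
rewrite (_ : (fun n => _) = fun=> 0); first exact: cvg_cst.
by apply/funext => n; rewrite big1// => i _; rewrite mul0r.
Qed.

Lemma Yip_measurable s v : 0 <= s <= T -> measurable_fun setT (fun w => ip (Y s w) v).
Proof.
move=> sT; have := measurable_fun_pair2 s (Yp_cst_measurable v).
by rewrite /=; under eq_fun do rewrite YpE//.
Qed.

Lemma Yp_section g s : continuous g -> measurable_fun setT (Yp g s).
Proof. by move=> cg; exact: (measurable_fun_pair2 s (Yp_measurable cg)). Qed.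

Lemma tonelli_measurable a b (H : R -> Omega -> R) :
  measurable_fun [set: R * Omega] (fun p => H p.1 p.2) ->
  (forall s w, 0 <= H s w) ->
  measurable_fun setT (fun w => \int[mu]_(s in `[a, b]) (H s w)%:E)%E /\
  (\int[P]_w \int[mu]_(s in `[a, b]) (H s w)%:E =
   \int[mu]_(s in `[a, b]) \int[P]_w (H s w)%:E)%E.
Proof.
move=> mH H0.
pose h (p : R * Omega) := ((H p.1 p.2)%:E * (\1_(`[a, b]%classic : set R) p.1)%:E)%E.
have mh : measurable_fun setT h.
  apply: emeasurable_funM; first exact/measurable_EFinP.
  apply/measurable_EFinP.
  by apply: (@measurableT_comp _ _ _ _ _ _ (\1_(`[a, b]%classic) : R -> R) _ fst).
have h0 p : (0 <= h p)%E by rewrite mule_ge0// lee_fin.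
have E w : (\int[mu]_(s in `[a, b]) (H s w)%:E = \int[mu]_s h (s, w))%E.
  rewrite integral_mkcond; apply: eq_integral => s _.
  by rewrite /h patchE indicE; case: ifP => _ /=; rewrite ?mule1 ?mule0.
have m2' := measurable_fun_fubini_tonelli_G (m1 := mu) h mh h0.
split.
  by apply: eq_measurable_fun m2' => w _; rewrite E.
rewrite (eq_integral (fun w => \int[mu]_s h (s, w)))%E; last by move=> w _.
rewrite -(fubini_tonelli (m1 := mu) (m2 := P) h mh h0).
rewrite [RHS]integral_mkcond; apply: eq_integral => s _.
rewrite patchE /h /=; case: ifP => hs.
  by apply: eq_integral => w _; rewrite indicE hs mule1.
by rewrite (eq_integral (fun=> 0%E)) ?integral0// => w _; rewrite indicE hs mule0.
Qed.

Definition II a b g w : R := Rintegral mu `[a, b] (fun s => ip (Y s w) (g s)).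

Lemma II_Yp a b g w : 0 <= a -> b <= T -> II a b g w = Rintegral mu `[a, b] (Yp g ^~ w).
Proof.
move=> a0 bT; apply: eq_Rintegral => s; rewrite inE /= in_itv /= => /andP[h1 h2].
by rewrite YpE// (le_trans a0 h1) (le_trans h2).
Qed.

Lemma II_measurable a b g : continuous g -> 0 <= a -> b <= T -> measurable_fun setT (II a b g).
Proof.
move=> cg a0 bT; have mY := Yp_measurable cg.
have mp : measurable_fun [set: R * Omega] (fun p => Num.max (Yp g p.1 p.2) 0).
  by apply: measurable_maxr.
have mn : measurable_fun [set: R * Omega] (fun p => Num.max (- Yp g p.1 p.2) 0).
  by apply: measurable_maxr => //; exact: measurableT_comp.
have m0 (r : R) : 0 <= Num.max r 0 by rewrite le_max lexx orbT.
have [h1 _] := @tonelli_measurable a b (fun s w => Num.max (Yp g s w) 0) mp (fun s w => m0 _).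
have [h2 _] := @tonelli_measurable a b (fun s w => Num.max (- Yp g s w) 0) mn (fun s w => m0 _).
have -> : II a b g = fine \o (fun w => (\int[mu]_(s in `[a, b]) (Num.max (Yp g s w) 0)%:E -
     \int[mu]_(s in `[a, b]) (Num.max (- Yp g s w) 0)%:E)%E).
  apply/funext => w; rewrite II_Yp// /Rintegral integralE /=; congr (fine (_ - _)%E).
    by apply: eq_integral => s _; rewrite funeposE /= EFin_max.
  by apply: eq_integral => s _; rewrite funenegE /= EFin_max EFinN.
by apply: measurableT_comp => //; exact: emeasurable_funB.
Qed.

Definition IA a b g w : R := Rintegral mu `[a, b] (fun s => `|ip (Y s w) (g s)|).

Lemma IA_measurable a b g : continuous g -> 0 <= a -> b <= T -> measurable_fun setT (IA a b g).
Proof.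
move=> cg a0 bT; have mY : measurable_fun [set: R * Omega] (fun p => `|Yp g p.1 p.2|).
  by apply: measurableT_comp => //; exact: Yp_measurable.
have [h1 _] := @tonelli_measurable a b (fun s w => `|Yp g s w|) mY (fun s w => normr_ge0 _).
have -> : IA a b g = fine \o (fun w => \int[mu]_(s in `[a, b]) `|Yp g s w|%:E)%E.
  apply/funext => w; rewrite /IA /Rintegral /=; congr fine; apply: eq_integral => s.
  rewrite inE /= in_itv /= => /andP[h2 h3].
  by rewrite YpE// (le_trans a0 h2) (le_trans h3).
exact: measurableT_comp.
Qed.

Lemma ae_itv_int g : continuous g ->
  {ae P, forall w, itv_int 0 T (fun s => ip (Y s w) (g s))}.
Proof. by move=> cg; apply: hint; exact: continuous_subspaceT. Qed.

(* The smallness condition on [[0, T]] is transferred to [[a, b]] by extending [g]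
   constantly and multiplying it with steep cutoff functions. *)
Let clamp a b s := Num.max a (Num.min b s).
Let cutoff a b (m : nat) s : R := Num.max 0 (1 - m%:R * `|s - clamp a b s|).

Let clamp_id a b s : a <= s <= b -> clamp a b s = s.
Proof. by move=> /andP[h1 h2]; rewrite /clamp min_r// max_r. Qed.

Let clamp_itv a b s : a <= b -> a <= clamp a b s <= b.
Proof. by move=> ab; rewrite /clamp le_max lexx ge_max ab ge_min lexx. Qed.

Let clamp_continuous a b : continuous (clamp a b).
Proof.
move=> s; apply: (@continuous_max _ _ (fun=> a) (Num.min b)); first exact: cst_continuous.
by apply: (@continuous_min _ _ (fun=> b) id); [exact: cst_continuous|exact: id].
Qed.

Let cutoff_continuous a b m : continuous (cutoff a b m).
Proof.
move=> s.
apply: (@continuous_max _ _ (fun=> 0) (fun s => 1 - m%:R * `|s - clamp a b s|)).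
  exact: cst_continuous.
apply: cvgB; first exact: cvg_cst.
apply: cvgM; first exact: cvg_cst.
by apply: cvg_norm; apply: cvgB; [exact: cvg_id|exact: clamp_continuous].
Qed.

Let cutoff01 a b m s : 0 <= cutoff a b m s <= 1.
Proof. by rewrite /cutoff le_max lexx ge_max ler01 gerBl mulr_ge0. Qed.

Let cutoff_cvg a b s : a <= b -> (fun m => cutoff a b m s) @ \oo --> (\1_(`[a, b]%classic : set R) s : R).
Proof.
move=> ab; rewrite indicE; have [sab|nsab] := boolP (s \in `[a, b]%classic).
  have {}sab : a <= s <= b by move: sab; rewrite inE /= in_itv.
  apply: cvg_near_cst; apply: nearW => m.
  by rewrite /cutoff clamp_id// subrr normr0 mulr0 subr0 max_r.
have dp : 0 < `|s - clamp a b s|.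
  rewrite normr_gt0 subr_eq0; apply/eqP => E; move/negP: nsab; apply.
  by rewrite inE /= in_itv /= E clamp_itv.
apply: cvg_near_cst; near=> m; rewrite /cutoff max_l//= subr_le0 -ler_pdivrMr// mul1r.
apply/ltW; apply: (lt_le_trans (truncnS_gt _)); rewrite ler_nat.
by near: m; exact: nbhs_infty_ge.
Unshelve. all: by end_near. Qed.

Lemma small_subinterval a b (g : nat -> R -> V) : 0 <= a -> a <= b -> b <= T ->
  (forall k, continuous (g k)) ->
  (forall e : R, 0 < e -> \forall k \near \oo, forall s, a <= s <= b -> `|g k s| <= e) ->
  cip P (fun k => II a b (g k)) (fun=> 0).
Proof.
move=> a0 ab bT cg gsmall.
pose gc k s := g k (clamp a b s).
have cgc k : continuous (gc k).
  by move=> s; apply: (@continuous_comp _ _ _ (clamp a b) (g k)); [exact: clamp_continuous|exact: cg].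
pose h k m s := cutoff a b m s *: gc k s.
have ch k m : continuous (h k m).
  by move=> s; apply: cvgZ; [exact: cutoff_continuous|exact: cgc].
have cvk k : cip P (fun m w => II 0 T (h k m) w - II a b (g k) w) (fun=> 0).
  apply: cip_of_ae_cvg.
    move=> m; apply: measurable_funB; apply: II_measurable => //; exact: ltW.
  apply: filterS (ae_itv_int (cgc k)) => w iw.
  suff cv : (fun m => II 0 T (h k m) w) @ \oo --> II a b (g k) w.
    rewrite -[X in _ --> X](subrr (II a b (g k) w)).
    by apply: cvgB; [exact: cv|exact: cvg_cst].
  have -> : II a b (g k) w = Rintegral mu `[0, T]
      (fun s => \1_(`[a, b]%classic : set R) s * ip (Y s w) (gc k s)).
    rewrite /II Rintegral_mkcond [RHS]Rintegral_mkcond; apply: eq_Rintegral => s _.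
    rewrite !patchE indicE; have [sab|nsab] := boolP (s \in `[a, b]%classic).
      have {}sab : a <= s <= b by move: sab; rewrite inE /= in_itv.
      have -> : s \in `[0, T]%classic.
        by case/andP : sab => h1 h2; rewrite inE /= in_itv /= (le_trans a0 h1) (le_trans h2).
      by rewrite mul1r /gc clamp_id.
    by rewrite mul0r; case: ifP.
  have [] := @dominated_convergence _ _ _ mu `[0, T]%classic (measurable_itv _)
     (fun m s => (cutoff a b m s * ip (Y s w) (gc k s))%:E)
     (fun s => (\1_(`[a, b]%classic : set R) s * ip (Y s w) (gc k s))%:E)
     (fun s => `|ip (Y s w) (gc k s)|%:E).
  - by move=> m; apply/measurable_EFinP; apply: itv_int_measurable; apply: itv_intM.
  - apply/measurable_EFinP; apply: measurable_funM => //.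
    exact: itv_int_measurable iw.
  - apply: aeW => s _; apply: cvg_EFin; first exact: nearW.
    by apply: cvgM; [exact: cutoff_cvg|exact: cvg_cst].
  - exact: itv_int_abs iw.
  - apply: aeW => s m _; rewrite lee_fin normrM ler_piMl// ger0_norm.
      by case/andP : (cutoff01 a b m s).
    by case/andP : (cutoff01 a b m s).
  move=> il _; rewrite -[X in _ --> X -> _](fineK (integrable_fin_num _ il))//.
  move=> /fine_cvg; apply: cvg_trans; apply: near_eq_cvg; apply: nearW => m /=.
  rewrite /II /Rintegral; congr fine; apply: eq_integral => s _.
  by rewrite (ipZr hV).
(* Diagonal choice: for each [k] a cutoff so steep that it costs at most 1/(k + 1), in size and in
   probability. [hsmall] then applies to the single sequence [h k (m k)] on [0, T]. *)
have pick k : exists m, exists B, [/\ measurable B, (P B <= (k.+1%:R^-1)%:E)%E &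
    forall w, ~ B w -> `|II 0 T (h k m) w - II a b (g k) w| <= k.+1%:R^-1].
  have k0 : (0 : R) < k.+1%:R^-1 by [].
  have [N _ hN] := cvk k _ _ k0 k0.
  have [B [mB PB hB]] := hN N (leqnn _).
  by exists N, B; split => // w /hB; rewrite subr0.
have [m hm] := choice pick.
have c1 : cip P (fun k => II 0 T (h k (m k))) (fun=> 0).
  apply: cip_of_cvg.
  - by move=> k; apply: II_measurable.
  - exact: measurable_cst.
  apply: hsmall => [k|e e0]; first exact: continuous_subspaceT.
  apply: filterS (gsmall e e0) => k hk s _.
  have /andP[z0 z1] := cutoff01 a b (m k) s.
  rewrite normrZ ger0_norm// (le_trans (ler_piMl _ z1))//.
  by apply: hk; exact: clamp_itv.
have c2 : cip P (fun k w => II a b (g k) w - II 0 T (h k (m k)) w) (fun=> 0).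
  move=> e eta e0 eta0; near=> k.
  have [B [mB PB hB]] := hm k; exists B; split => //.
    apply: (le_trans PB); rewrite lee_fin ltW//; near: k.
    exact: near_infty_natSinv_lt (PosNum eta0).
  move=> w /hB; rewrite subr0 distrC => hw; apply: (le_trans hw); rewrite ltW//.
  by near: k; exact: near_infty_natSinv_lt (PosNum e0).
have := cipD c2 c1; apply: cip_ae => [k|]; apply: aeW => w.
  by rewrite subrK.
by rewrite addr0.
Unshelve. all: by end_near. Qed.

End TimeIntegrals.

Context {U : completeNormedModType R}.
Variable L : R -> U -> Omega -> R.
Hypothesis hL : cylindrical_levy P L.
Hypothesis hL2 : forall u : U, (\int[P]_w ((L 1 u w) ^+ 2)%:E < +oo)%E.
Variables (A : V -> V) (DA : set V) (Bs : V -> U) (y0 : V).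
Hypothesis Bs_linear : forall (k : R) x y, Bs (k *: x + y) = k *: Bs x + Bs y.
Hypothesis heq : forall v Av, adjoint_graph ip A DA v Av -> forall t, 0 <= t <= T ->
  {ae P, forall w, ip (Y t w) v = ip y0 v + Rintegral mu `[0, t] (fun s => ip (Y s w) Av)
     + L t (Bs v) w}.
Local Notation graph := (adjoint_graph ip A DA).

(** * Integration by parts for a fixed vector *)

Section RiemannSum.
Implicit Types (s t a b r : R) (v w : V).

Let cstV v : continuous (fun _ : R => v). Proof. by move=> x; exact: cst_continuous. Qed.

Lemma increment_equation v w s t : graph v w -> 0 <= s -> s <= t -> t <= T ->
  {ae P, forall x, ip (Y t x) v - ip (Y s x) v - II s t (fun=> w) x =
     L t (Bs v) x - L s (Bs v) x}.
Proof.
move=> g s0 st tT; have t0 := le_trans s0 st; have sT := le_trans st tT.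
have h1 := heq g (_ : 0 <= t <= T); rewrite t0 tT in h1; have {}h1 := h1 isT.
have h2 := heq g (_ : 0 <= s <= T); rewrite s0 sT in h2; have {}h2 := h2 isT.
have h3 := ae_itv_int (@cstV w).
apply: filterS3 h1 h2 h3 => x -> -> i3.
rewrite (Rintegral_split s0 st (itv_int_sub (lexx 0) tT i3)) /II; ring.
Qed.

(** An increment of length l has second moment l times the variance plus l^2 times the squared mean;
    for l at most [T] this is at most l times [kappa u]. *)
Let kappa u := levy_var P L u + T * levy_mean P L u ^+ 2.

Let kappa0 u : 0 <= kappa u.
Proof. by rewrite addr_ge0 ?levy_var_ge0// mulr_ge0 ?sqr_ge0// ltW. Qed.

Let abs_increment u s t : 0 <= s -> s <= t -> t <= T ->
  EX P (fun x => `|L t u x - L s u x|) <= Num.sqrt (kappa u * (t - s)).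
Proof.
move=> s0 st tT; have t0 := le_trans s0 st.
have lX := levy_increment_L2 hL hL2 u s0 t0; set X := fun x => _ in lX.
have m2X : m2 P X <= kappa u * (t - s).
  rewrite (m2_vari lX) /vari (levy_increment_mean hL hL2)// (levy_increment_var hL hL2)//.
  rewrite /kappa exprMn.
  have h : (t - s) ^+ 2 * levy_mean P L u ^+ 2 <= T * levy_mean P L u ^+ 2 * (t - s).
    rewrite [leRHS]mulrAC ler_wpM2r ?sqr_ge0// expr2 ler_wpM2r ?subr_ge0//.
    by rewrite lerBlDr (le_trans tT)// lerDl.
  by rewrite [leRHS]mulrDl [X in _ <= X + _]mulrC lerD2l.
have lA : L2 P (fun x => `|X x|).
  apply: (L2_dom (Y := fun x => X x ^+ 2)); last by move=> x; rewrite real_normK ?num_real.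
    by apply: measurableT_comp => //; case: lX.
  exact: L2_sqr.
have h := jensen lA.
have E : m2 P (fun x => `|X x|) = m2 P X.
  by congr (EX P _); apply/funext => x; rewrite real_normK ?num_real.
rewrite E in h; rewrite -(ger0_norm (EX_ge0 P (fun x => normr_ge0 (X x)))) -sqrtr_sqr.
by apply: ler_wsqrtr; exact: le_trans m2X.
Qed.

Let Yv v s x := Yp (fun=> v) s x.

(* By [increment_equation] the truncation removes the drift, so the mean of [osc] is
   controlled by the increments of [L] alone; no moment of the time integrals of [Y]
   is available. *)
Let osc v w s t x : R := fine (\int[mu]_(r in `[s, t])
   (Num.max (`|Yv v t x - Yv v r x| - IA s t (fun=> w) x) 0)%:E)%E.

Let osc_ge0 v w s t x : 0 <= osc v w s t x.
Proof.
by rewrite fine_ge0// integral_ge0// => r _; rewrite lee_fin le_max lexx orbT.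
Qed.

Let osc_integrand_measurable v w s t : 0 <= s -> s <= t -> t <= T ->
  measurable_fun [set: R * Omega] (fun p =>
     Num.max (`|Yv v t p.2 - Yv v p.1 p.2| - IA s t (fun=> w) p.2) 0).
Proof.
move=> s0 st tT.
have m1 := Yp_cst_measurable v.
have m2' : measurable_fun [set: R * Omega] (fun p => Yv v t p.2).
  apply: (measurableT_comp (f := Yv v t)); last exact: measurable_snd.
  exact: (Yp_section t (@cstV v)).
have m3 : measurable_fun [set: R * Omega] (fun p => IA s t (fun=> w) p.2).
  apply: (measurableT_comp (f := IA s t (fun=> w))); last exact: measurable_snd.
  exact: (IA_measurable  (@cstV w) s0 tT).
apply: measurable_maxr => //; apply: measurable_funB => //.
by apply: measurableT_comp => //; exact: measurable_funB.
Qed.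

Let osc_measurable v w s t : 0 <= s -> s <= t -> t <= T -> measurable_fun setT (osc v w s t).
Proof.
move=> s0 st tT.
have [h1 _] := @tonelli_measurable s t (fun r x =>
    Num.max (`|Yv v t x - Yv v r x| - IA s t (fun=> w) x) 0)
   (osc_integrand_measurable v w s0 st tT)
   (fun r x => ltac:(by rewrite le_max lexx orbT)).
exact: measurableT_comp.
Qed.

Let osc_mean v w s t : graph v w -> 0 <= s -> s <= t -> t <= T ->
  (\int[P]_x (osc v w s t x)%:E <= ((t - s) * Num.sqrt (kappa (Bs v) * (t - s)))%:E)%E.
Proof.
move=> g s0 st tT; have t0 := le_trans s0 st.
pose H r x := Num.max (`|Yv v t x - Yv v r x| - IA s t (fun=> w) x) 0.
have H0 r x : 0 <= H r x by rewrite /H le_max lexx orbT.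
have [h1 h2] := @tonelli_measurable s t H (osc_integrand_measurable v w s0 st tT) H0.
apply: (@le_trans _ _ (\int[P]_x \int[mu]_(r in `[s, t]) (H r x)%:E)%E).
  apply: ge0_le_integral => //.
  - by move=> x _; rewrite lee_fin osc_ge0.
  - by apply/measurable_EFinP; exact: osc_measurable.
  - have fine_le (J : \bar R) : (0 <= J)%E -> ((fine J)%:E <= J)%E.
      by case: J => [r||] //= _; rewrite leey.
    move=> x _; apply: (fine_le (\int[mu]_(r in `[s, t]) (H r x)%:E)%E).
    by apply: integral_ge0 => r _; rewrite lee_fin H0.
rewrite h2.
apply: (@le_trans _ _ (\int[mu]_(r in `[s, t]) (Num.sqrt (kappa (Bs v) * (t - s)))%:E)%E).
  apply: ge0_le_integral => //.
  - by move=> r _; apply: integral_ge0 => x _; rewrite lee_fin.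
  - apply: measurable_funTS.
    apply: (measurable_fun_fubini_tonelli_F (m2 := P) (fun p => (H p.1 p.2)%:E)).
      by apply/measurable_EFinP; exact: osc_integrand_measurable.
    by move=> p; rewrite lee_fin.
  - move=> r; rewrite /= in_itv /= => /andP[sr rt].
    have r0 := le_trans s0 sr.
    have lX := levy_increment_L2 hL hL2 (Bs v) r0 t0.
    have iX : Int P (fun x => `|L t (Bs v) x - L r (Bs v) x|) by exact: integrable_norm (L2_Int lX).
    apply: (@le_trans _ _ (\int[P]_x (`|L t (Bs v) x - L r (Bs v) x|)%:E)%E); last first.
      rewrite -EX_EFin// lee_fin (le_trans (abs_increment _ r0 rt tT))//.
      by rewrite ler_wsqrtr// ler_wpM2l// lerD2l lerN2.
    apply: ae_ge0_le_integral => //.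
    - by move=> x _; rewrite lee_fin.
    - apply/measurable_EFinP.
      exact: (measurable_fun_pair2 r (osc_integrand_measurable v w s0 st tT)).
    - exact: measurable_int iX.
    apply: filterS2 (increment_equation g r0 rt tT) (ae_itv_int (@cstV w)) => x E i3 _.
    rewrite lee_fin /H ge_max normr_ge0 andbT lerBlDr /Yv !YpE ?t0 ?r0 ?(le_trans rt tT)//.
    have -> : ip (Y t x) v - ip (Y r x) v = (L t (Bs v) x - L r (Bs v) x) + II r t (fun=> w) x.
      by rewrite -E subrK.
    rewrite (le_trans (ler_normD _ _))// lerD2l.
    have i4 : itv_int s t (fun r => ip (Y r x) w) by exact: itv_int_sub i3.
    have i5 : itv_int r t (fun r => ip (Y r x) w) by exact: itv_int_sub i4.
    rewrite (le_trans (le_normr_Rintegral _ i5))// /IA (Rintegral_split sr rt (itv_int_abs i4)).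
    by rewrite lerDr Rintegral_ge0.
rewrite integral_cst// [X in (_ * X)%E](_ : _ = (t - s)%:E); first by rewrite -EFinM mulrC.
rewrite /= lebesgue_measure_itv /= lte_fin; case: ltP => //= ts.
by have -> : t = s; [apply/eqP; rewrite eq_le st ts|rewrite subrr].
Qed.

Section OnInterval.
Variables (a b : R).
Hypotheses (a0 : 0 <= a) (ab : a <= b) (bT : b <= T).

Definition node (M j : nat) : R := a + j%:R * ((b - a) / M.+1%:R).

Lemma node0 M : node M 0 = a. Proof. by rewrite /node mul0r addr0. Qed.

Lemma nodeM M : node M M.+1 = b.
Proof. by rewrite /node mulrCA mulfV ?pnatr_eq0// mulr1 addrC subrK. Qed.

Lemma node_step M j : node M j.+1 - node M j = (b - a) / M.+1%:R.
Proof. by rewrite /node -natr1; ring. Qed.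

Lemma step_ge0 M : 0 <= (b - a) / M.+1%:R.
Proof. by rewrite divr_ge0// subr_ge0. Qed.

Lemma node_le M i j : (i <= j)%N -> node M i <= node M j.
Proof. by move=> ij; rewrite lerD2l ler_wpM2r ?step_ge0// ler_nat. Qed.

Lemma node_itv M j : (j <= M.+1)%N -> a <= node M j <= b.
Proof.
by move=> jM; rewrite -[X in X <= _](node0 M) -[X in _ && (_ <= X)](nodeM M) !node_le.
Qed.

Definition C1 (phi phi' : R -> R) := (forall x : R, is_derive x 1 phi (phi' x)) /\ continuous phi'.

Lemma C1_continuous phi phi' : C1 phi phi' -> continuous phi.
Proof. by case=> /is_derive_continuous. Qed.

(** [parts_error] is summed over the subintervals, the discrepancy there being the increment of [L].
    The oscillations tend to 0 in mean, like the square root of the mesh; the drift error is of the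
    order of the mesh, but only pathwise. *)
Lemma riemann_sum_cst v w phi phi' : graph v w -> C1 phi phi' ->
  cip P (fun M x => \sum_(j < M.+1) phi (node M j) *
            (L (node M j.+1) (Bs v) x - L (node M j) (Bs v) x))
    (fun x => phi b * ip (Y b x) v - phi a * ip (Y a x) v
       - II a b (fun s => phi' s *: v + phi s *: w) x).
Proof.
move=> g hphi; have [dphi cphi'] := hphi; have cphi := C1_continuous hphi.
have [K [K0 hK]] := continuous_itv_bounded a b cphi'.
pose Z M x := \sum_(j < M.+1) osc v w (node M j) (node M j.+1) x.
pose del (M : nat) : R := (b - a) / M.+1%:R.
have nP M (j : 'I_M.+1) : [/\ 0 <= node M j, node M j <= node M j.+1,
    node M j.+1 <= T, a <= node M j & node M j.+1 <= b].
  have /andP[h1 h2] := node_itv (ltnW (ltn_ord j) : (j <= M.+1)%N).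
  have /andP[h3 h4] := node_itv (ltn_ord j : (j.+1 <= M.+1)%N).
  by split => //; [exact: le_trans h1|exact: node_le|exact: le_trans bT].
have del0 : del @ \oo --> 0.
  have -> : del = (fun M => (b - a) * M.+1%:R^-1) by [].
  rewrite -(mulr0 (b - a)); apply: cvgM; first exact: cvg_cst.
  exact: cvg_harmonic.
have cZ : cip P Z (fun=> 0).
  apply: (@cip_L1 _ _ _ _ _ (fun M => (b - a) * Num.sqrt (kappa (Bs v) * del M))).
  - move=> M; apply: measurable_sum => j; have [h1 h2 h3 _ _] := nP M j.
    exact: osc_measurable.
  - by move=> M x; apply: sumr_ge0 => j _; exact: osc_ge0.
  - move=> M; under eq_integral do rewrite -sumEFin.
    rewrite ge0_integral_sum//; last 2 first.
    + move=> j; have [h1 h2 h3 _ _] := nP M j.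
      by apply/measurable_EFinP; exact: osc_measurable.
    + by move=> j x _; rewrite lee_fin.
    have -> : ((b - a) * Num.sqrt (kappa (Bs v) * del M))%:E =
        (\sum_(j < M.+1) (del M * Num.sqrt (kappa (Bs v) * del M))%:E)%E.
      have hd : M.+1%:R * del M = b - a by rewrite /del mulrCA mulfV ?pnatr_eq0// mulr1.
      rewrite sumEFin sumr_const card_ord -hd; congr (_%:E).
      by rewrite -(mulr_natl (del M * _)) mulrA.
    apply: lee_sum => j _; have [h1 h2 h3 _ _] := nP M j.
    by rewrite (le_trans (osc_mean g h1 h2 h3))// node_step.
  - rewrite -(mulr0 (b - a)); apply: cvgM; first exact: cvg_cst.
    rewrite -sqrtr0 -[X in Num.sqrt X](mulr0 (kappa (Bs v))).
    have h : kappa (Bs v) * del M @[M --> \oo] --> kappa (Bs v) * 0.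
      by apply: cvgM; [exact: cvg_cst|exact: del0].
    exact: (cvg_comp _ _ h (@sqrt_continuous R _)).
(* The factor 2 has two sources: the drift split off by [truncated_error] and the second term of
   [parts_error]. *)
have cIA : cip P (fun M x => 2 * K * del M * IA a b (fun=> w) x) (fun=> 0).
  apply: (@cip_bounded _ _ _ _ _ (IA a b (fun=> w)) (fun M => 2 * K * del M)).
  - exact: (IA_measurable  (@cstV w) a0 bT).
  - by move=> M; rewrite mulr_ge0 ?step_ge0// mulr_ge0.
  - by rewrite -(mulr0 (2 * K)); apply: cvgM; [exact: cvg_cst|exact: del0].
  - move=> M; apply: aeW => x; rewrite ger0_norm// mulr_ge0//.
      by rewrite mulr_ge0 ?step_ge0// mulr_ge0.
    by apply: Rintegral_ge0.
apply: cip_of_diff.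
have := cipD (cipZ K cZ) cIA; rewrite mulr0 (_ : (fun _ => 0 + 0) = fun=> 0); last first.
  by apply/funext => x; rewrite addr0.
apply: cip_squeeze => M.
have hinc : {ae P, forall x, forall j, (j < M.+1)%N ->
    ip (Y (node M j.+1) x) v - ip (Y (node M j) x) v - II (node M j) (node M j.+1) (fun=> w) x =
    L (node M j.+1) (Bs v) x - L (node M j) (Bs v) x}.
  apply: ae_forall_nat => j; have [jM|jM] := ltnP j M.+1; last by apply: aeW.
  have [h1 h2 h3 _ _] := nP M (Ordinal jM).
  by apply: filterS (increment_equation g h1 h2 h3) => x + _.
apply: filterS3 hinc (ae_itv_int (@cstV v)) (ae_itv_int (@cstV w)) => x hx iv iw.
pose y r := ip (Y r x) v; pose f r := ip (Y r x) w.
have iva : itv_int a b y by exact: itv_int_sub iv.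
have iwa : itv_int a b f by exact: itv_int_sub iw.
have ipf : itv_int a b (fun r => phi' r * y r + phi r * f r).
  by apply: itv_intD; exact: itv_intM.
pose X r := phi r * y r - Rintegral mu `[a, r] (fun r => phi' r * y r + phi r * f r).
have EX1 : phi b * ip (Y b x) v - phi a * ip (Y a x) v - II a b (fun s => phi' s *: v + phi s *: w) x
    = \sum_(j < M.+1) (X (node M j.+1) - X (node M j)).
  rewrite -(big_mkord xpredT (fun j => X (node M j.+1) - X (node M j))).
  rewrite telescope_sumr// node0 nodeM /X set_itv1 Rintegral_set1 subr0 /II -/(y b) -/(y a).
  rewrite addrAC; congr (_ - _ - _); apply: eq_Rintegral => r _.
  by rewrite (ipDr hV) !(ipZr hV).
rewrite EX1 -sumrB (le_trans (ler_norm_sum _ _ _))//.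
have -> : K * Z M x + 2 * K * del M * IA a b (fun=> w) x =
   \sum_(j < M.+1) (K * osc v w (node M j) (node M j.+1) x +
      2 * K * del M * IA (node M j) (node M j.+1) (fun=> w) x).
  rewrite big_split/= -!mulr_sumr; congr (_ + _ * _).
  rewrite -(big_mkord xpredT (fun j => IA (node M j) (node M j.+1) (fun=> w) x)).
  have : forall k, (k <= M.+1)%N -> IA a (node M k) (fun=> w) x =
      \sum_(0 <= j < k) IA (node M j) (node M j.+1) (fun=> w) x.
    elim=> [|k ih] kM; first by rewrite big_geq// node0 /IA set_itv1 Rintegral_set1.
    rewrite big_nat_recr//= -ih; last exact: ltnW.
    have [_ h2 _ h4 h5] := nP M (Ordinal kM).
    rewrite /IA (Rintegral_split h4 h2)//; apply: itv_int_sub (itv_int_abs iwa) => //.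
  by move=> /(_ _ (leqnn _)); rewrite nodeM.
apply: ler_sum => j _; have [h1 h2 h3 h4 h5] := nP M j.
set s := node M j in h1 h2 h4 *; set t := node M j.+1 in h2 h3 h5 *.
have ist : itv_int s t y by exact: itv_int_sub iva.
have ift : itv_int s t f by exact: itv_int_sub iwa.
have hKst r : s <= r <= t -> `|phi' r| <= K.
  by move=> /andP[sr rt]; apply: hK; rewrite (le_trans h4 sr) (le_trans rt h5).
have perr := parts_error h2 dphi cphi' hKst ist ift.
have EXj : X t - X s = phi t * y t - phi s * y s -
    Rintegral mu `[s, t] (fun r => phi' r * y r + phi r * f r).
  rewrite /X (Rintegral_split h4 h2); first by ring.
  exact: itv_int_sub ipf.
rewrite EXj -hx// distrC -/(y t) -/(y s); apply: (le_trans perr).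
have -> : t - s = del M by exact: node_step.
set G := Rintegral mu `[s, t] (fun r => `|f r|).
have GE : IA s t (fun=> w) x = G by [].
have [tr _] := truncated_error G h2 ist.
have oscE : osc v w s t x = Rintegral mu `[s, t] (fun r => Num.max (`|y t - y r| - G) 0).
  rewrite /osc /Rintegral; congr fine; apply: eq_integral => r.
  rewrite inE /= in_itv /= => /andP[sr rt].
  by rewrite /Yv !YpE ?GE// ?(le_trans h1 sr) ?(le_trans rt h3)// (le_trans h1 h2).
rewrite -oscE (_ : t - s = del M) in tr; last exact: node_step.
rewrite GE; have := ler_wpM2l K0 tr; rewrite mulrDr.
by set I := Rintegral _ _ _; lra.
Qed.

End OnInterval.
End RiemannSum.

(** * Integration by parts for time dependent test functions *)

Section TestFunctions.
Variables (a b : R).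
Hypotheses (a0 : 0 <= a) (ab : a <= b) (bT : b <= T).
Implicit Types (s t r : R) (v w z : V) (p q : R -> V) (psi chi : R -> R).
Local Notation node := (node a b).

Definition rsum psi p M x := \sum_(j < M.+1) psi (node M j) *
  (L (node M j.+1) (Bs (p (node M j))) x - L (node M j) (Bs (p (node M j))) x).

(* [q s] plays the role of the generator adjoint applied to [p s]; the scalar
   factor [psi] makes the class stable under multiplication by functions. *)
Definition ident p p' q := [/\ continuous p, continuous p', continuous q &
  forall psi psi', C1 psi psi' ->
  cip P (rsum psi p)
    (fun x => psi b * ip (Y b x) (p b) - psi a * ip (Y a x) (p a)
       - II a b (fun s => psi' s *: p s + psi s *: p' s + psi s *: q s) x)].

Lemma ident_cst v w : graph v w -> ident (fun=> v) (fun=> 0) (fun=> w).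
Proof.
move=> g; split; try by move=> x; exact: cst_continuous.
move=> psi psi' hpsi.
have := riemann_sum_cst a0 ab bT g hpsi.
under [X in cip P _ X -> _]eq_fun => x.
  rewrite (_ : (fun s => psi' s *: v + psi s *: w) =
    (fun s => psi' s *: v + psi s *: 0 + psi s *: w)); last first.
    by apply/funext => s; rewrite scaler0 addr0.
  over.
exact.
Qed.

Lemma C1M psi psi' chi chi' : C1 psi psi' -> C1 chi chi' ->
  C1 (fun s => psi s * chi s) (fun s => psi' s * chi s + psi s * chi' s).
Proof.
move=> h1 h2; have c1 := C1_continuous h1; have c2 := C1_continuous h2.
have [d1 c1'] := h1; have [d2 c2'] := h2; split.
  move=> s; apply: is_derive_eq; rewrite addrC /GRing.scale /=.
  by rewrite (mulrC (chi s)).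
by move=> s; apply: cvgD; apply: cvgM; [exact: c1'|exact: c2|exact: c1|exact: c2'].
Qed.

(** Multiplication by [chi] amounts to replacing the scalar factor [psi] by its product with [chi].
    This is exactly one step of the Bernstein recursion. *)
Lemma ident_linear chi chi' p1 p1' q1 p2 p2' q2 :
  C1 chi chi' -> ident p1 p1' q1 -> ident p2 p2' q2 ->
  ident (fun s => chi s *: p1 s + p2 s)
        (fun s => (chi' s *: p1 s + chi s *: p1' s) + p2' s)
        (fun s => chi s *: q1 s + q2 s).
Proof.
move=> hchi [cp1 cp1' cq1 h1] [cp2 cp2' cq2 h2].
have cchi := C1_continuous hchi; have [_ cchi'] := hchi.
have cS (f : R -> R) (g : R -> V) : continuous f -> continuous g -> continuous (fun s => f s *: g s).
  by move=> cf cg s; apply: cvgZ; [exact: cf|exact: cg].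
have cA (f g : R -> V) : continuous f -> continuous g -> continuous (fun s => f s + g s).
  by move=> cf cg s; apply: cvgD; [exact: cf|exact: cg].
split; [by apply/cA => //; exact: cS|by apply/cA => //; apply/cA; exact: cS|
  by apply/cA => //; exact: cS|].
move=> psi psi' hpsi; have cpsi := C1_continuous hpsi; have [_ cpsi'] := hpsi.
have hM := C1M hpsi hchi; have [_ cM'] := hM.
apply: cip_ae (cipD (h1 _ _ hM) (h2 _ _ hpsi)) => [M|].
  (* Linearity of [L t] holds almost surely for given vectors and a given time; only the finitely
     many nodes of the [M]-th partition are needed. *)
  have lin : {ae P, forall x, forall j, (j < M.+1)%N ->
      (forall t, t = node M j \/ t = node M j.+1 ->
      L t (Bs (chi (node M j) *: p1 (node M j) + p2 (node M j))) x =
      chi (node M j) * L t (Bs (p1 (node M j))) x + L t (Bs (p2 (node M j))) x)}.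
    apply: ae_forall_nat => j; have [jM|jM] := ltnP j M.+1; last exact: aeW.
    have /andP[n1 _] := node_itv ab (ltnW jM); have /andP[n2 _] := node_itv ab jM.
    have [_ l2 _ _] := hL.
    have e1 := l2 (node M j) (chi (node M j)) (Bs (p1 (node M j))) (Bs (p2 (node M j))) (le_trans a0 n1).
    have e2 := l2 (node M j.+1) (chi (node M j)) (Bs (p1 (node M j))) (Bs (p2 (node M j))) (le_trans a0 n2).
    by apply: filterS2 e1 e2 => x e1 e2 _ t [->|->]; rewrite Bs_linear.
  apply: filterS lin => x hx; rewrite /rsum -big_split; apply: eq_bigr => j _ /=.
  rewrite (hx j (ltn_ord j) (node M j.+1)); last by right.
  by rewrite (hx j (ltn_ord j) (node M j)); [ring|left].
have i1 := ae_itv_int (cS _ _ cM' cp1).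
have i2 := ae_itv_int (cS _ _ (C1_continuous hM) cp1').
have i3 := ae_itv_int (cS _ _ (C1_continuous hM) cq1).
have i4 := ae_itv_int (cA _ _ (cA _ _ (cS _ _ cpsi' cp2) (cS _ _ cpsi cp2')) (cS _ _ cpsi cq2)).
apply: filterS (filterI (filterI i1 i2) (filterI i3 i4)) => x [[j1 j2] [j3 j4]].
rewrite !(ipDr hV) !(ipZr hV).
have sub f : itv_int 0 T f -> itv_int a b f by exact: itv_int_sub.
have -> : II a b (fun s => psi' s *: (chi s *: p1 s + p2 s) +
    psi s *: (chi' s *: p1 s + chi s *: p1' s + p2' s) + psi s *: (chi s *: q1 s + q2 s)) x =
  II a b (fun s => (psi' s * chi s + psi s * chi' s) *: p1 s + psi s * chi s *: p1' s
       + psi s * chi s *: q1 s) x +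
  II a b (fun s => psi' s *: p2 s + psi s *: p2' s + psi s *: q2 s) x; last by ring.
rewrite /II -RintegralD//; last 2 first.
- have := itv_intD (itv_intD (sub _ j1) (sub _ j2)) (sub _ j3).
  by apply: eq_integrable => // s _; rewrite /= !(ipDr hV).
- exact: sub j4.
apply: eq_Rintegral => s _.
by rewrite !(ipDr hV) !(ipZr hV) !(ipDr hV) !(ipZr hV); ring.
Qed.

Lemma C1_cst (k : R) : C1 (fun=> k) (fun=> 0).
Proof. by split => [s|s]; [exact: is_derive_cst|exact: cst_continuous]. Qed.

(** Time enters only through the scalar weights [X s] and [1 - X s], so the recursion never leaves
    the class [ident], provided that [K] preserves the graph of the adjoint generator. *)
Lemma ident_bern (K : V -> V) (tau : R) m z w :
  (forall (k : R) x y, K (k *: x + y) = k *: K x + K y) ->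
  (forall z w, graph z w -> graph (K z) (K w)) -> graph z w ->
  ident (fun s => bern K m ((b - s) / tau) z)
        (fun s => - tau^-1 *: dbern K m ((b - s) / tau) z)
        (fun s => bern K m ((b - s) / tau) w).
Proof.
move=> lK gK; pose X s := (b - s) / tau.
have hX : C1 X (fun=> - tau^-1).
  split; last by move=> s; exact: cst_continuous.
  move=> s; rewrite /X; apply: is_derive_eq.
  by rewrite /GRing.scale /= mulr0 !add0r mul1r mulrN mulr1.
have hX1 : C1 (fun s => 1 - X s) (fun=> tau^-1).
  case: hX => dX _; split; last by move=> s; exact: cst_continuous.
  by move=> s; have := is_deriveB (is_derive_cst (1 : R) s 1) (dX s); rewrite sub0r opprK.
have K0 : K 0 = 0.
  by have := lK (-1) 0 0; rewrite scaler0 addr0 scaleN1r addrC subrr.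
have i0 : ident (fun=> 0) (fun=> 0) (fun=> 0).
  by apply: ident_cst => x Dx; rewrite !(ip0r hV).
elim: m z w => [|m ih] z w g.
  by have := ident_cst g; rewrite /ident /= scaler0.
have := ident_linear hX1 (ih _ _ g) (ident_linear hX (ih _ _ (gK _ _ g)) i0).
rewrite /=.
set p := fun s => _ + (_ + 0); set p' := fun s => _ + (_ + 0); set q := fun s => _ + (_ + 0).
rewrite (_ : p = (fun s => bern K m.+1 (X s) z)); last by apply/funext => s; rewrite /p addr0.
rewrite (_ : q = (fun s => bern K m.+1 (X s) w)); last by apply/funext => s; rewrite /q addr0.
rewrite (_ : p' = (fun s => - tau^-1 *: dbern K m.+1 (X s) z))//.
apply/funext => s; rewrite /p' addr0 /= !scalerDr !scalerA !scalerN !scaleNr opprK.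
rewrite !(mulrC (- tau^-1)) addrACA [X in X + _]addrC.
by [].
Qed.

Lemma ident_endpoint p p' q : ident p p' q ->
  cip P (rsum (fun=> 1) p)
    (fun x => ip (Y b x) (p b) - ip (Y a x) (p a) - II a b (fun s => p' s + q s) x).
Proof.
move=> [_ _ _ /(_ _ _ (C1_cst 1))].
under [X in cip P _ X -> _]eq_fun => x.
  rewrite !mul1r (_ : (fun s => 0 *: p s + 1 *: p' s + 1 *: q s) =
    (fun s => p' s + q s)); last by apply/funext => s; rewrite scale0r add0r !scale1r.
  over.
exact.
Qed.

End TestFunctions.

Variables (S : R -> V -> V) (Ss : R -> V -> V).
Hypothesis hS : C0_semigroup S.
Hypothesis hA : generator_of S A DA.
Hypothesis hSs : forall t : R, 0 <= t -> forall x y, ip (S t x) y = ip x (Ss t y).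
Variables C Cl beta : R.
Hypothesis C_ge1 : 1 <= C.
Hypothesis hC : forall t x, 0 <= t -> t <= T -> `|S t x| <= C * `|x|.
Hypotheses (Cl0 : 0 <= Cl) (hCl : forall v : U, m2 P (L 1 v) <= Cl * `|v| ^+ 2).
Hypotheses (beta0 : 0 <= beta) (hbeta : forall v, `|Bs v| <= beta * `|v|).
Local Notation smooth := (smooth ip A DA Ss T).

Let C0 : 0 <= C. Proof. exact: le_trans C_ge1. Qed.

(** * The cubic error over one interval *)

Section MildIncrements.
Implicit Types (s t r a b : R) (v w z : V).

Lemma graph_adjoint r v w : 0 <= r -> graph v w -> graph (Ss r v) (Ss r w).
Proof.
move=> r0 g x Dx; have [D E] := generator_semigroup hS hA r0 Dx.
by rewrite -!hSs// -E g.
Qed.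

Lemma node_grid a b M : 0 <= a -> a <= b -> grid (node a b M).
Proof.
move=> a0 ab; split => j; last exact: node_le.
by rewrite /node addr_ge0// mulr_ge0// step_ge0.
Qed.

Lemma BsB v w : Bs (v - w) = Bs v - Bs w.
Proof. by have := Bs_linear (-1) w v; rewrite !scaleN1r !(addrC (- _)). Qed.

Lemma levyB t (u v : U) : 0 <= t -> {ae P, forall x, L t (u - v) x = L t u x - L t v x}.
Proof.
move=> t0; have [_ l2 _ _] := hL; apply: filterS (l2 t (-1) v u t0) => x.
by rewrite scaleN1r addrC => ->; rewrite mulN1r addrC.
Qed.

(* Pairing of [Y b - S (b - a) (Y a)] with [v]. *)
Definition mild_increment a b v x := ip (Y b x) v - ip (Y a x) (Ss (b - a) v).

Section ShortInterval.
Variables (a b c : R) (v w : V).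
Hypotheses (sm : smooth c v w) (a0 : 0 <= a) (ab : a < b) (bT : b <= T).

Let tau := b - a.
Let tau0 : 0 < tau. Proof. by rewrite subr_gt0. Qed.
Let tauT : tau <= T. Proof. by rewrite lerBlDr (le_trans bT)// lerDl. Qed.
Let step n : R := tau / n.+1%:R.
Let K n := Ss (step n).
Let X s := (b - s) / tau.
Let p n s := bern (K n) n.+1 (X s) v.
Let p' n s := - tau^-1 *: dbern (K n) n.+1 (X s) v.
Let q n s := bern (K n) n.+1 (X s) w.
Let D x := L b (Bs v) x - L a (Bs v) x.

Let b0 : 0 <= b. Proof. exact: le_trans (ltW ab). Qed.

Let step_ge0 n : 0 <= step n. Proof. by rewrite divr_ge0// ltW. Qed.

Let K_linear n (k : R) x y : K n (k *: x + y) = k *: K n x + K n y.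
Proof. by rewrite /K (adjoint_linear hV hSs). Qed.

Let iterK n k z : iter k (K n) z = Ss (k%:R * step n) z.
Proof. by rewrite (adjoint_iter hV hS hSs). Qed.

Let iter_le n k : (k <= n.+1)%N -> k%:R * step n <= tau.
Proof.
by move=> kn; rewrite /step mulrCA ger_pMr// ler_pdivrMr// mul1r ler_nat.
Qed.

Let X01 s : a <= s <= b -> 0 <= X s <= 1.
Proof.
move=> /andP[sa sb]; rewrite divr_ge0 ?subr_ge0 ?(ltW ab)//=.
by rewrite ler_pdivrMr// mul1r lerD2l lerN2.
Qed.

Let ident_p n : ident a b (p n) (p' n) (q n).
Proof.
apply: (ident_bern a0 (ltW ab) bT).
- exact: K_linear.
- by move=> z z'; exact: graph_adjoint.
- by case: sm.
Qed.

Let p_b n : p n b = v. Proof. by rewrite /p /X subrr mul0r bern_at0. Qed.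

Let p_a n : p n a = Ss tau v.
Proof.
rewrite /p /X divff ?lt0r_neq0// bern_at1 iterK /step mulrCA mulfV ?mulr1//.
Qed.

Let p_near n s : a <= s <= b -> `|p n s - v| <= c * tau.
Proof.
move=> hs; apply: bern_convex; first exact: X01.
move=> k kn; rewrite iterK; have [c0 _ hc] := sm.
have h0 : 0 <= k%:R * step n by rewrite mulr_ge0.
have h1 := iter_le kn.
have [h _ _] := hc _ h0 (le_trans h1 tauT).
by rewrite (le_trans h)// ler_wpM2l.
Qed.

Let g n s := p' n s + q n s.

Let g_small n s : a <= s <= b -> `|g n s| <= C * (2 * c * step n).
Proof.
move=> hs; have x01 := X01 hs; have [c0 _ hc] := sm.
have st0 : 0 < step n by rewrite divr_gt0.
have stT : step n <= T by have := iter_le (isT : (1 <= n.+1)%N); rewrite mul1r => /le_trans; apply.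
(* By [bernS] and [dbernE] both summands of [g n] have degree [n], so [g n s] is the polynomial of
   one vector [z]. Smoothness bounds its two parts, the defect of the difference quotient and the
   change of [w] over one step, by [c * step n] each. *)
pose z := w - (step n)^-1 *: (K n v - v) + X s *: (K n w - w).
have gE : g n s = bern (K n) n (X s) z.
  have E1 : q n s = bern (K n) n (X s) (w + X s *: (K n w - w)).
    rewrite /q (bernS (K_linear n)); congr bern.
    by rewrite scalerBr scalerBl scale1r addrAC addrA.
  have E2 : p' n s = bern (K n) n (X s) (- (step n)^-1 *: (K n v - v)).
    rewrite /p' (dbernE (K_linear n)) scalerA.
    rewrite -[X in _ = bern _ _ _ X]addr0 (bern_linear (K_linear n)).
    have -> : bern (K n) n (X s) 0 = 0.
      by rewrite -[X in bern _ _ _ X](subrr v) (bernB (K_linear n)) subrr.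
    rewrite addr0; congr (_ *: _).
    by rewrite /step invfM invrK mulNr mulrC.
  rewrite /g E1 E2 /z -[X in X + _]scale1r -(bern_linear (K_linear n)) scale1r; congr bern.
  by rewrite scaleNr addrA [- _ + _]addrC.
rewrite gE.
have hz : `|z| <= 2 * c * step n.
  have [_ h2 h3] := hc _ (ltW st0) stT; have /andP[x0 x1] := x01.
  rewrite /z (le_trans (ler_normD _ _))// -mulrA mulr_natl mulr2n lerD//.
    have -> : w - (step n)^-1 *: (K n v - v) = - ((step n)^-1 *: (K n v - v - step n *: w)).
      by rewrite [in RHS]scalerBr scalerA mulVf ?gt_eqF// scale1r opprB.
    rewrite normrN normrZ gtr0_norm ?invr_gt0// ler_pdivrMl// (le_trans h3)//.
    by rewrite expr2 mulrCA.
  by rewrite normrZ ger0_norm// (le_trans _ h2)// ler_piMl.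
apply: bern_norm => // k kn; rewrite iterK.
have h1 := iter_le (leqW kn).
rewrite (le_trans (adjoint_bound hV hSs C_ge1 hC _ _ _))//; first by rewrite mulr_ge0.
  exact: le_trans h1 tauT.
by rewrite ler_wpM2l.
Qed.

Let g_continuous n : continuous (g n).
Proof. by have [_ h1 h2 _] := ident_p n; move=> s; apply: cvgD; [exact: h1|exact: h2]. Qed.

(** The bound of [lsum_m2_le] on an interval of length [tau], for vectors of norm at most
    [beta * (c * tau)]; this is where the third power arises. *)
Let kap := (1 + T) * Cl * beta ^+ 2 * c ^+ 2 * tau ^+ 3.

Let D_L2 : L2 P D. Proof. exact: (levy_increment_L2 hL hL2). Qed.

(** [D] telescopes over the nodes, so the difference is an [lsum] with the vectors [Bs (p n s - v)],
    small because [p n] stays near [v]. *)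
Let rsum_m2 n M : L2 P (fun x => rsum a b (fun=> 1) (p n) M x - D x) /\
  m2 P (fun x => rsum a b (fun=> 1) (p n) M x - D x) <= kap.
Proof.
have gn := node_grid M a0 (ltW ab); have [gn0 gn1] := gn.
pose u j := Bs (p n (node a b M j) - v).
have lr : L2 P (rsum a b (fun=> 1) (p n) M).
  by apply: L2_sum => j; apply: L2Z; exact: (levy_increment_L2 hL hL2).
have lB := L2B lr D_L2; split => //.
have ll := lsum_L2 hL hL2 M.+1 u gn.
have -> : m2 P (fun x => rsum a b (fun=> 1) (p n) M x - D x) =
    m2 P (lsum L M.+1 (node a b M) u).
  apply: m2_ae; [exact: L2_measurable lB|exact: L2_measurable ll|].
  have h : {ae P, forall x, forall j, (forall t, t = node a b M j \/ t = node a b M j.+1 ->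
      L t (u j) x = L t (Bs (p n (node a b M j))) x - L t (Bs v) x)}.
    apply: ae_forall_nat => j.
    apply: filterS2 (levyB (Bs (p n (node a b M j))) (Bs v) (gn0 j))
      (levyB (Bs (p n (node a b M j))) (Bs v) (gn0 j.+1)) => x h1 h2 t [->|->];
      by rewrite /u BsB.
  apply: filterS h => x hx; rewrite /rsum /lsum.
  have -> : D x = \sum_(j < M.+1) (L (node a b M j.+1) (Bs v) x - L (node a b M j) (Bs v) x).
    rewrite -(big_mkord xpredT (fun j => L (node a b M j.+1) (Bs v) x - L (node a b M j) (Bs v) x)).
    by rewrite telescope_sumr// nodeM node0.
  rewrite -sumrB; apply: eq_bigr => j _.
  rewrite (hx j (node a b M j)); last by left.
  rewrite (hx j (node a b M j.+1)); last by right.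
  by ring.
have [c0 _ _] := sm.
have r0 : 0 <= beta * (c * tau) by rewrite mulr_ge0// mulr_ge0// ltW.
have ub j : (j < M.+1)%N -> `|u j| <= beta * (c * tau).
  move=> jM; rewrite (le_trans (hbeta _))// ler_wpM2l//; apply: p_near.
  by apply: (node_itv (ltW ab)); exact: ltnW.
apply: le_trans (lsum_m2_le hL hL2 Cl0 hCl gn ub r0) _.
rewrite nodeM node0 -/tau.
have -> : kap = tau * ((1 + T) * Cl * (beta * (c * tau)) ^+ 2) by rewrite /kap; ring.
rewrite ler_wpM2l ?(ltW tau0)// ler_wpM2r ?sqr_ge0// ler_wpM2r//.
by rewrite lerD2l.
Qed.

Let Z n x := mild_increment a b v x - II a b (g n) x - D x.

Let aT : 0 <= a <= T. Proof. by rewrite a0 (le_trans (ltW ab)). Qed.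
Let bbT : 0 <= b <= T. Proof. by rewrite b0. Qed.

Let mi_measurable : measurable_fun setT (mild_increment a b v).
Proof. by apply: measurable_funB; exact: Yip_measurable. Qed.

(** First passage to the limit: the mesh tends to 0 while the degree is fixed. *)
Let Z_m2 n : L2 P (Z n) /\ m2 P (Z n) <= kap.
Proof.
apply: (@fatou_cip _ _ _ _ (fun M x => rsum a b (fun=> 1) (p n) M x - D x)).
- have h := ident_endpoint (ident_p n).
  have := cipD h (cip_cst P (fun x => - D x)).
  by rewrite p_b p_a.
- apply: measurable_funB; last exact: L2_measurable D_L2.
  apply: measurable_funB => //.
  exact: (II_measurable  (@g_continuous n) a0 bT).
- by move=> M; have [] := rsum_m2 n M.
- by apply: nearW => M; have [] := rsum_m2 n M.
Qed.

(** Second passage to the limit: the degree tends to infinity, the defect integral vanishes in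
    probability by [small_subinterval], and [kap] depends on neither the mesh nor the degree. *)
Lemma short_interval : L2 P (fun x => mild_increment a b v x - D x) /\
  m2 P (fun x => mild_increment a b v x - D x) <= kap.
Proof.
apply: (@fatou_cip _ _ _ _ Z).
- have h : cip P (fun n => II a b (g n)) (fun=> 0).
    apply: (small_subinterval a0 (ltW ab) bT).
      exact: g_continuous.
    move=> e e0; have [c0 _ _] := sm.
    have cv : (fun n => C * (2 * c * step n)) @ \oo --> 0.
      have -> : (fun n => C * (2 * c * step n)) = (fun n => (C * (2 * c) * tau) * n.+1%:R^-1).
        by apply/funext => n; rewrite /step; ring.
      rewrite -(mulr0 (C * (2 * c) * tau)); apply: cvgM; first exact: cvg_cst.
      exact: cvg_harmonic.
    move/cvgrPdist_lt : cv => /(_ e e0); apply: filterS => n; rewrite sub0r normrN => hn s hs.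
    by rewrite (le_trans (g_small n hs))// (le_trans (ler_norm _))// ltW.
  have := cipD (cip_cst P (fun x => mild_increment a b v x - D x)) (cipZ (-1) h).
  apply: cip_ae => [n|]; apply: aeW => x; last by rewrite mulr0 addr0.
  by rewrite /Z mulN1r addrAC.
- by apply: measurable_funB; [exact: mi_measurable|exact: L2_measurable D_L2].
- by move=> n; have [] := Z_m2 n.
- by apply: nearW => n; have [] := Z_m2 n.
Qed.

End ShortInterval.
End MildIncrements.

(** * Mild increments as limits of sums of Lévy increments *)

Section MildLimits.
Implicit Types (s t r a b c : R) (v w z : V).
Local Notation mild := mild_increment.

(** A Riemann sum for the stochastic convolution tested with [v]. Right endpoints are forced: the
    mild increment over a piece is paired with the adjoint orbit of [v] at the distance from the end
    of that piece to [b]. *)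
Definition mild_sum a b v M :=
  lsum L M.+1 (node a b M) (fun j => Bs (Ss (b - node a b M j.+1) v)).

Let mild_sum_L2 a b v M : 0 <= a -> a <= b -> L2 P (mild_sum a b v M).
Proof. by move=> a0 ab; apply: (lsum_L2 hL hL2); exact: node_grid. Qed.

Let mild_split a b c v x : a <= b -> b <= c ->
  mild a c v x = mild b c v x + mild a b (Ss (c - b) v) x.
Proof.
move=> ab bc; rewrite /mild_increment -(adjointD hV hS hSs) ?subr_ge0//.
by rewrite addrA subrK (_ : b - a + (c - b) = c - a)//; ring.
Qed.

Let mild_telescope a b v M x : 0 <= a -> a <= b ->
  mild a b v x = \sum_(j < M.+1)
    mild (node a b M j) (node a b M j.+1) (Ss (b - node a b M j.+1) v) x.
Proof.
move=> a0 ab; pose G j := ip (Y (node a b M j) x) (Ss (b - node a b M j) v).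
transitivity (\sum_(j < M.+1) (G j.+1 - G j)).
  rewrite -(big_mkord xpredT (fun j => G j.+1 - G j)) telescope_sumr// /G nodeM node0.
  by rewrite subrr (adjoint0 hV hS hSs).
apply: eq_bigr => j _; rewrite /mild_increment -(adjointD hV hS hSs); last 2 first.
- by rewrite subr_ge0 node_le.
- by rewrite subr_ge0; have /andP[] := node_itv ab (ltn_ord j).
by rewrite /G (_ : _ - node a b M j + _ = b - node a b M j)//; ring.
Qed.

(** The mild increment telescopes over the partition. Each of the M + 1 errors is of order (M +
    1)^-3, with constant [C * c] from [smooth_adjoint], and [m2_sum_le] leaves the order 1/(M + 1)
    for the whole. *)
Lemma mild_sum_cvg a b c v w : smooth c v w -> 0 <= a -> a < b -> b <= T ->
  L2 P (mild a b v) /\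
  (fun M => m2 P (fun x => mild_sum a b v M x - mild a b v x)) @ \oo --> 0.
Proof.
move=> sm a0 ab bT; have ab' := ltW ab; split.
  have [l1 _] := short_interval  sm a0 ab bT.
  have := L2D l1 (levy_increment_L2 hL hL2 (Bs v) a0 (le_trans a0 ab')).
  by under eq_fun do rewrite subrK.
pose kap := (1 + T) * Cl * beta ^+ 2 * (C * c) ^+ 2 * (b - a) ^+ 3.
apply: (@squeeze_cvgr _ _ _ _ (fun=> 0) (fun M => kap * M.+1%:R^-1)); last 2 first.
- exact: cvg_cst.
- by rewrite -(mulr0 kap); apply: cvgM; [exact: cvg_cst|exact: cvg_harmonic].
apply: nearW => M; rewrite m2_ge0/=.
have gn := node_grid M a0 ab'.
pose E (j : nat) x := mild (node a b M j) (node a b M j.+1) (Ss (b - node a b M j.+1) v) x -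
  (L (node a b M j.+1) (Bs (Ss (b - node a b M j.+1) v)) x
   - L (node a b M j) (Bs (Ss (b - node a b M j.+1) v)) x).
have hE (j : 'I_M.+1) : L2 P (E j) /\
    m2 P (E j) <= (1 + T) * Cl * beta ^+ 2 * (C * c) ^+ 2 * ((b - a) / M.+1%:R) ^+ 3.
  have /andP[h1 h2] := node_itv ab' (ltn_ord j : (j.+1 <= M.+1)%N).
  have r0 : 0 <= b - node a b M j.+1 by rewrite subr_ge0.
  have rT : b - node a b M j.+1 <= T.
    by rewrite lerBlDr (le_trans bT)// lerDl (le_trans a0).
  have sm' := smooth_adjoint hV hS hA hSs C_ge1 hC sm r0 rT.
  have lt : node a b M j < node a b M j.+1.
    by rewrite -subr_gt0 node_step divr_gt0// subr_gt0.
  have [gn0 _] := gn.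
  have := short_interval  sm' (gn0 j) lt (le_trans h2 bT).
  by rewrite node_step.
have -> : m2 P (fun x => mild_sum a b v M x - mild a b v x) =
    m2 P (fun x => \sum_(j < M.+1) E j x).
  congr EX; apply/funext => x; rewrite (mild_telescope v M x a0 ab') -sqrrN opprB.
  by rewrite /mild_sum /lsum -sumrB.
apply: le_trans (m2_sum_le (fun j => (hE j).1)) _.
apply: (@le_trans _ _ (M.+1%:R * \sum_(j < M.+1) ((1 + T) * Cl * beta ^+ 2 * (C * c) ^+ 2 * ((b - a) / M.+1%:R) ^+ 3))).
  by rewrite ler_wpM2l//; apply: ler_sum => j _; exact: (hE j).2.
rewrite sumr_const card_ord -[X in _ * X]mulr_natl le_eqVlt; apply/orP; left; apply/eqP.
by rewrite /kap; field; rewrite nat1r pnatr_eq0.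
Qed.

Section SmoothVector.
Variables (c : R) (v w : V).
Hypothesis sm : smooth c v w.

Let mild_sum_shift a b M : 0 <= a -> a <= b ->
  EX P (mild_sum a b v M) = EX P (mild_sum 0 (b - a) v M) /\
  vari P (mild_sum a b v M) = vari P (mild_sum 0 (b - a) v M).
Proof.
move=> a0 ab; have g1 := node_grid M a0 ab.
have ba : 0 <= b - a by rewrite subr_ge0.
have g2 := node_grid M (lexx 0) ba.
rewrite /mild_sum (lsum_EX hL hL2 _ _ g1) (lsum_EX hL hL2 _ _ g2).
rewrite (lsum_vari hL hL2 _ _ g1) (lsum_vari hL hL2 _ _ g2).
have E j : b - node a b M j = b - a - node 0 (b - a) M j.
  by rewrite /node subr0 add0r; ring.
by split; apply: eq_bigr => j _; rewrite E !node_step subr0.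
Qed.

Lemma mild_shift_smooth a b : 0 <= a -> a < b -> b <= T ->
  EX P (mild a b v) = EX P (mild 0 (b - a) v) /\
  vari P (mild a b v) = vari P (mild 0 (b - a) v).
Proof.
move=> a0 ab bT; have ab' := ltW ab.
have ba : 0 < b - a by rewrite subr_gt0.
have baT : b - a <= T by rewrite lerBlDr (le_trans bT)// lerDl.
have [l1 c1] := mild_sum_cvg sm a0 ab bT.
have [l2 c2] := mild_sum_cvg sm (lexx 0) ba baT.
have L1' M := mild_sum_L2 v M a0 ab'.
have L2' M := mild_sum_L2 v M (lexx 0) (ltW ba).
split.
  apply: (cvg_unique (@Rhausdorff R) (cvg_EX L1' l1 c1)).
  rewrite (_ : (fun n => _) = fun M => EX P (mild_sum 0 (b - a) v M)); first exact: cvg_EX.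
  by apply/funext => M; have [] := mild_sum_shift M a0 ab'.
apply: (cvg_unique (@Rhausdorff R) (cvg_vari L1' l1 c1)).
rewrite (_ : (fun n => _) = fun M => vari P (mild_sum 0 (b - a) v M)); first exact: cvg_vari.
by apply/funext => M; have [] := mild_sum_shift M a0 ab'.
Qed.

(** The approximating sums over [0, s] and [s, t] use disjoint increments and are uncorrelated; the
    additivity of their variances passes to the limit. *)
Lemma mild_vari_split s t : 0 < s -> s < t -> t <= T ->
  vari P (mild 0 t v) = vari P (mild 0 s (Ss (t - s) v)) + vari P (mild s t v).
Proof.
move=> s0 st tT; have s0' := ltW s0; have st' := ltW st.
have ts0 : 0 <= t - s by rewrite subr_ge0.
have tsT : t - s <= T by rewrite lerBlDr (le_trans tT)// lerDl.
have sm' := smooth_adjoint hV hS hA hSs C_ge1 hC sm ts0 tsT.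
have [l1 c1] := mild_sum_cvg sm' (lexx 0) s0 (le_trans st' tT).
have [l2 c2] := mild_sum_cvg sm s0' st tT.
have L1' M := mild_sum_L2 (Ss (t - s) v) M (lexx 0) s0'.
have L2' M := mild_sum_L2 v M s0' st'.
have -> : mild 0 t v = fun x => mild 0 s (Ss (t - s) v) x + mild s t v x.
  by apply/funext => x; rewrite (mild_split v x s0' st') addrC.
have cs : (fun M => m2 P (fun x => (mild_sum 0 s (Ss (t - s) v) M x + mild_sum s t v M x) -
    (mild 0 s (Ss (t - s) v) x + mild s t v x))) @ \oo --> 0.
  apply: (@squeeze_cvgr _ _ _ _ (fun=> 0) (fun M =>
    2 * m2 P (fun x => mild_sum 0 s (Ss (t - s) v) M x - mild 0 s (Ss (t - s) v) x) +
    2 * m2 P (fun x => mild_sum s t v M x - mild s t v x))); last 2 first.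
  - exact: cvg_cst.
  - have -> : nbhs (0 : R) = nbhs (2 * 0 + 2 * 0 : R) by rewrite !mulr0 addr0.
    by apply: cvgD; apply: cvgM => //; exact: cvg_cst.
  apply: nearW => M; rewrite m2_ge0/=.
  apply: le_trans (m2D_le (L2B (L1' M) l1) (L2B (L2' M) l2)).
  rewrite le_eqVlt; apply/orP; left; apply/eqP; congr EX; apply/funext => x.
  by rewrite opprD addrACA.
have h := cvg_vari (fun M => L2D (L1' M) (L2' M)) (L2D l1 l2) cs.
apply: (cvg_unique (@Rhausdorff R) h).
have -> : (fun M => vari P (fun x => mild_sum 0 s (Ss (t - s) v) M x + mild_sum s t v M x)) =
   (fun M => vari P (mild_sum 0 s (Ss (t - s) v) M) + vari P (mild_sum s t v M)).
  apply/funext => M; apply: (lsumD_vari hL hL2); [exact: node_grid|exact: node_grid|].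
  by rewrite nodeM node0.
by apply: cvgD; exact: cvg_vari.
Qed.

Let mild_bound_terms a b M : 0 <= a -> a <= b -> b <= T -> forall j, (j < M.+1)%N ->
  `|Bs (Ss (b - node a b M j.+1) v)| <= beta * (C * `|v|).
Proof.
move=> a0 ab bT j jM; have /andP[h1 h2] := node_itv ab (jM : (j.+1 <= M.+1)%N).
rewrite (le_trans (hbeta _))// ler_wpM2l// (adjoint_bound hV hSs C_ge1 hC)//.
  by rewrite subr_ge0.
by rewrite lerBlDr (le_trans bT)// lerDl (le_trans a0).
Qed.

Let mild_sum_mean_le a b M : 0 <= a -> a <= b -> b <= T ->
  `|EX P (mild_sum a b v M)| <= (b - a) * (Num.sqrt Cl * (beta * (C * `|v|))).
Proof.
move=> a0 ab bT; have r0 : 0 <= beta * (C * `|v|) by rewrite !mulr_ge0.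
have gn := node_grid M a0 ab.
have := @lsum_EX_le _ _ _ P _ L hL hL2 Cl Cl0 hCl M.+1 (node a b M)
  (fun j => Bs (Ss (b - node a b M j.+1) v)) _ gn (mild_bound_terms a0 ab bT) r0.
by rewrite nodeM node0.
Qed.

Let mild_sum_m2_le a b M : 0 <= a -> a <= b -> b <= T ->
  m2 P (mild_sum a b v M) <= (b - a) * ((1 + T) * Cl * (beta * (C * `|v|)) ^+ 2).
Proof.
move=> a0 ab bT; have r0 : 0 <= beta * (C * `|v|) by rewrite !mulr_ge0.
have gn := node_grid M a0 ab.
have := @lsum_m2_le _ _ _ P _ L hL hL2 Cl Cl0 hCl M.+1 (node a b M)
  (fun j => Bs (Ss (b - node a b M j.+1) v)) _ gn (mild_bound_terms a0 ab bT) r0.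
rewrite nodeM node0 => /le_trans; apply.
rewrite ler_wpM2l ?subr_ge0// ler_wpM2r ?sqr_ge0// ler_wpM2r// lerD2l.
by rewrite lerBlDr (le_trans bT)// lerDl.
Qed.

Lemma mild_mean_bound_smooth a b : 0 <= a -> a < b -> b <= T ->
  `|EX P (mild a b v)| <= (b - a) * (Num.sqrt Cl * (beta * (C * `|v|))).
Proof.
move=> a0 ab bT; have ab' := ltW ab; have [l1 c1] := mild_sum_cvg sm a0 ab bT.
have cv := cvg_EX (fun M => mild_sum_L2 v M a0 ab') l1 c1.
have {}cv : (fun M => `|EX P (mild_sum a b v M)|) @ \oo --> `|EX P (mild a b v)|.
  by apply: cvg_norm.
rewrite -(cvg_lim (@Rhausdorff R) cv); apply: limr_le; first exact: (cvgP _ cv).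
by apply: nearW => M; exact: mild_sum_mean_le.
Qed.

Lemma mild_m2_bound_smooth a b : 0 <= a -> a < b -> b <= T ->
  m2 P (mild a b v) <= (b - a) * ((1 + T) * Cl * (beta * (C * `|v|)) ^+ 2).
Proof.
move=> a0 ab bT; have ab' := ltW ab; have [l1 c1] := mild_sum_cvg sm a0 ab bT.
have cv := cvg_m2 (fun M => mild_sum_L2 v M a0 ab') l1 c1.
rewrite -(cvg_lim (@Rhausdorff R) cv); apply: limr_le; first exact: (cvgP _ cv).
by apply: nearW => M; exact: mild_sum_m2_le.
Qed.

End SmoothVector.
End MildLimits.

Hypothesis hY2 : forall t : R, 0 <= t <= T -> (\int[P]_x (`|Y t x| ^+ 2)%:E < +oo)%E.
Variable J : R -> V -> V.
Hypothesis hJ : forall t : R, 0 <= t -> forall x y,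
  ip x (J t y) = prim (fun s => ip (traj S x s) y) t.
Local Notation rv2 := (rv2 P ip).
Local Notation E2 := (E2 P).

(** * From scalar moments to mean square continuity *)

Section MeanSquareContinuity.
Implicit Types (s t r a b c h : R) (v w z : V) (e : nat -> V).
Local Notation mild := mild_increment.

Definition mild_vector a b x := Y b x - S (b - a) (Y a x).

Lemma mild_vectorE a b v x : a <= b -> ip (mild_vector a b x) v = mild a b v x.
Proof. by move=> ab; rewrite /mild_vector (ipBl hV) hSs// subr_ge0. Qed.

Lemma rv2_Y t : 0 <= t <= T -> rv2 (Y t).
Proof.
by move=> tT; split; [move=> v; exact: Yip_measurable|exact: hY2].
Qed.

Lemma rv2_semigroup t Z : 0 <= t <= T -> rv2 Z -> rv2 (fun x => S t (Z x)).
Proof.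
by move=> /andP[t0 tT]; apply: (rv2_map hV (hSs t0)) => x; exact: hC.
Qed.

Lemma rv2N Z : rv2 Z -> rv2 (fun x => - Z x).
Proof.
apply: (@rv2_map _ _ _ P _ _ hV -%R -%R 1) => [x y|x].
  by rewrite (ipNl hV) (ipNr hV).
by rewrite normrN mul1r.
Qed.

Lemma rv2B Z1 Z2 : rv2 Z1 -> rv2 Z2 -> rv2 (fun x => Z1 x - Z2 x).
Proof. by move=> r1 r2; exact: (rv2D hV r1 (rv2N r2)). Qed.

Lemma rv2_mild a b : 0 <= a -> a <= b -> b <= T -> rv2 (mild_vector a b).
Proof.
move=> a0 ab bT; have b0 := le_trans a0 ab.
apply: rv2B; first by apply: rv2_Y; rewrite b0.
apply: rv2_semigroup; first by rewrite subr_ge0 ab lerBlDr (le_trans bT)// lerDl.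
by apply: rv2_Y; rewrite a0 (le_trans ab).
Qed.

Lemma mild_vector_diag a x : mild_vector a a x = 0.
Proof. by rewrite /mild_vector subrr (semigroup0 hS) subrr. Qed.

Let mean a b v := EX P (fun x => ip (mild_vector a b x) v).
Let second a b v := m2 P (fun x => ip (mild_vector a b x) v).
Let variance a b v := vari P (fun x => ip (mild_vector a b x) v).

Let second_variance a b v : 0 <= a -> a <= b -> b <= T ->
  second a b v = variance a b v + mean a b v ^+ 2.
Proof. by move=> a0 ab bT; apply: m2_vari; exact: (rv2_ip hV v (rv2_mild a0 ab bT)). Qed.

Let moments_smooth a b v : a <= b -> [/\ mean a b v = EX P (mild a b v),
  second a b v = m2 P (mild a b v) & variance a b v = vari P (mild a b v)].
Proof.
move=> ab; have -> : mild a b v = (fun x => ip (mild_vector a b x) v).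
  by apply/funext => x; rewrite mild_vectorE.
by [].
Qed.

(** Carries the moment relations from smooth vectors to all vectors. One sequence serves every
    interval, so relations between two intervals pass to the limit as well. *)
Let moments_limit v0 : exists vs : nat -> V, (forall n, exists c w, smooth c (vs n) w) /\
  (forall n, `|vs n| <= C ^+ 2 * `|v0|) /\
  forall a b, 0 <= a -> a <= b -> b <= T ->
    [/\ (fun n => mean a b (vs n)) @ \oo --> mean a b v0,
        (fun n => second a b (vs n)) @ \oo --> second a b v0 &
        (fun n => variance a b (vs n)) @ \oo --> variance a b v0].
Proof.
have [vs [ws [h1 h2 h3]]] := smooth_weakly_dense hV hS hA hSs hJ C_ge1 hC v0 T0.
exists vs; split; first by move=> n; have [c hc] := h1 n; exists c, (ws n).
split => // a b a0 ab bT.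
have [c1 c2] := weak_cvg_moments hV (rv2_mild a0 ab bT) h3 h2.
split => //.
have vE v : variance a b v = second a b v - mean a b v * mean a b v.
  by rewrite second_variance// addrK.
rewrite vE (_ : (fun n => _) = fun n => second a b (vs n) - mean a b (vs n) * mean a b (vs n)).
  by apply: cvgB => //; apply: cvgM.
by apply/funext => n.
Qed.

Let shift a b v : 0 <= a -> a <= b -> b <= T ->
  mean a b v = mean 0 (b - a) v /\ second a b v = second 0 (b - a) v.
Proof.
move=> a0 ab bT.
have ba0 : 0 <= b - a by rewrite subr_ge0.
have baT : b - a <= T by rewrite lerBlDr (le_trans bT)// lerDl.
have [->|ne] := eqVneq a b.
  rewrite subrr /mean /second.
  by split; [congr EX|congr m2]; apply/funext => x; rewrite !mild_vector_diag.
have ab' : a < b by rewrite lt_neqAle ne.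
have [vs [sm [_ lim]]] := moments_limit v.
have [m1 s1 _] := lim a b a0 ab bT; have [m2' s2 _] := lim 0 (b - a) (lexx 0) ba0 baT.
have hsm n : mean a b (vs n) = mean 0 (b - a) (vs n) /\
    second a b (vs n) = second 0 (b - a) (vs n).
  have [c [w hc]] := sm n.
  have [e1 v1] := mild_shift_smooth  hc a0 ab' bT.
  rewrite (second_variance _ a0 ab bT) (second_variance _ (lexx 0) ba0 baT).
  have [-> _ ->] := moments_smooth (vs n) ab; have [-> _ ->] := moments_smooth (vs n) ba0.
  by split; [exact: e1|rewrite v1 e1].
split.
  apply: (cvg_unique (@Rhausdorff R) m1).
  rewrite (_ : (fun n => _) = fun n => mean 0 (b - a) (vs n))//.
  by apply/funext => n; have [] := hsm n.
apply: (cvg_unique (@Rhausdorff R) s1).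
rewrite (_ : (fun n => _) = fun n => second 0 (b - a) (vs n))//.
by apply/funext => n; have [] := hsm n.
Qed.

Let variance_ge0 a b v : 0 <= variance a b v. Proof. exact: vari_ge0. Qed.

Let variance_diag a v : variance a a v = 0.
Proof.
rewrite /variance (_ : (fun x => ip (mild_vector a a x) v) = fun=> 0).
  by rewrite /vari /m2 !EX_cst subrr expr0n.
by apply/funext => x; rewrite mild_vector_diag (ip0l hV).
Qed.

(** The split is made at [t - s], not at [s]: the piece over [t - s, t] is tested with [v] itself
    and has the variance of the one over [0, s], by stationarity; the rest is nonnegative. *)
Let variance_mono s t v : 0 <= s -> s <= t -> t <= T -> variance 0 s v <= variance 0 t v.
Proof.
move=> s0 st tT; have t0 := le_trans s0 st.
have [<-|s_ne] := eqVneq 0 s; first by rewrite variance_diag.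
have [<-//|st_ne] := eqVneq s t.
have sp : 0 < s by rewrite lt_neqAle s_ne.
have st' : s < t by rewrite lt_neqAle st_ne.
have [vs [sm [_ lim]]] := moments_limit v.
have [_ _ v1] := lim 0 s (lexx 0) s0 (le_trans st tT).
have [_ _ v2] := lim 0 t (lexx 0) t0 tT.
apply: (ler_cvg_to v1 v2); apply: nearW => n; have [c [w hc]] := sm n.
have [_ _ ->] := moments_smooth (vs n) s0; have [_ _ ->] := moments_smooth (vs n) t0.
have ts0 : 0 < t - s by rewrite subr_gt0.
have tst : t - s < t by rewrite ltrBlDr ltrDl.
rewrite (mild_vari_split  hc ts0 tst tT).
have [_ ->] := mild_shift_smooth  hc (ltW ts0) tst tT.
by rewrite subKr lerDr vari_ge0.
Qed.

(** One factor [C] bounds the adjoint semigroup; [C ^+ 2] is the price of approximating a vector by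
    smooth ones. *)
Let kmean := Num.sqrt Cl * (beta * (C * C ^+ 2)).
Let ksecond := (1 + T) * Cl * (beta * (C * C ^+ 2)) ^+ 2.

Let kmean0 : 0 <= kmean.
Proof. by rewrite /kmean !mulr_ge0 ?sqrtr_ge0// sqr_ge0. Qed.

Let ksecond0 : 0 <= ksecond.
Proof. by rewrite /ksecond !mulr_ge0 ?sqr_ge0// addr_ge0// ltW. Qed.

Let mean_bound h v : 0 <= h -> h <= T -> `|mean 0 h v| <= h * kmean * `|v|.
Proof.
move=> h0 hT; have [<-|h_ne] := eqVneq 0 h.
  rewrite !mul0r /mean (_ : (fun x => _) = fun=> 0) ?EX_cst ?normr0//.
  by apply/funext => x; rewrite mild_vector_diag (ip0l hV).
have hp : 0 < h by rewrite lt_neqAle h_ne.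
have [vs [sm [vb lim]]] := moments_limit v.
have [m1 _ _] := lim 0 h (lexx 0) h0 hT.
have m1' : (fun n => `|mean 0 h (vs n)|) @ \oo --> `|mean 0 h v| by apply: cvg_norm.
rewrite -(cvg_lim (@Rhausdorff R) m1'); apply: limr_le; first exact: (cvgP _ m1').
apply: nearW => n; have [c [w hc]] := sm n; have [-> _ _] := moments_smooth (vs n) h0.
have := mild_mean_bound_smooth  hc (lexx 0) hp hT.
rewrite subr0 => /le_trans; apply.
have -> : h * kmean * `|v| = h * (Num.sqrt Cl * (beta * (C * (C ^+ 2 * `|v|)))).
  by rewrite /kmean; ring.
by rewrite !ler_wpM2l ?sqrtr_ge0.
Qed.

Let second_bound h v : 0 <= h -> h <= T -> second 0 h v <= h * (ksecond * `|v| ^+ 2).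
Proof.
move=> h0 hT; have [<-|h_ne] := eqVneq 0 h.
  rewrite !mul0r /second (_ : (fun x => _) = fun=> 0) ?/m2 ?expr0n ?EX_cst//.
  by apply/funext => x; rewrite mild_vector_diag (ip0l hV).
have hp : 0 < h by rewrite lt_neqAle h_ne.
have [vs [sm [vb lim]]] := moments_limit v.
have [_ s1 _] := lim 0 h (lexx 0) h0 hT.
rewrite -(cvg_lim (@Rhausdorff R) s1); apply: limr_le; first exact: (cvgP _ s1).
apply: nearW => n; have [c [w hc]] := sm n; have [_ -> _] := moments_smooth (vs n) h0.
have := mild_m2_bound_smooth  hc (lexx 0) hp hT.
rewrite subr0 => /le_trans; apply.
have -> : h * (ksecond * `|v| ^+ 2) = h * ((1 + T) * Cl * (beta * (C * (C ^+ 2 * `|v|))) ^+ 2).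
  by rewrite /ksecond; ring.
rewrite ler_wpM2l// ler_wpM2l//; first by rewrite mulr_ge0// addr_ge0// ltW.
by rewrite lerXn2r ?nnegrE ?mulr_ge0 ?sqr_ge0// !ler_wpM2l.
Qed.

Let mean_linear h : 0 <= h -> h <= T -> linear_functional (mean 0 h).
Proof.
move=> h0 hT k v w; have r := rv2_mild (lexx 0) h0 hT.
have i1 := L2_Int (rv2_ip hV v r); have i2 := L2_Int (rv2_ip hV w r).
rewrite /mean -(EXZ _ i1) -EXD//; last exact: IntZ.
by congr EX; apply/funext => x; rewrite (ipDr hV) (ipZr hV).
Qed.

(** Removing the last piece, over [t - s, t], leaves the mild increment over [0, t - s] tested with
    [Ss s v]; the removed piece has mean [mean 0 s v] by stationarity. *)
Let mean_diff s t v : 0 <= s -> s <= t -> t <= T ->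
  mean 0 t v - mean 0 s v = mean 0 (t - s) (Ss s v).
Proof.
move=> s0 st tT; have t0 := le_trans s0 st.
have ts0 : 0 <= t - s by rewrite subr_ge0.
have tst : t - s <= t by rewrite lerBlDr lerDl.
have [e1 _] := shift v ts0 tst tT; rewrite subKr in e1.
rewrite -e1 /mean -EXB; last 2 first.
- exact: L2_Int (rv2_ip hV v (rv2_mild (lexx 0) t0 tT)).
- exact: L2_Int (rv2_ip hV v (rv2_mild ts0 tst tT)).
congr EX; apply/funext => x; rewrite !mild_vectorE// /mild_increment !subr0 subKr.
by rewrite -(adjointD hV hS hSs)// subrK; ring.
Qed.

Lemma E2_mild_shift a b : 0 <= a -> a <= b -> b <= T ->
  E2 (mild_vector a b) = E2 (mild_vector 0 (b - a)).
Proof.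
move=> a0 ab bT; have [e [e1 _ _]] := exists_parseval_basis hV.
have ba0 : 0 <= b - a by rewrite subr_ge0.
have baT : b - a <= T by rewrite lerBlDr (le_trans bT)// lerDl.
apply: (cvg_unique (@Rhausdorff R) (E2_parseval hV e1 (rv2_mild a0 ab bT))).
rewrite (_ : (fun n => _) = fun n => \sum_(i < n) second 0 (b - a) (e i)).
  exact: (E2_parseval hV e1 (rv2_mild (lexx 0) ba0 baT)).
by apply/funext => n; apply: eq_bigr => i _; have [_ <-] := shift (e i) a0 ab bT.
Qed.

(* The tail of [\sum_n m2 <X_h, e_n>] is controlled by that of [X_T] for the
   variances, and by Bessel's inequality for the squared means. *)
Lemma E2_mild_small (eps : R) : 0 < eps -> exists2 delta, 0 < delta &
  forall h, 0 <= h -> h <= T -> h <= delta -> E2 (mild_vector 0 h) <= eps.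
Proof.
move=> eps0; have [e [e1 _ e3]] := exists_parseval_basis hV.
have TT : 0 <= T by exact: ltW.
have rT := rv2_mild (lexx 0) TT (lexx T).
have e30 : 0 < eps / 3 by rewrite divr_gt0.
have [N _ hN] := (@cvgrPdist_le _ _ _ _ _ _ _).1 (E2_parseval hV e1 rT) _ e30.
have {}hN := hN N (leqnn N).
pose G := \sum_(i < N) (ksecond * `|e i| ^+ 2).
have G0 : 0 <= G by apply: sumr_ge0 => i _; rewrite mulr_ge0// sqr_ge0.
(* [eps] is shared by the first [N] coordinates, the tail of the series at [T] and the squared
   means. [G] serves the first share, [kmean ^+ 2 * T] the third, and 1 keeps the denominator
   positive. *)
pose D := eps / 3 / (1 + G + kmean ^+ 2 * T).
have D0 : 0 < 1 + G + kmean ^+ 2 * T.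
  by rewrite -addrA ltr_pwDl// addr_ge0// mulr_ge0// sqr_ge0.
exists D; first by rewrite divr_gt0.
move=> h h0 hT hD; have rh := rv2_mild (lexx 0) h0 hT.
have hsmall1 : h * (1 + G + kmean ^+ 2 * T) <= eps / 3 by rewrite -ler_pdivlMr.
have h1 : h * G <= eps / 3.
  apply: le_trans hsmall1; rewrite ler_wpM2l//.
  by rewrite -subr_ge0 [X in 0 <= X](_ : _ = 1 + kmean ^+ 2 * T); [rewrite addr_ge0// mulr_ge0// sqr_ge0|ring].
have h2 : (h * kmean) ^+ 2 <= eps / 3.
  apply: (@le_trans _ _ (h * (kmean ^+ 2 * T))).
    by rewrite exprMn expr2 -mulrA ler_wpM2l// mulrC ler_wpM2l// sqr_ge0.
  apply: le_trans hsmall1; rewrite ler_wpM2l//.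
  by rewrite -subr_ge0 [X in 0 <= X](_ : _ = 1 + G); [rewrite addr_ge0|ring].
apply: (E2_le_of_sums hV e1 rh) => n.
(* Taking [N + n] terms instead of [n] lets the sum be cut at [N] whatever [n] is. *)
apply: (@le_trans _ _ (\sum_(i < N + n) second 0 h (e i))).
  rewrite addnC big_split_ord/= lerDl; apply: sumr_ge0 => i _; exact: m2_ge0.
rewrite big_split_ord/=.
have -> : eps = eps / 3 + (eps / 3 + eps / 3) by field.
apply: lerD.
  apply: le_trans h1; rewrite mulr_sumr; apply: ler_sum => i _.
  exact: second_bound.
apply: (@le_trans _ _ (\sum_(i < n) (second 0 T (e (N + i)%N) + mean 0 h (e (N + i)%N) ^+ 2))).
  apply: ler_sum => i _; rewrite second_variance// lerD2r.
  rewrite (le_trans (variance_mono _ h0 hT (lexx T)))// second_variance// lerDl.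
  exact: sqr_ge0.
rewrite big_split/=; apply: lerD.
  have := m2_sum_le_E2 hV (N + n) e1 rT; rewrite big_split_ord/=.
  by move: hN; rewrite ler_norml => /andP[_]; lra.
apply: le_trans h2; have b0 : 0 <= h * kmean by rewrite mulr_ge0.
have := bessel_functional e3 (mean_linear h0 hT) b0 (fun v => mean_bound v h0 hT) (N + n).
rewrite big_split_ord/= => /(le_trans _); apply.
by rewrite lerDr; apply: sumr_ge0 => i _; exact: sqr_ge0.
Qed.

(** Dominated convergence along a sequence of bad [h] tending to 0, with majorant [(C + 1) ^+ 2]
    times the squared norm of [Z]. The vector [Z] must stay fixed, which is the difficulty that
    [E2_left_increment] removes. *)
Lemma E2_semigroup_small Z (eps : R) : rv2 Z -> 0 < eps -> exists2 delta, 0 < delta &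
  forall h, 0 <= h -> h <= T -> h <= delta -> E2 (fun x => S h (Z x) - Z x) <= eps.
Proof.
move=> rZ eps0; apply: contrapT => H.
have /choice[hs hhs] : forall n : nat, exists h, [/\ 0 <= h, h <= T, h <= n.+1%:R^-1 &
    eps < E2 (fun x => S h (Z x) - Z x)].
  move=> n; apply: contrapT => H2; apply: H; exists n.+1%:R^-1; first by [].
  move=> h h0 hT hn; rewrite leNgt; apply/negP => hh; apply: H2; exists h; split => //.
have cv : (fun n => E2 (fun x => S (hs n) (Z x) - Z x)) @ \oo --> EX P (fun=> 0 : R).
  apply: (@EX_dominated _ _ _ _ _ _ (fun x => (C + 1) ^+ 2 * `|Z x| ^+ 2)).
  - move=> n; have [h1 h2 _ _] := hhs n.
    have r : rv2 (fun x => S (hs n) (Z x) - Z x).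
      by apply: rv2B => //; apply: rv2_semigroup => //; rewrite h1.
    by apply: (sqr_norm_measurable hV); case: r.
  - by apply: IntZ; exact: (rv2_Int hV rZ).
  - move=> x; have -> : nbhs (0 : R) = nbhs ((0 : R) * 0) by rewrite mulr0.
    under eq_fun do rewrite expr2.
    suff h : (fun n => `|S (hs n) (Z x) - Z x|) @ \oo --> (0 : R) by apply: cvgM.
    apply/cvgrPdist_lt => e e0; have [dl dl0 hdl] := semigroup_near0 hS (Z x) e0.
    near=> n; rewrite sub0r normrN normr_id; have [h1 _ h3 _] := hhs n.
    apply: hdl => //; apply: (le_lt_trans h3); near: n.
    exact: near_infty_natSinv_lt (PosNum dl0).
  - move=> n x; have [h1 h2 _ _] := hhs n.
    rewrite ger0_norm ?sqr_ge0// -exprMn lerXn2r ?nnegrE ?mulr_ge0 ?addr_ge0//.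
    by rewrite (le_trans (ler_normB _ _))// mulrDl mul1r lerD2r hC.
rewrite EX_cst in cv.
have [N _ hN] := (@cvgrPdist_lt _ _ _ _ _ _ _).1 cv _ eps0.
have := hN N (leqnn N); rewrite /= sub0r normrN ger0_norm ?E2_ge0// => hlt.
by have [_ _ _ /(lt_trans hlt)] := hhs N; rewrite ltxx.
Unshelve. all: by end_near. Qed.

(** The operator moves to the test vectors as [u]. The variances at [s] are then dominated by those
    at [t], while the means differ by the functional [g] of norm proportional to [t - s], whose
    squares are summed by Bessel's inequality. Dominated convergence is thus needed at the fixed
    time [t] only. *)
Lemma E2_left_increment s t h : 0 <= s -> s <= t -> t <= T -> 0 <= h -> h <= T ->
  E2 (fun x => S h (mild_vector 0 s x) - mild_vector 0 s x) <=
  2 * E2 (fun x => S h (mild_vector 0 t x) - mild_vector 0 t x)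
  + 2 * ((t - s) * kmean * (C * (C + 1))) ^+ 2.
Proof.
move=> s0 st tT h0 hT; have t0 := le_trans s0 st; have sT := le_trans st tT.
have [e [e1 _ e3]] := exists_parseval_basis hV.
have ts0 : 0 <= t - s by rewrite subr_ge0.
have tsT : t - s <= T by rewrite lerBlDr (le_trans tT)// lerDl.
have rs := rv2_mild (lexx 0) s0 sT; have rt := rv2_mild (lexx 0) t0 tT.
have h0T : 0 <= h <= T by rewrite h0.
have rs' := rv2B (rv2_semigroup h0T rs) rs; have rt' := rv2B (rv2_semigroup h0T rt) rt.
pose u v := Ss h v - v.
have uE a b v : (fun x => ip (S h (mild_vector a b x) - mild_vector a b x) v) =
    (fun x => ip (mild_vector a b x) (u v)).
  by apply/funext => x; rewrite (ipBl hV) (ipBr hV) hSs.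
pose g v := mean 0 (t - s) (Ss s (u v)).
have glin : linear_functional g.
  move=> k v w; rewrite /g -(mean_linear ts0 tsT) -(adjoint_linear hV hSs)//; congr (mean _ _ (Ss _ _)).
  by rewrite /u (adjoint_linear hV hSs)// scalerBr opprD addrACA.
have gb v : `|g v| <= (t - s) * kmean * (C * (C + 1)) * `|v|.
  rewrite (le_trans (mean_bound _ ts0 tsT))// -[leRHS]mulrA ler_wpM2l ?mulr_ge0//.
  rewrite (le_trans (adjoint_bound hV hSs C_ge1 hC _ s0 sT))// -mulrA ler_wpM2l//.
  rewrite (le_trans (ler_normB _ _))// mulrDl mul1r lerD2r.
  exact: (adjoint_bound hV hSs C_ge1 hC).
have g0 : 0 <= (t - s) * kmean * (C * (C + 1)) by rewrite !mulr_ge0// addr_ge0.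
(* [p] and [q] stand for the variances at [s] and [t], [m] for the mean at [t], [k] for the value of
   [g]; the proof is the parallelogram identity. *)
have elem (p q m k : R) : p <= q -> 0 <= q ->
    p + (m - k) ^+ 2 <= 2 * (q + m ^+ 2) + 2 * k ^+ 2.
  move=> pq q0; rewrite -subr_ge0.
  have -> : 2 * (q + m ^+ 2) + 2 * k ^+ 2 - (p + (m - k) ^+ 2) = (q - p) + q + (m + k) ^+ 2.
    by ring.
  by rewrite addr_ge0 ?sqr_ge0// addr_ge0 ?subr_ge0.
apply: (E2_le_of_sums hV e1 rs') => n.
apply: (@le_trans _ _ (\sum_(i < n) (2 * second 0 t (u (e i)) + 2 * g (e i) ^+ 2))).
  apply: ler_sum => i _; rewrite uE -/(second 0 s (u (e i))) !second_variance//.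
  have h1 := variance_mono (u (e i)) s0 st tT; have h2 := variance_ge0 0 t (u (e i)).
  have h3 := mean_diff (u (e i)) s0 st tT; rewrite -/(g (e i)) in h3.
  have -> : mean 0 s (u (e i)) = mean 0 t (u (e i)) - g (e i) by rewrite -h3; ring.
  exact: elem.
rewrite big_split/= -!mulr_sumr lerD// ler_wpM2l//.
  have := m2_sum_le_E2 hV n e1 rt'; apply: le_trans; rewrite le_eqVlt; apply/orP; left.
  by apply/eqP; apply: eq_bigr => i _; rewrite uE.
exact: (bessel_functional e3 glin g0 gb).
Qed.

Let rv2S h Z : 0 <= h -> h <= T -> rv2 Z -> rv2 (fun x => S h (Z x) - Z x).
Proof.
move=> h0 hT rZ; apply: rv2B => //.
by apply: (rv2_semigroup) => //; rewrite h0.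
Qed.

Lemma increment_right s t : 0 <= t -> t <= s -> s <= T ->
  E2 (fun x => Y s x - Y t x) <=
  2 * E2 (mild_vector 0 (s - t)) + 2 * E2 (fun x => S (s - t) (Y t x) - Y t x).
Proof.
move=> t0 ts sT; have h0 : 0 <= s - t by rewrite subr_ge0.
have hT : s - t <= T by rewrite lerBlDr (le_trans sT)// lerDl.
have tT : 0 <= t <= T by rewrite t0 (le_trans ts).
rewrite -(E2_mild_shift t0 ts sT).
apply: le_trans (E2D_le hV (rv2_mild t0 ts sT) (rv2S h0 hT (rv2_Y tT))).
rewrite le_eqVlt; apply/orP; left; apply/eqP; congr EX; apply/funext => x.
by rewrite /mild_vector addrA subrK.
Qed.

(** Here the earlier time varies, so [Y s] is decomposed into [mild_vector 0 s] and [S s (Y 0)]. The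
    semigroup law lets [S s] act last on the second part, which reduces it to the fixed vector
    [Y 0]. *)
Lemma increment_left s t : 0 <= s -> s <= t -> t <= T ->
  E2 (fun x => Y s x - Y t x) <= 2 * E2 (mild_vector 0 (t - s)) +
    2 * (2 * E2 (fun x => S (t - s) (mild_vector 0 s x) - mild_vector 0 s x) +
         2 * (C ^+ 2 * E2 (fun x => S (t - s) (Y 0 x) - Y 0 x))).
Proof.
move=> s0 st tT; have h0 : 0 <= t - s by rewrite subr_ge0.
have hT : t - s <= T by rewrite lerBlDr (le_trans tT)// lerDl.
have sT : s <= T := le_trans st tT.
have sT' : 0 <= s <= T by rewrite s0.
have Y0 : rv2 (Y 0) by apply: rv2_Y; rewrite lexx ltW.
have r1 := rv2S h0 hT (rv2_mild (lexx 0) s0 sT).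
have r2 := rv2S h0 hT Y0.
have r3 := rv2_semigroup sT' r2.
have r4 := rv2S h0 hT (rv2_Y sT').
have -> : E2 (fun x => Y s x - Y t x) =
    E2 (fun x => mild_vector s t x + (S (t - s) (Y s x) - Y s x)).
  congr EX; apply/funext => x; rewrite /mild_vector addrA subrK.
  by rewrite -normrN opprB.
apply: (le_trans (E2D_le hV (rv2_mild s0 st tT) r4)).
rewrite (E2_mild_shift s0 st tT) lerD2l ler_wpM2l//.
have -> : E2 (fun x => S (t - s) (Y s x) - Y s x) =
    E2 (fun x => (S (t - s) (mild_vector 0 s x) - mild_vector 0 s x) + S s (S (t - s) (Y 0 x) - Y 0 x)).
  congr EX; apply/funext => x; congr (`|_| ^+ 2); rewrite /mild_vector subr0.
  rewrite !(semigroupB hS)// -!(semigroupD hS)// [s + _]addrC.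
  by rewrite [in RHS]opprB addrAC addrA addrA !subrK.
apply: (le_trans (E2D_le hV r1 r3)); rewrite lerD2l ler_wpM2l//.
by apply: (E2_le_map hV r3 r2) => x; exact: hC.
Qed.

Lemma mean_square_continuous t (eps : R) : 0 <= t <= T -> 0 < eps ->
  exists2 delta, 0 < delta & forall s, 0 <= s <= T -> `|s - t| <= delta ->
    E2 (fun x => Y s x - Y t x) <= eps.
Proof.
move=> /andP[t0 tT] eps0; have tT' : 0 <= t <= T by rewrite t0.
pose kap := kmean * (C * (C + 1)).
have kap2 : 0 <= kap ^+ 2 by exact: sqr_ge0.
have C2 : 0 <= C ^+ 2 by exact: sqr_ge0.
(* The left estimate adds up to [18 * eta + 4 * C ^+ 2 * eta] and the right one to [4 * eta]. *)
pose eta := eps / (20 * (1 + C ^+ 2)).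
have k0 : 0 < 20 * (1 + C ^+ 2) by rewrite mulr_gt0// ltr_pwDl.
have eta0 : 0 < eta by rewrite divr_gt0.
have epsE : eps = 20 * (1 + C ^+ 2) * eta by rewrite /eta mulrC divfK// gt_eqF.
have c2eta : 0 <= C ^+ 2 * eta by rewrite mulr_ge0// ltW.
have [d1 d10 h1] := E2_mild_small eta0.
have small Z (rZ : rv2 Z) := E2_semigroup_small rZ eta0.
have Y0 : rv2 (Y 0) by apply: rv2_Y; rewrite lexx ltW.
have [d2 d20 h2] := small _ (rv2_Y tT').
have [d3 d30 h3] := small _ (rv2_mild (lexx 0) t0 tT).
have [d4 d40 h4] := small _ Y0.
have k1 : 0 < 1 + T * kap ^+ 2 by rewrite ltr_pwDl// mulr_ge0// ltW.
(* Controls the squared mean term: one factor [t - s] is bounded by [T], the other by [d5]. *)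
pose d5 := eta / (1 + T * kap ^+ 2).
have d50 : 0 < d5 by rewrite divr_gt0.
exists (Num.min d1 (Num.min d2 (Num.min d3 (Num.min d4 d5)))).
  by rewrite !lt_min d10 d20 d30 d40 d50.
move=> s /andP[s0 sT]; rewrite !le_min => /and5P[e1 e2 e3 e4 e5].
have [st|ts] := leP s t.
  have h0 : 0 <= t - s by rewrite subr_ge0.
  have hT : t - s <= T by rewrite lerBlDr (le_trans tT)// lerDl.
  rewrite distrC ger0_norm// in e1 e2 e3 e4 e5.
  apply: (le_trans (increment_left s0 st tT)).
  have i1 := h1 _ h0 hT e1; have i3 := h3 _ h0 hT e3; have i4 := h4 _ h0 hT e4.
  have i := E2_left_increment  s0 st tT h0 hT.
  have i5 : ((t - s) * kmean * (C * (C + 1))) ^+ 2 <= eta.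
    rewrite -mulrA -/kap exprMn.
    have : (t - s) * (1 + T * kap ^+ 2) <= eta by rewrite -ler_pdivlMr.
    apply: le_trans; rewrite expr2 -mulrA ler_wpM2l//.
    by rewrite -[leLHS]add0r lerD// ler_wpM2r.
  have i4' : C ^+ 2 * E2 (fun x => S (t - s) (Y 0 x) - Y 0 x) <= C ^+ 2 * eta by rewrite ler_wpM2l.
  by rewrite epsE; lra.
have h0 : 0 <= s - t by rewrite subr_ge0 ltW.
have hT : s - t <= T by rewrite lerBlDr (le_trans sT)// lerDl.
rewrite ger0_norm// in e1 e2 e3 e4 e5.
apply: (le_trans (increment_right t0 (ltW ts) sT)).
have i1 := h1 _ h0 hT e1; have i2 := h2 _ h0 hT e2.
by rewrite epsE; lra.
Qed.

End MeanSquareContinuity.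

End Solution.

(** [Bs] is given only through the duality relation; linearity and boundedness follow because scalar
    products determine a vector and its norm. *)
Lemma hilbert_adjoint_bounded (R : realType) (U V : completeNormedModType R)
  (ipU : U -> U -> R) (ipV : V -> V -> R) (hU : separable_hilbert ipU) (hV : separable_hilbert ipV)
  (B : U -> V) (Bs : V -> U) : bounded_linear B ->
  (forall u v, ipV (B u) v = ipU u (Bs v)) ->
  (forall (k : R) x y, Bs (k *: x + y) = k *: Bs x + Bs y) /\
  exists2 beta : R, 0 <= beta & forall v, `|Bs v| <= beta * `|v|.
Proof.
move=> hB hBs; split=> [k x y|].
  by apply: (ip_inj hU) => u; rewrite (ipDr hU) (ipZr hU) -!hBs (ipDr hV) (ipZr hV).
have [c c0 hc] := bounded_linear_bound hB; exists c => // v.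
apply: (norm_le_ip hU) => [|u]; first by rewrite mulr_ge0.
rewrite -hBs (le_trans (ler_norm _))// (le_trans (ip_CS hV _ _))//.
by rewrite mulrAC ler_wpM2r.
Qed.

Theorem theorem5p8 (R : realType) (d : measure_display) (Omega : measurableType d)
  (P : probability Omega R)
  (U V : completeNormedModType R) (ipU : U -> U -> R) (ipV : V -> V -> R)
  (hU : separable_hilbert ipU) (hV : separable_hilbert ipV)
  (A : V -> V) (DA : set V) (hA : generates_C0 A DA)
  (B : U -> V) (hB : bounded_linear B)
  (Bstar : V -> U) (hBstar : forall u v, ipV (B u) v = ipU u (Bstar v))
  (y0 : V) (L : R -> U -> Omega -> R) (hL : cylindrical_levy P L)
  (hL2 : forall u : U, (\int[P]_w ((L 1 u w) ^+ 2)%:E < +oo)%E)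
  (Tend : R) (F : R -> set (set Omega)) (hF : filtration F)
  (Y : R -> Omega -> V)
  (hY : weak_solution P ipV A DA Bstar y0 L Tend F Y)
  (hY2 : forall t, 0 <= t <= Tend -> (\int[P]_w ((`|Y t w| ^+ 2)%:E) < +oo)%E) :
  forall t, 0 <= t <= Tend ->
    (fun s => (\int[P]_w ((`|Y s w - Y t w| ^+ 2)%:E))%E)
      @ within `[0, Tend] (nbhs t) --> 0%E.
Proof.
move=> t tT; have /andP[t0 tT'] := tT.
have [hprog hint hsmall heq] := hY.
(* A limit in the extended reals asks for eventual finiteness and for convergence of the finite
   parts; one bound by [e%:E] gives both. *)
suff key (e : R) : 0 < e -> exists2 dl : R, 0 < dl & forall s, 0 <= s <= Tend ->
    `|s - t| <= dl -> (\int[P]_w ((`|Y s w - Y t w| ^+ 2)%:E) <= e%:E)%E.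
  have near_le (e : R) : 0 < e -> \forall s \near within `[0, Tend] (nbhs t),
      (\int[P]_w ((`|Y s w - Y t w| ^+ 2)%:E) <= e%:E)%E.
    move=> /key[dl dl0 hdl]; rewrite near_withinE.
    apply: filterS (nbhsx_ballx t dl dl0) => s /= hs; rewrite in_itv => sT.
    by apply: hdl => //; rewrite distrC ltW.
  have int_ge0 s : (0 <= \int[P]_w ((`|Y s w - Y t w| ^+ 2)%:E))%E.
    by apply: integral_ge0 => w _; rewrite lee_fin sqr_ge0.
  apply/fine_cvgP; split.
    apply: filterS (near_le 1 ltr01) => s hs.
    by rewrite fin_real// (lt_le_trans _ (int_ge0 s)) ?ltNyr//= (le_lt_trans hs) ?ltry.
  apply/cvgrPdist_le => e e0; apply: filterS (near_le e e0) => s hs /=.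
  rewrite sub0r normrN ger0_norm ?fine_ge0//.
  by have := int_ge0 s; move: hs; case: (\int[P]_w _)%E => //= r.
(* The solution lemmas need a positive horizon. Otherwise the interval reduces to the point 0 and
   the integral vanishes. *)
move=> e0; have [Tpos|Tneg] := ltP 0 Tend; last first.
  exists 1 => // s /andP[s0 sT] _.
  have tz : t = 0 by apply/eqP; rewrite eq_le t0 (le_trans tT').
  have sz : s = 0 by apply/eqP; rewrite eq_le s0 (le_trans sT).
  rewrite sz tz (_ : (fun w => _) = fun=> 0%E); last first.
    by apply/funext => w; rewrite subrr normr0 expr0n.
  by rewrite integral0 lee_fin ltW.
have [S [hS hgen]] := hA.
have [Ss hSs] := semigroup_adjoint_exists hV hS.
have [J hJ] := weak_integral_exists hV hS.
have [C C_ge1 hC] := semigroup_bound hS Tend.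
have [Cl Cl0 hCl] := levy_m2_bound hL hL2.
have [Bs_linear [beta beta0 hbeta]] := hilbert_adjoint_bounded hU hV hB hBstar.
have [dl dl0 hdl] := mean_square_continuous hV Tpos hF hprog hint hsmall hL hL2 Bs_linear heq
  hS hgen hSs C_ge1 hC Cl0 hCl beta0 hbeta hY2 hJ tT e0.
exists dl => // s sT sd; have := hdl s sT sd; rewrite -lee_fin /E2 EX_EFin//.
apply: (rv2_Int hV); apply: (rv2B hV); exact: (rv2_Y hV Tpos hF hprog hY2).
Qed.
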